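(* $A_2(8,6;4)\le 272$. That is, every $(8,N,6;4)_2$ constant dimension code satisfies $N\le 272$.
   Context: Let $V\cong\mathbb{F}_q^v$ be a $v$-dimensional vector space over the field $\mathbb{F}_q$ with $q$ elements, and let $L(V)$ be the set of all subspaces of $V$. The subspace distance on $L(V)$ is $\mathrm{d}_{\mathrm{s}}(U,W)=\dim(U+W)-\dim(U\cap W)=\dim(U)+\dim(W)-2\dim(U\cap W)$. A subspace code is a subset $C\subseteq L(V)$; its elements are called codewords. It has minimum distance $d$ if $d\le \mathrm{d}_{\mathrm{s}}(U,W)$ for all $U\neq W$ in $C$, with equality attained at least once. A $(v,N,d;k)_q$ constant dimension code is a subspace code in $V$ of size $N$ and minimum distance $d$ all of whose codewords have dimension $k$. $A_q(v,d;k)$ denotes the maximum size $N$ of a $(v,N,d;k)_q$ constant dimension code. *)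

(* Defs.v *)
From HB Require Import structures.
From mathcomp Require Import all_boot all_order all_algebra.

Set Implicit Arguments.
Unset Strict Implicit.
Unset Printing Implicit Defensive.

Section FiniteSubspaceLattice.
Variables (F : finFieldType) (V : vectType F).

(* A subspace is encoded by a square matrix over F, so there are finitely    *)
(* many subspaces and codes can be taken in {set {vspace V}}.                *)
Let vs2mx_pcan := can_pcan (@VectorInternalTheory.vs2mxK F V).
HB.instance Definition _ :=
  Choice_isCountable.Build {vspace V} (pcan_pickleK vs2mx_pcan).
HB.instance Definition _ :=
  isFinite.Build {vspace V} (pcan_enumP vs2mx_pcan).

End FiniteSubspaceLattice.

Section SubspaceCodes.
Variables (F : finFieldType) (V : vectType F).
Implicit Types (U W : {vspace V}) (C : {set {vspace V}}).

(* The natural-number subtraction never truncates: U :&: W <= U + W. *)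
Definition subspace_dist U W : nat := \dim (U + W) - \dim (U :&: W).

Lemma subspace_distE U W :
  subspace_dist U W = \dim U + \dim W - 2 * \dim (U :&: W).
Proof. by rewrite /subspace_dist -dimv_sum_cap mul2n -addnn subnDr. Qed.

(* The second conjunct requires the value d to be attained, so codes with at *)
(* most one codeword have no minimum distance.                               *)
Definition has_min_distance (d : nat) C : bool :=
  [forall U in C, forall W in C, (U != W) ==> (d <= subspace_dist U W)] &&
  [exists U in C, exists W in C, (U != W) && (subspace_dist U W == d)].

(* C is a (v, N, d; k)_q constant dimension code, where q = #|F|. *)
Definition constant_dim_code (v N d k : nat) C : bool :=
  [&& \dim {:V} == v, #|C| == N, has_min_distance d C
    & [forall U in C, \dim U == k]].

(* A_q(v, d; k) for q = #|F| and v = \dim {:V}; it is 0 if there is no such  *)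
(* code.                                                                     *)
Definition max_code_size (d k : nat) : nat :=
  \max_(C : {set {vspace V}} | constant_dim_code (\dim {:V}) #|C| d k C) #|C|.

End SubspaceCodes.

Arguments max_code_size {F} V d k.

(* Main.v *)
Require Import Defs.
From mathcomp Require Import all_boot all_order all_algebra all_field.
From mathcomp Require Import zify.
From Stdlib Require Import NArith.
Set Implicit Arguments. Unset Strict Implicit. Unset Printing Implicit Defensive.

(** Let C have at least 273 codewords, a(P) of them through the point P and c(h)
    of them in the hyperplane h; a(P), c(h) <= 17. Counting the codewords of the
    flags (P, h) shows that for a(P) = 17 exactly eight hyperplanes h through P
    contain three of the codewords through P. If, for each such P, these eight h
    satisfy sum wt(17 - c(h)) >= 14, where wt = 0, 0, 2, 2, 3, 3, ..., then a
    double count of the flags, applied to C and to its dual code, forces more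
    points with a(P) = 17 than hyperplanes with c(h) = 17 and vice versa.

    The inequality is local. In V/P the codewords through P are 17 planes, the
    other codewords are planes of functionals. If it fails, some h has
    c(h) >= 16; its three planes span h/P as A + B with C diagonal, and the other
    14 planes meet h/P in lines (x, y), whose first coordinates run through every
    line of F_2^3 exactly twice. A search over the seven pairs, up to the group
    GL_3(2) x Z_2, leaves three sets of 14 lines with room for 13 dual lines.
    Lifting the lines back to planes gives 36 configurations: in 27 of them the
    inequality holds, since few functional planes are available, and the other
    nine are isomorphic to one configuration, for which a weighting of the 864
    available functional planes allows at most 252 of them, while there are at
    least 256. *)

(** * Number vectors *)

(** The bound is where the degrees average 16: a codeword has 15 of the 255 points, so 273 codewords
    give sum (16 - a(P)) <= -15, and only points of degree 17 contribute negatively. The weights are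
    calibrated against this sum. At a point of degree a, the number g of hyperplanes holding exactly
    three of its codewords satisfies 2 g <= a^2 - 31 a + 254 and 6 g <= a^2 - a, whence wt(17 - a) g
    <= 14 max(0, 16 - a); at a = 15 this reads 2 * 7 <= 14. Summing the local inequality of the dual
    code over the hyperplanes with c(h) = 17, H in number, gives 14 H <= 14 sum max(0, 16 - a(P)) <=
    14 (Z - 15), where Z counts the points of degree 17. The threshold 14 also starts the local
    analysis: eight hyperplanes of weight at least 2 would give 16, so a failure produces a
    hyperplane of weight 0, that is, with c(h) >= 16. The case analysis takes place in V/P, which
    has 128 vectors; vectors and functionals are binary numbers below 128 and sets of them are bit
    masks, so that the search can be run by evaluation. *)

Fixpoint parp (p : positive) : bool :=
  match p with xH => true | xO q => parp q | xI q => ~~ parp q end.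
Definition par (x : N) : bool := if x is Npos p then parp p else false.

Notation "x ^^ y" := (N.lxor x y) (at level 50, left associativity).
Notation "x &&& y" := (N.land x y) (at level 40, left associativity).

Lemma par_lxor x y : par (x ^^ y) = par x (+) par y.
Proof.
case: x y => [|p] [|q] //=; first by rewrite addbF.
elim: p q => [p IH|p IH|] [q|q|] /=;
  try (have := IH q; case: (Pos.lxor p q) => [|r] /=; case: (parp p); case: (parp q) => //=; by case: (parp r)).
all: try by case: (parp _).
by [].
Qed.

Lemma landC x y : x &&& y = y &&& x. Proof. exact: N.land_comm. Qed.

Lemma land_lxorl x y z : (x ^^ y) &&& z = (x &&& z) ^^ (y &&& z).
Proof.
apply: N.bits_inj => n; rewrite !(N.land_spec, N.lxor_spec).
by case: (N.testbit x n); case: (N.testbit y n); case: (N.testbit z n).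
Qed.

(** The standard bilinear form over F_2 on binary expansions. It identifies functionals with numbers
    too. *)
Definition pdot x k := par (x &&& k).
Lemma pdotC x k : pdot x k = pdot k x. Proof. by rewrite /pdot landC. Qed.
Lemma pdotD x y k : pdot (x ^^ y) k = pdot x k (+) pdot y k.
Proof. by rewrite /pdot land_lxorl par_lxor. Qed.
Lemma pdotDr x y k : pdot k (x ^^ y) = pdot k x (+) pdot k y.
Proof. by rewrite pdotC pdotD !(pdotC k). Qed.

Definition rng (n : nat) : seq N := [seq N.of_nat i | i <- iota 0 n].
Definition R7 := rng 128.

Lemma mem_rng n x : (x \in rng n) = (N.to_nat x < n).
Proof.
apply/mapP/idP => [[i] | H]; first by rewrite mem_iota => /andP[_ H] ->; rewrite Nnat.Nat2N.id.
by exists (N.to_nat x); rewrite ?mem_iota // Nnat.N2Nat.id.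
Qed.

Lemma rng_uniq n : uniq (rng n).
Proof. by rewrite map_inj_uniq ?iota_uniq // => i j /Nnat.Nat2N.inj. Qed.

Lemma size_rng n : size (rng n) = n. Proof. by rewrite size_map size_iota. Qed.

Lemma mem_R7 x : (x \in R7) = (N.ltb x 128).
Proof. by rewrite mem_rng; apply/idP/idP => H; [apply/N.ltb_lt; lia | move/N.ltb_lt: H; lia]. Qed.

Lemma log2_lt x : x \in R7 <-> N.shiftr x 7 = 0%num.
Proof.
rewrite mem_R7; split=> [/N.ltb_lt H | H].
  by rewrite N.shiftr_div_pow2 N.div_small.
apply/N.ltb_lt; move: H; rewrite N.shiftr_div_pow2 => /N.div_small_iff; apply; by [].
Qed.

Lemma R7_lxor x y : x \in R7 -> y \in R7 -> x ^^ y \in R7.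
Proof. by move=> /log2_lt Hx /log2_lt Hy; apply/log2_lt; rewrite N.shiftr_lxor Hx Hy. Qed.

Lemma lxorK x y : x ^^ y ^^ y = x.
Proof. by rewrite N.lxor_assoc N.lxor_nilpotent N.lxor_0_r. Qed.

Lemma lxor_eq0 x y : x ^^ y = 0%num -> x = y. Proof. exact: N.lxor_eq. Qed.

Section Lin.
Variables (A : Type) (op : A -> A -> A) (z : A).
(** The combination of the vectors [b] whose coefficients are the binary digits of [x]; a basis thus
    acts as a linear map on numbers. The target is kept general because it is also used for Booleans
    under [addb] and for the abstract space of the code. *)
Fixpoint lin (b : seq A) (x : N) : A :=
  if b is v :: b' then op (if N.odd x then v else z) (lin b' (N.div2 x)) else z.
Hypotheses (opA : associative op) (opC : commutative op) (op0 : right_id z op)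
  (opvv : forall v, op v v = z).

Lemma lin_lxor b x y : lin b (x ^^ y) = op (lin b x) (lin b y).
Proof.
elim: b x y => [|v b IH] x y /=; first by rewrite opvv.
rewrite -!N.bit0_odd N.lxor_spec !N.div2_spec N.shiftr_lxor IH.
set s := lin b _; set t := lin b _.
case: (N.testbit x 0); case: (N.testbit y 0) => /=; rewrite ?op0.
- by rewrite (opC z) op0 (opC v s) -opA (opA v v) opvv (opC z) op0.
- by rewrite -!opA (opC z) op0.
- by rewrite (opC z s) op0 !opA (opC v s).
- by rewrite !(opC z) !op0.
Qed.
End Lin.

Notation linN := (lin N.lxor 0%num).

Lemma linN_lxor b x y : linN b (x ^^ y) = linN b x ^^ linN b y.
Proof.
apply: lin_lxor; [exact: (fun a b c => esym (N.lxor_assoc a b c)) | exact: N.lxor_comm |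
  exact: N.lxor_0_r | exact: N.lxor_nilpotent].
Qed.

Lemma linN_R7 b x : {subset b <= R7} -> linN b x \in R7.
Proof.
elim: b x => [|v b IH] x Hb //=; apply: R7_lxor; last by apply: IH => y yb; apply: Hb; rewrite inE yb orbT.
by case: (N.odd x) => //; apply: Hb; rewrite inE eqxx.
Qed.

Lemma linN0 b : linN b 0%num = 0%num. Proof. by elim: b => //= v b ->. Qed.

Lemma R7_surj (f : N -> N) : {in R7, forall x, f x \in R7} -> {in R7 &, injective f} ->
  forall y, y \in R7 -> exists2 x, x \in R7 & f x = y.
Proof.
move=> fR fI y yR; have Us : uniq (map f R7) by rewrite map_inj_in_uniq ?rng_uniq.
have sub : {subset map f R7 <= R7} by move=> _ /mapP[x xR ->]; apply: fR.
have [|_ E] := uniq_min_size Us sub; first by rewrite size_map.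
by move: yR; rewrite -E => /mapP[x xR ->]; exists x.
Qed.

Lemma perm_R7 (f : N -> N) : {in R7, forall x, f x \in R7} -> {in R7 &, injective f} ->
  perm_eq (map f R7) R7.
Proof.
move=> fR fI; have Us : uniq (map f R7) by rewrite map_inj_in_uniq ?rng_uniq.
have sub : {subset map f R7 <= R7} by move=> _ /mapP[x xR ->]; apply: fR.
by have [|_ E] := uniq_min_size Us sub; rewrite ?size_map //; apply: uniq_perm; rewrite ?rng_uniq.
Qed.

Opaque R7.

(** The weight of a deficiency 17 - a. Deficiency at most 1 must weigh 0 and deficiency 2 at most 2
    for [wt_bound] to hold. *)
Definition wt c := if c <= 1 then 0 else if c <= 3 then 2 else 3.

(** * Local systems: planes of V/P and planes of functionals *)

Definition orth (q : N -> bool) k := all (fun x => q x ==> ~~ pdot x k) R7.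

Definition closed (q : N -> bool) :=
  q 0%num /\ {in R7 &, forall x y, q x -> q y -> q (x ^^ y)}.

Section Sys.
Variables (X : finType) (I J : {set X}).
Implicit Types p d : X -> N -> bool.

Definition nI p k := #|[set i in I | orth (p i) k]|.
Definition nJ d k := #|[set j in J | d j k]|.

(* The codewords through a point P of degree 17 give 17 planes [p i] of V/P;
   the others give the planes [d j] of functionals vanishing on P and on the codeword. *)
Record sys p d : Prop := Sys {
  sys_cI : #|I| = 17;
  sys_cJ : 256 <= #|J|;
  sys_p : forall i, i \in I -> closed (p i) /\ count (p i) R7 = 8;
  sys_pp : forall i j x, i \in I -> j \in I -> i != j -> x \in R7 -> p i x -> p j x -> x = 0%num;
  sys_d : forall j, j \in J -> closed (d j) /\ count (d j) R7 = 8;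
  sys_dd : forall i j, i \in J -> j \in J -> i != j -> count (predI (d i) (d j)) R7 <= 2;
  sys_pd : forall i j, i \in I -> j \in J -> count (predI (d j) (orth (p i))) R7 <= 2;
  sys_8 : count (fun k => nI p k == 3) R7 = 8 }.

(** Such a hyperplane holds three codewords through P, so 17 - c(h) is 14 minus the number of
    functional planes through it. *)
Definition sgood p d := 14 <= \sum_(k <- R7 | nI p k == 3) wt (14 - nJ d k).

Lemma count_pull (f : N -> N) (q : N -> bool) :
  {in R7, forall x, f x \in R7} -> {in R7 &, injective f} -> count (q \o f) R7 = count q R7.
Proof. by move=> fR fI; rewrite -count_map; apply/permP; apply: perm_R7. Qed.

Lemma closed_pull (f : N -> N) q : {in R7, forall x, f x \in R7} ->
  (forall x y, f (x ^^ y) = f x ^^ f y) -> closed q -> closed (q \o f).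
Proof.
move=> fR fD [q0 qD]; split=> [|x y xR yR]; rewrite /= ?fD; last by apply: qD; apply: fR.
by rewrite -(N.lxor_nilpotent 0%num) fD N.lxor_nilpotent.
Qed.

Lemma orth_pull (f h : N -> N) (q : N -> bool) k :
  {in R7, forall x, f x \in R7} -> {in R7 &, injective f} ->
  {in R7, forall x, pdot (f x) (h k) = pdot x k} -> orth (q \o f) k = orth q (h k).
Proof.
move=> fR fI fh; apply/allP/allP => H x xR.
  by have [y yR <-] := R7_surj fR fI xR; have := H y yR; rewrite /= fh.
by rewrite /= -fh //; apply: H; apply: fR.
Qed.

(** Every change of coordinates passes through this lemma; [h] is the contragredient of [f].
    Goodness is carried from the new system to the old one, so a bad system stays bad. *)
Lemma sys_pull p d (f h : N -> N) :
  {in R7, forall x, f x \in R7} -> {in R7 &, injective f} -> (forall x y, f (x ^^ y) = f x ^^ f y) ->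
  {in R7, forall k, h k \in R7} -> {in R7 &, injective h} ->
  {in R7 &, forall x y, h (x ^^ y) = h x ^^ h y} ->
  {in R7 &, forall x k, pdot (f x) (h k) = pdot x k} ->
  sys p d ->
  sys (fun i => p i \o f) (fun j => d j \o h) /\
  {in R7, forall k, nI (fun i => p i \o f) k = nI p (h k)} /\
  (sgood (fun i => p i \o f) (fun j => d j \o h) -> sgood p d).
Proof.
move=> fR fI fD hR hI hD fh [cI cJ Hp Hpp Hd Hdd Hpd H8].
have f0 : f 0%num = 0%num by rewrite -(N.lxor_nilpotent 0%num) fD N.lxor_nilpotent.
have orthE i k : k \in R7 -> orth (p i \o f) k = orth (p i) (h k).
  by move=> kR; apply: orth_pull => // x xR; apply: fh.
have nIE : {in R7, forall k, nI (fun i => p i \o f) k = nI p (h k)}.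
  by move=> k kR; apply: eq_card => i; rewrite !inE orthE.
split; last split=> //; first (split=> //).
- by move=> i /Hp[cl c8]; split; [apply: closed_pull | rewrite count_pull].
- move=> i j x iI jI ij xR pi pj; have := Hpp _ _ _ iI jI ij (fR x xR) pi pj.
  by move=> fx0; apply: fI => //; rewrite ?fx0 ?f0 ?mem_R7.
- move=> j /Hd[[d0 dD] c8]; split; last by rewrite count_pull.
  split=> [|x y xR yR]; rewrite /= ?hD //; last by apply: dD; apply: hR.
  by rewrite -(N.lxor_nilpotent 0%num) hD ?N.lxor_nilpotent ?mem_R7.
- by move=> i j iJ jJ ij; have := Hdd _ _ iJ jJ ij; rewrite -(count_pull (f := h)).
- move=> i j iI jJ; have := Hpd _ _ iI jJ; rewrite -(count_pull (f := h)) // => H.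
  by apply: leq_trans H; apply: eq_leq; apply: eq_in_count => k kR; rewrite /= orthE //.
- by rewrite -H8 -[RHS](count_pull (f := h)) //; apply: eq_in_count => k kR; rewrite nIE.
rewrite /sgood => H; apply: leq_trans H _; apply: eq_leq.
have -> : \sum_(k <- R7 | nI p k == 3) wt (14 - nJ d k) =
    \sum_(k <- map h R7 | nI p k == 3) wt (14 - nJ d k).
  by apply: perm_big; rewrite perm_sym; apply: perm_R7.
rewrite [RHS]big_map big_seq_cond [RHS]big_seq_cond; apply: eq_bigl => k.
by case: (boolP (k \in R7)) => //= kR; rewrite -nIE.
Qed.
End Sys.

(** * The search *)

(* Unlike [all] and [has], these stop early under call by value. *)
Fixpoint vall (A : Type) (p : A -> bool) s := if s is x :: s' then (if p x then vall p s' else false) else true.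
Fixpoint vhas (A : Type) (p : A -> bool) s := if s is x :: s' then (if p x then true else vhas p s') else false.

Fixpoint disjp (a b : positive) : bool :=
  match a, b with
  | xO a', xO b' | xO a', xI b' | xI a', xO b' => disjp a' b'
  | xI _, xI _ | xH, xI _ | xI _, xH | xH, xH => false
  | xH, xO _ | xO _, xH => true
  end.
Definition disj a b := match a, b with Npos a, Npos b => disjp a b | _, _ => true end.

Definition mk (s : seq N) : N := foldr (fun x m => N.setbit m x) 0%num s.
Definition bit m x := N.testbit m x.
Fixpoint ptsp (p : positive) (i : N) : seq N :=
  match p with xH => [:: i] | xO q => ptsp q (N.succ i) | xI q => i :: ptsp q (N.succ i) end.
Definition pts (m : N) := if m is Npos p then ptsp p 0%num else [::].

(** Points (x, y) outside A (y = 0), B (x = 0) and C (x = y). Read for a functional, the same test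
    says that it vanishes on none of A, B, C; hence lines and dual lines share the lists [P42] and
    [Ls]. *)
Definition isp z := let x := N.land z 7 in let y := N.shiftr z 3 in
  [&& x != 0%num, y != 0%num & x != y].
Definition P42 := [seq z <- rng 64 | isp z].
Definition Ls := flatten [seq [seq mk [:: p; q; p ^^ q] | q <- P42 & [&& N.ltb p q, N.ltb q (p ^^ q) & isp (p ^^ q)]] | p <- P42].
(** A line of [Ls] misses B, so the projection along B is injective on it and the domain is a line
    of the Fano plane. *)
Definition dom m := mk [seq N.land x 7 | x <- pts m].
Definition fano := [:: mk [:: 1; 2; 3]; mk [:: 1; 4; 5]; mk [:: 1; 6; 7]; mk [:: 2; 4; 6]; mk [:: 2; 5; 7]; mk [:: 3; 4; 7]; mk [:: 3; 5; 6]]%num.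
Definition orthpts s t := vall (fun x => vall (fun y => ~~ pdot x y) t) s.
(* two lines with the same domain, their union, the mask of the dual lines compatible with both *)
Definition entry : Type := (N * N * N * N)%type.
Definition E a b c d : entry := (a, b, c, d).
Definition e1 (e : entry) := e.1.1.1.
Definition e2 (e : entry) := e.1.1.2.
Definition em (e : entry) := e.1.2.
Definition ea (e : entry) := e.2.
(** Bit i tells whether the i-th line, read as a dual line, fails to annihilate [s]; by [not_orthl]
    an annihilating dual line cannot occur. *)
Definition avmask (Lp : seq (N * seq N)) (s : seq N) : N :=
  foldr (fun t a => if orthpts s t.2 then N.double a else N.succ_double a) 0%num Lp.
Fixpoint pairsof (l : seq (N * N)) : seq entry :=
  if l is (m, a) :: l' then
    [seq E m t.1 (N.lor m t.1) (N.land a t.2) | t <- l' & disj m t.1] ++ pairsof l'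
  else [::].
Definition Lp := [seq (m, pts m) | m <- Ls].
Definition LT := [seq (t.1, avmask Lp t.2, dom t.1) | t <- Lp].
Definition entries := let T := LT in
  [seq (d, pairsof [seq t.1 | t <- T & t.2 == d]) | d <- fano].

Section DFS.
Variables (K T S : Type) (tm : T -> N) (step : S -> T -> S) (prune leaf : S -> bool).
Fixpoint shorter (A B : Type) (a : seq A) (b : seq B) :=
  match a, b with [::], _ :: _ => true | _ :: a', _ :: b' => shorter a' b' | _, _ => false end.
Fixpoint pick (x : K * seq T) (r : seq (K * seq T)) :=
  if r is y :: r' then
    if shorter y.2 x.2 then let: (b, s) := pick y r' in (b, x :: s)
    else let: (b, s) := pick x r' in (b, y :: s)
  else (x, [::]).
(** Chooses one item from each keyed list, with pairwise disjoint masks, branching on a shortest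
    list. The value [true] means that no choice survives, so [false] is the safe answer when the
    fuel [n] is exhausted. *)
Fixpoint dfs n (st : S) (rem : seq (K * seq T)) : bool :=
  if prune st then true else
  if n is n'.+1 then
  if rem is x :: r then
    let: (b, s) := pick x r in
    vall (fun e => dfs n' (step st e) [seq (l.1, [seq t <- l.2 | disj (tm t) (tm e)]) | l <- s]) b.2
  else leaf st else false.
End DFS.

Section Mu.
Definition Pm := [seq mk [:: z] | z <- P42].
Fixpoint best (c : N * nat) (cs : seq (N * nat)) :=
  if cs is c' :: r then best (if (c.2 == 0) || (0 < c'.2 < c.2) then c' else c) r else c.1.
(** The value [true] certifies that [l] has no [k] pairwise disjoint lines, which would meet 3k
    points. Otherwise the branching is at a point [z] on fewest lines: one of its lines is taken, or
    all are dropped. *)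
Fixpoint mu n k (l : seq N) : bool :=
  let cs := [seq (z, count (fun m => ~~ disj m z) l) | z <- Pm] in
  if count (fun t => 0 < t.2) cs < 3 * k then true else
  if n is n'.+1 then if k is k'.+1 then
    let z := best (0%num, 0) cs in
    if vall (fun m => mu n' k' [seq t <- l | disj t m]) [seq m <- l | ~~ disj m z] then mu n' k [seq t <- l | disj t z] else false
  else false else false.
End Mu.

Definition GL3 : seq (N * N * N) :=
  let r := behead (rng 8) in
  flatten [seq flatten [seq [seq (a, b, c) | c <- r & [&& c != a, c != b & c != a ^^ b]] | b <- r & a != b] | a <- r].
Definition dual3 t := let: (a, b, c) := t in
  let f u v w := head 0%num [seq k <- rng 8 | [&& pdot u k, ~~ pdot v k & ~~ pdot w k]] in
  (f a b c, f b a c, f c a b).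
Definition e8 x := N.shiftl x 3.
(** The involution (x, y) -> (x, x + y) fixes B and swaps A with C. The other permutations of A, B,
    C would move B and so would not respect [dom]. *)
Definition mkb (s : bool) t := let: (a, b, c) := t in
  let g u := if s then u ^^ e8 u else u in [:: g a; g b; g c; e8 a; e8 b; e8 c; 64%num].
Definition mkd (s : bool) t := let: (a, b, c) := t in
  let g u := if s then u ^^ e8 u else e8 u in [:: a; b; c; g a; g b; g c; 64%num].
Definition group : seq (seq N * seq N) := [seq (mkb s t, mkd s (dual3 t)) | s <- [:: false; true], t <- GL3].

Definition stdb := [seq N.pow 2 (N.of_nat i) | i <- iota 0 7].
Definition gram (b d : seq N) := [seq [seq pdot v w | w <- d] | v <- b].
Definition dualb b d := vall (fun x => N.ltb x 128) (b ++ d) && (gram b d == gram stdb stdb).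
Definition imgm b m := mk [seq linN b x | x <- pts m].
Definition orbit (r : N * N) := [seq (imgm g.1 r.1, imgm g.1 r.2) | g <- group].
(** Orbit representatives of pairs of disjoint lines with a common domain. Their completeness is not
    presupposed: [stages] ends by testing that removing the orbits has emptied the lists. *)
Definition reps : seq (N * N) := [seq (mk r.1, mk r.2) | r <- [::
  ([:: 10; 33; 43], [:: 11; 34; 41]); ([:: 10; 33; 43], [:: 11; 49; 58]);
  ([:: 10; 33; 43], [:: 19; 34; 49]); ([:: 10; 33; 43], [:: 19; 41; 58]);
  ([:: 10; 33; 43], [:: 26; 35; 57]); ([:: 10; 33; 43], [:: 26; 41; 51]);
  ([:: 10; 19; 25], [:: 11; 33; 42]); ([:: 10; 19; 25], [:: 11; 17; 26])]]%num.

(* state: lines, available dual lines, depth *)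
Record state := St { sl : seq N; sa : N; sd : nat }.
Definition sstep st e := St [:: e1 e, e2 e & sl st] (N.land (sa st) (ea e)) (sd st).+1.
Definition fold_bits (A : Type) (f : A -> bool) (s : seq A) : N :=
  foldr (fun t a => if f t then N.succ_double a else N.double a) 0%num s.
Definition ptmask := [seq fold_bits (bit^~ z) Ls | z <- P42].
Definition dead (pm : seq N) a := count (disj a) pm.
(** Thirteen disjoint dual lines cover 39 of the 42 points, so at most three points may lie on no
    available dual line. *)
Definition sprune dp pm st := (dp <= sd st) && (4 <= dead pm (sa st)).
Fixpoint avl (a : N) (l : seq N) := if l is m :: l' then
  (if N.odd a then cons m else id) (avl (N.div2 a) l') else [::].
Definition samepair (r : N * N) e :=
  N.eqb r.1 (e1 e) && N.eqb r.2 (e2 e) || N.eqb r.2 (e1 e) && N.eqb r.1 (e2 e).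
Definition remove (o : seq (N * N)) (ents : seq (N * seq entry)) :=
  let od := [seq (dom r.1, r) | r <- o] in
  [seq let ol := [seq x.2 | x <- od & N.eqb x.1 l.1] in
       (l.1, [seq e <- l.2 | ~~ vhas (samepair^~ e) ol]) | l <- ents].

(* planes through a line of K, as 128 bit masks *)
Definition coset l q := mk (q :: [seq q ^^ x | x <- pts l]).
Definition qreps l := let P := pts l in [seq q <- rng 64 | vall (fun x => N.ltb q (q ^^ x)) P].
Definition plane l q := N.lor (N.setbit l 0) (N.shiftl (coset l q) 64).
Definition liftsof l qs := (l, [seq (coset l q, plane l q) | q <- qs]).
(** After the first line has been lifted with q = 0, the shears 64 -> 64 + t with t on that line
    still preserve this lift, so the second lift matters only modulo both lines. *)
Definition qreps2 l l' := let P := 0%num :: pts l in [seq q <- qreps l' | vall (fun t => vall (fun x => N.leb q (q ^^ t ^^ x)) P) (0%num :: pts l')].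
Definition planeA := mk [:: 0; 1; 2; 3; 4; 5; 6; 7]%num.
Definition planeB := mk [:: 0; 8; 16; 24; 32; 40; 48; 56]%num.
Definition planeC := mk [:: 0; 9; 18; 27; 36; 45; 54; 63]%num.
(** Planes over disjoint lines can meet only outside the hyperplane, so only the cosets are
    compared. The fuel 15 serves 14 lines and the leaf. *)
Definition lifts (kill : seq N -> bool) l0 l1 ls :=
  if ~~ uniq [:: l0, l1 & ls] then false else
  dfs fst (fun st t => t.2 :: st) (fun _ => false) kill 15 [:: planeA; planeB; planeC]
   (liftsof l0 [:: 0%num] :: liftsof l1 (qreps2 l0 l1) :: [seq liftsof l (qreps l) | l <- ls]).

(* tables indexed by the binary digits of a number *)
Inductive tree (A : Type) := Lf of A | Nd of tree A & tree A.
Fixpoint build A n (f : N -> A) : tree A :=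
  if n is n'.+1 then Nd (build n' (fun x => f (N.double x))) (build n' (fun x => f (N.succ_double x)))
  else Lf (f 0%num).
Fixpoint look A (t : tree A) (x : N) : A :=
  match t with Lf a => a | Nd l r => look (if N.odd x then r else l) (N.div2 x) end.

Definition pperp m := let P := pts m in build 7 (fun k => vall (fun x => ~~ pdot x k) P).
(** Marks the forbidden pairs: by [sys_pd], two distinct nonzero functionals that vanish on a common
    plane of the configuration never lie in one functional plane. *)
Definition badtab (ps : seq (tree bool)) :=
  build 7 (fun k => let pk := [seq p <- ps | look p k] in build 7 (fun y => vhas (fun p => look p y) pk)).
(** Counts the y such that k, y and some z span a plane none of whose seven lines is forbidden. A
    functional plane through k supplies six such y, and two of these planes share none; this is the
    divisor 6 in [alivetest]. *)
Definition alive (bt : tree (tree bool)) k :=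
  let bk := look bt k in
  let Y := [seq y <- R7 | if look bk y then false else if N.eqb y 0 then false else ~~ N.eqb y k] in
  count (fun y => let b := look bt y in let b' := look bt (y ^^ k) in vhas (fun z =>
    if look b z then false else if look bk (y ^^ z) then false else
    if look b (z ^^ k) then false else if look b' z then false else if look b' (z ^^ k) then false
    else if N.eqb y z then false else ~~ N.eqb z (y ^^ k)) Y) Y.
Definition alivetest cfg := let ps := [seq pperp m | m <- cfg] in let bt := badtab ps in
  14 <= sumn [seq wt (14 - alive bt k %/ 6) | k <- R7 & count (fun p => look p k) ps == 3].

(** The exceptional configuration. Its 17 planes leave eight points of V/P uncovered, the holes 96,
    ..., 103, which form the coset 96 + A. *)
Definition CF : seq N := map mk [:: [:: 0; 1; 2; 3; 4; 5; 6; 7]; [:: 0; 8; 16; 24; 32; 40; 48; 56];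
 [:: 0; 9; 18; 27; 36; 45; 54; 63]; [:: 0; 22; 47; 57; 64; 86; 111; 121];
 [:: 0; 25; 44; 53; 65; 88; 109; 116]; [:: 0; 13; 19; 30; 66; 79; 81; 92];
 [:: 0; 15; 50; 61; 67; 76; 113; 126]; [:: 0; 21; 34; 55; 72; 93; 106; 127];
 [:: 0; 28; 39; 59; 78; 82; 105; 117]; [:: 0; 12; 17; 29; 70; 74; 87; 91];
 [:: 0; 14; 52; 58; 71; 73; 115; 125]; [:: 0; 20; 42; 62; 68; 80; 110; 122];
 [:: 0; 11; 37; 46; 85; 94; 112; 123]; [:: 0; 23; 38; 49; 77; 90; 107; 124];
 [:: 0; 10; 33; 43; 83; 89; 114; 120]; [:: 0; 31; 35; 60; 75; 84; 104; 119];
 [:: 0; 26; 41; 51; 69; 95; 108; 118]]%num.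
Definition isotest isos cfg :=
  vhas (fun g : seq N * seq N => vall (fun m => vhas (N.eqb (imgm g.1 m)) cfg) CF) isos.
Definition stage lf pm r (ents : seq (N * seq entry)) :=
  let d := dom r.1 in let u := N.lor r.1 r.2 in
  dfs em sstep (sprune 3 pm) (lf r) 7
    (St [::] (N.land (avmask Lp (pts r.1)) (avmask Lp (pts r.2))) 1)
    [seq (l.1, [seq t <- l.2 | disj (em t) u]) | l <- ents & ~~ N.eqb l.1 d].
(** Refuting a representative refutes its orbit, whose pairs then leave the lists. Once the lists
    are empty, no domain can receive its two lines. *)
Fixpoint stages lf pm rs ents :=
  if rs is r :: rs' then (if stage lf pm r ents then stages lf pm rs' (remove (orbit r) ents) else false)
  else vall (fun l => nilp l.2) ents.
Definition isos : seq (seq N * seq N) := [:: ([:: 48; 8; 32; 6; 1; 4; 65], [:: 16; 8; 48; 2; 65; 6; 64]);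
([:: 6; 1; 4; 48; 8; 32; 112], [:: 2; 1; 6; 80; 8; 48; 64]);
([:: 9; 18; 36; 1; 2; 4; 67], [:: 8; 16; 32; 73; 82; 36; 64]);
([:: 16; 40; 48; 2; 5; 6; 83], [:: 120; 8; 40; 7; 65; 69; 64]);
([:: 2; 5; 6; 16; 40; 48; 74], [:: 71; 1; 5; 120; 72; 104; 64]);
([:: 27; 18; 54; 3; 2; 6; 68], [:: 8; 56; 32; 9; 127; 100; 64]);
([:: 8; 32; 16; 1; 4; 2; 71], [:: 8; 32; 16; 65; 68; 66; 64]);
([:: 27; 54; 18; 3; 6; 2; 87], [:: 8; 32; 120; 73; 100; 63; 64]);
([:: 3; 6; 2; 24; 48; 16; 104], [:: 1; 4; 7; 72; 96; 56; 64])]%num.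
Definition kill cfg := if [&& size cfg == 17, uniq cfg & vall (fun m => vall (fun x => N.ltb x 128) (pts m)) cfg] then if alivetest cfg then true else isotest isos cfg else false.
Definition leaf r st := if mu 40 13 (avl (sa st) Ls) then true else lifts kill r.1 r.2 (sl st).

(** * Weights of functional planes *)

Definition span3 (a b c : N) := [:: a; b; a ^^ b; c; a ^^ c; b ^^ c; a ^^ b ^^ c].
(** Each plane is listed through its least basis: [a] is its least nonzero element, [b] the next one
    and [c] the least element outside their span. *)
Definition planes_of (bt : tree (tree bool)) : seq (seq N) :=
  flatten [seq let ba := look bt a in flatten [seq let bb := look bt b in
     [seq span3 a b c | c <- R7 & [&& N.ltb b c, N.ltb c (a ^^ c), N.ltb c (b ^^ c), N.ltb c (a ^^ b ^^ c) &
        if look ba c then false else if look bb c then false else if look ba (b ^^ c) then false else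
        if look bb (a ^^ c) then false else let bab := look bt (a ^^ b) in if look bab c then false else ~~ look bab (a ^^ c)]]
   | b <- R7 & [&& N.ltb a b, N.ltb b (a ^^ b) & ~~ look ba b]] | a <- behead R7].
Definition mem7 (D : seq N) x := vhas (N.eqb x) D.
Definition conf (D D' : seq N) := 1 < count (mem7 D) D'.

(** F is the plane of functionals that vanish on E, the plane with nonzero vectors [Epts], and at
    96; hence they vanish at all holes 96 + E. *)
Definition Fpts : seq N := [:: 8; 16; 24; 96; 104; 112; 120]%num.
Definition Epts : seq N := [:: 1; 2; 3; 4; 5; 6; 7]%num.
Definition inperp x (D : seq N) := vall (fun k => ~~ pdot x k) D.
Definition Gof (AV : seq (seq N)) x := [seq D <- AV | inperp x D & ~~ vhas (mem7 D) Fpts].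
Definition foot G (D : seq N) := [seq conf g D | g <- G].
Definition code2 (s : seq bool) : N := foldr (fun b a => if b then N.succ_double a else N.double a) 0%num s.
(** Planes vanishing at x that meet F in z only, each with the planes of [G] it conflicts with.
    Sorting by these feet makes the outcomes at different holes comparable. *)
Definition Qof AV G x z :=
  sort (fun a b : seq bool * seq N => N.leb (code2 a.1) (code2 b.1))
    [seq t <- [seq (foot G D, D) | D <- AV & [&& inperp x D, mem7 D z & count (mem7 D) Fpts == 1]] | vhas id t.1].
(** A plane of [G] is worth 2 at a hole; a plane meeting F in one point is worth half the number of
    planes of [G] that it excludes. *)
Definition wq (f : seq bool) := (count id f)./2.
(** Runs through the conflict-free subfamilies of [Q], recording the total weight and the union of
    the feet. *)
Fixpoint indep (Q : seq (seq bool * seq N)) (ch : seq (seq N)) (m : seq bool) (w : nat) : seq (nat * seq bool) :=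
  if Q is q :: Q' then
    indep Q' ch m w ++
    if vhas (conf q.2) ch then [::] else indep Q' (q.2 :: ch) [seq t.1 || t.2 | t <- zip m q.1] (w + wq q.1)
  else [:: (w, m)].
(** For each hole, an order of its 16 planes of [Gof] and of the points of F in which its data
    coincide with those of the first hole, so that one run of [hdfs] serves all eight. *)
Definition hints : seq (N * seq nat * seq N) := [:: (96, [:: 0; 1; 2; 10; 7; 4; 14; 3; 9; 15; 8; 13; 11; 5; 6; 12]%nat, [:: 24; 8; 16; 120; 104; 96; 112]);
(97, [:: 0; 14; 3; 11; 15; 9; 7; 13; 2; 6; 8; 4; 10; 12; 5; 1]%nat, [:: 24; 16; 8; 104; 96; 112; 120]);
(98, [:: 0; 9; 4; 5; 10; 1; 11; 3; 8; 15; 14; 7; 12; 13; 6; 2]%nat, [:: 24; 16; 8; 112; 120; 104; 96]);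
(99, [:: 0; 6; 3; 5; 9; 14; 2; 10; 1; 4; 12; 13; 15; 7; 8; 11]%nat, [:: 24; 8; 16; 96; 112; 120; 104]);
(100, [:: 0; 11; 5; 4; 10; 13; 9; 6; 3; 8; 12; 14; 2; 7; 15; 1]%nat, [:: 24; 8; 16; 120; 104; 96; 112]);
(101, [:: 0; 6; 11; 10; 13; 15; 14; 12; 1; 7; 3; 9; 5; 4; 8; 2]%nat, [:: 24; 8; 16; 120; 104; 96; 112]);
(102, [:: 0; 6; 8; 9; 13; 15; 14; 12; 1; 7; 5; 11; 3; 2; 10; 4]%nat, [:: 24; 8; 16; 120; 104; 96; 112]);
(103, [:: 0; 1; 7; 10; 12; 3; 13; 11; 8; 5; 15; 4; 14; 9; 6; 2]%nat, [:: 24; 8; 16; 96; 112; 120; 104])]%num.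
Definition Gord AV x (o : seq nat) := let G := Gof AV x in [seq nth [::] G i | i <- o].
Definition Jof AV x G (zs : seq N) : seq (seq (nat * seq bool)) :=
  [seq sort (fun a b : nat * seq bool => b.1 <= a.1) (indep (Qof AV G x z) [::] (nseq 16 false) 0) | z <- zs].
Definition hd0 (J : seq (nat * seq bool)) := if J is t :: _ then t.1 else 0.
(** Branch and bound over the planes of [G], taken or not; [B] is the remaining allowance. The
    optimistic estimate adds the best weight of every list and 2 for every undecided plane. *)
Fixpoint hdfs n (Js : seq (seq (nat * seq bool))) B : bool :=
  if sumn [seq hd0 J | J <- Js] + n.*2 <= B then true else
  if n is n'.+1 then
    let Js' := [seq [seq (t.1, behead t.2) | t <- J] | J <- Js] in
    if B <= 1 then false else if hdfs n' [seq [seq (t.1, behead t.2) | t <- J & ~~ head false t.2] | J <- Js] (B - 2)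
    then hdfs n' Js' B else false
  else false.
(** The seven pairs generate the seven lines of a plane in the order of [span3]; a line is kept if
    none of its functionals vanishes on all of E. *)
Definition Lam (AV : seq (seq N)) := flatten [seq flatten [seq
  [seq l <- [:: (nth 0 D 0, nth 0 D 1); (nth 0 D 0, nth 0 D 3); (nth 0 D 0, nth 0 D 5); (nth 0 D 1, nth 0 D 3);
     (nth 0 D 1, nth 0 D 4); (nth 0 D 2, nth 0 D 3); (nth 0 D 2, nth 0 D 4)]%num |
     ~~ vhas (fun k => vall (fun e => ~~ pdot e k) Epts) [:: l.1; l.2; l.1 ^^ l.2]]
   | D <- Gof AV e] | e <- Epts].
Definition AVc := planes_of (badtab [seq pperp m | m <- CF]).
Definition whole x G D := if inperp x D then
  (if vhas (mem7 D) Fpts then (if count (mem7 D) Fpts == 1 then wq (foot G D) else 0) else 2) else 0.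
Definition inLam L D := count (fun l : N * N => if mem7 D l.1 then mem7 D l.2 else false) L.
Definition hole_check AV J0 (h : N * seq nat * seq N) G :=
  [&& Jof AV h.1.1 G h.2 == J0, perm_eq G (Gof AV h.1.1), size G == 16 & perm_eq h.2 Fpts].
(** A linear programming certificate. Twice the hole weights plus the lines of [Lam] give every
    plane at least 4; a conflict-free family gets at most 35 at each hole, and each of the 448
    entries of [Lam] lies in at most one of its planes. So its size n satisfies 4 n <= 2 * 8 * 35 +
    448 = 4 * 252. *)
Definition check7 AV := let Gs := [seq (h, Gord AV h.1.1 h.1.2) | h <- hints] in
  let J0 := head [::] [seq Jof AV t.1.1.1 t.2 t.1.2 | t <- Gs] in let L := Lam AV in
  [&& uniq AV, hdfs 16 J0 35, vall (fun t => hole_check AV J0 t.1 t.2) Gs,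
   vall (fun D => 4 <= (sumn [seq whole t.1.1.1 t.2 D | t <- Gs]).*2 + inLam L D) AV,
   vall (fun l => ~~ N.eqb l.1 l.2) L & size L == 448].

(** * Correctness of the weighting certificate *)

Lemma size_hints : size hints = 8. Proof. by []. Qed.
#[local] Opaque Fpts hints.

Lemma vallE A (p : A -> bool) s : vall p s = all p s.
Proof. by elim: s => //= x s ->; case: (p x). Qed.
Lemma vhasE A (p : A -> bool) s : vhas p s = has p s.
Proof. by elim: s => //= x s ->; case: (p x). Qed.

Fixpoint avoids (g m : seq bool) : bool :=
  if g is b :: g' then ~~ (b && head false m) && avoids g' (behead m) else true.

Section Indep.
Variable sel : seq N -> bool.
Notation orm := (fun m q : seq bool => [seq t.1 || t.2 | t <- zip m q]).

(** The branch that keeps exactly the planes chosen by [sel] is never cut, since they do not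
    conflict. *)
Lemma indepP Q ch m w :
  let Qs := [seq q <- Q | sel q.2] in
  pairwise (fun a b => ~~ conf b.2 a.2) Qs ->
  all (fun q => all (fun c => ~~ conf q.2 c) ch) Qs ->
  (w + \sum_(q <- Qs) wq q.1, foldl (fun m q => orm m q.1) m Qs) \in indep Q ch m w.
Proof.
elim: Q ch m w => [|q Q IH] ch m w /=; first by rewrite big_nil addn0 inE.
rewrite mem_cat; case: (sel q.2) => /=; last by move=> H1 H2; rewrite IH.
move=> /andP[H1 H2] /andP[H3 H4]; apply/orP; right.
have -> : vhas (conf q.2) ch = false by rewrite vhasE; apply/negbTE; rewrite -all_predC.
rewrite big_cons addnA; apply: IH => //.
by apply/allP => r rQ /=; rewrite (allP H1 _ rQ) (allP H4 _ rQ).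
Qed.

Lemma avoids_or g m (Q : seq (seq bool * seq N)) :
  size m = size g -> all (fun q => size q.1 == size g) Q ->
  avoids g m -> all (fun q => avoids g q.1) Q -> avoids g (foldl (fun m q => orm m q.1) m Q).
Proof.
elim: Q m => [|q Q IH] m //= sm /andP[/eqP sq sQ] am /andP[aq aQ]; apply: IH => //.
  by rewrite size_map size_zip sm sq minnn.
elim: g {sQ aQ} m q.1 sm sq am aq => [|b g IHg] [|x m] [|y q'] //= [sm] [sq].
by move=> /andP[/negbTE bx am] /andP[/negbTE yx aq]; rewrite IHg // andbT andb_orr bx yx.
Qed.
End Indep.

Definition decr (a b : nat * seq bool) := b.1 <= a.1.
Lemma decr_trans : transitive decr. Proof. by move=> b a c H1 H2; apply: leq_trans H2 H1. Qed.
Lemma decr_total : total decr. Proof. by move=> a b; rewrite /decr; case: leqP => // /ltnW. Qed.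

Lemma hd0_max J t : sorted decr J -> t \in J -> t.1 <= hd0 J.
Proof.
case: J => // u J /= /(order_path_min decr_trans) /allP H; rewrite inE => /orP[/eqP -> //|/H]; by [].
Qed.

Lemma hdfsP n Js B g ts : hdfs n Js B -> all (sorted decr) Js -> size g = n ->
  all2 (fun (t : nat * seq bool) J => (t \in J) && avoids g t.2) ts Js ->
  sumn (map fst ts) + (count id g).*2 <= B.
Proof.
elim: n Js B g ts => [|n IH] Js B g ts /=; case: ifP => // Hb.
- move=> _ sJ sg tJ; apply: leq_trans Hb; apply: leq_add; last first.
    by rewrite leq_double -sg count_size.
  elim: ts Js sJ tJ => [|t ts IHt] [|J Js] //= /andP[sJ sJs] /andP[/andP[tJ _] tJs].
  by rewrite leq_add ?hd0_max ?IHt.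
- move=> _ sJ sg tJ; apply: leq_trans Hb; apply: leq_add; last first.
    by rewrite leq_double -sg count_size.
  elim: ts Js sJ tJ => [|t ts IHt] [|J Js] //= /andP[sJ sJs] /andP[/andP[tJ _] tJs].
  by rewrite leq_add ?hd0_max ?IHt.
case: leqP => // B1; case: ifP => // H1 H2 sJ; case: g => // b g [sg].
pose bh (t : nat * seq bool) := (t.1, behead t.2).
have sb (J : seq (nat * seq bool)) : sorted decr J -> sorted decr (map bh J) by rewrite sorted_map.
have fst_bh s : map fst (map bh s) = map fst s by rewrite -map_comp; apply: eq_map.
case: b => tJ; rewrite -fst_bh /=.
  suff : sumn [seq i.1 | i <- [seq bh i | i <- ts]] + (count id g).*2 <= B - 2.
    move=> H; rewrite doubleD -[(nat_of_bool true).*2]/2 addnCA -(subnKC B1) leq_add2l; exact: H.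
  apply: (IH _ _ _ _ H1 _ sg).
    by rewrite all_map; apply: sub_all sJ => J sJ /=; apply: sb; apply: sorted_filter sJ; apply: decr_trans.
  clear -tJ; elim: ts Js tJ => [|t ts IHt] [|J Js] //= /andP[/andP[tJ /andP[h a]] tJs].
  by rewrite IHt // andbT a andbT; apply/mapP; exists t; rewrite // mem_filter h.
rewrite add0n; apply: (IH _ _ _ _ H2 _ sg).
  by rewrite all_map; apply: sub_all sJ => J sJ /=; apply: sb.
clear -tJ; elim: ts Js tJ => [|t ts IHt] [|J Js] //= /andP[/andP[tJ a] tJs].
by rewrite IHt // andbT a andbT; apply/mapP; exists t.
Qed.

Lemma conf_in D D' a b : a != b -> uniq D' -> a \in D -> b \in D -> a \in D' -> b \in D' -> conf D D'.
Proof.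
move=> ab uD aD bD aD' bD'; rewrite /conf.
have E : mem7 D =1 mem D by move=> x; rewrite /mem7 vhasE /=; elim: (D) => //= y s ->; rewrite inE; congr (_ || _); apply/N.eqb_spec/eqP.
rewrite (eq_count E) -size_filter; apply: (@uniq_leq_size _ [:: a; b]); first by rewrite /= inE ab.
by move=> x; rewrite !inE mem_filter => /orP[] /eqP ->; rewrite /= ?aD ?bD.
Qed.

Lemma mem7E D x : mem7 D x = (x \in D).
Proof. by rewrite /mem7 vhasE; elim: D => //= y s ->; rewrite inE; congr (_ || _); apply/N.eqb_spec/eqP. Qed.

Lemma wq0 f : ~~ vhas id f -> wq f = 0.
Proof. by rewrite vhasE has_count -leqNgt leqn0 /wq => /eqP ->. Qed.

Section Selected.
Variables (AV : seq (seq N)) (sel : seq N -> bool).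
Hypothesis AVu : uniq AV.
Hypothesis AVD : {in AV, forall D, uniq D}.
Hypothesis selC : {in AV &, forall D D', sel D -> sel D' -> D != D' -> ~~ conf D D'}.

Section Hole.
Variables (x : N) (G : seq (seq N)) (zs : seq N) (J0 : seq (seq (nat * seq bool))).
Hypotheses (HJ : Jof AV x G zs = J0) (HG : perm_eq G (Gof AV x)) (sG : size G = 16) (Hz : perm_eq zs Fpts).

Lemma Gof_sub D : D \in G -> [/\ D \in AV, inperp x D & ~~ vhas (mem7 D) Fpts].
Proof. by rewrite (perm_mem HG) mem_filter => /andP[/andP[-> ->] ->]. Qed.

Lemma Qof_sub z q : q \in Qof AV G x z ->
  [/\ q.2 \in AV, q.1 = foot G q.2 & vhas (mem7 q.2) Fpts].
Proof.
rewrite mem_sort mem_filter => /andP[_ /mapP[D]]; rewrite mem_filter => /andP[/and3P[_ _ c1] DA] ->.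
by split=> //; rewrite vhasE has_count (eqP c1).
Qed.

Lemma Qof_uniq z : uniq (map snd (Qof AV G x z)).
Proof.
rewrite (perm_uniq (perm_map _ (permEl (perm_sort _ _)))).
have sub : subseq (map snd [seq t <- [seq (foot G D, D) | D <- AV & [&& inperp x D, mem7 D z & count (mem7 D) Fpts == 1]] | vhas id t.1])
   (map snd [seq (foot G D, D) | D <- AV & [&& inperp x D, mem7 D z & count (mem7 D) Fpts == 1]]).
  by apply: map_subseq; apply: filter_subseq.
by apply: subseq_uniq sub _; rewrite -map_comp map_id_in // filter_uniq.
Qed.

(** The selected planes that count at the hole either miss F, with weight 2, or meet F in one point
    z. Those of the second kind are grouped by z; each group is an entry of [indep], and its feet
    avoid the selected planes of the first kind. *)
Lemma hole_bound : hdfs 16 J0 35 -> \sum_(D <- AV | sel D) whole x G D <= 35.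
Proof.
move=> Hh.
pose wz z := \sum_(q <- [seq q <- Qof AV G x z | sel q.2]) wq q.1.
have wzE z : wz z = \sum_(D <- AV | sel D) (if [&& inperp x D, mem7 D z & count (mem7 D) Fpts == 1] then wq (foot G D) else 0).
  rewrite /wz big_filter (perm_big _ (permEl (perm_sort _ _))) /= big_filter_cond big_map big_filter_cond.
  rewrite big_mkcond [RHS]big_mkcond; apply: eq_bigr => D _ /=.
  case: (sel D); rewrite ?andbF //=; case: ifP => [/andP[-> _]//|].
  by rewrite andbT; case: [&& _, _ & _] => //= /negbT /wq0 ->.
have -> : \sum_(D <- AV | sel D) whole x G D = sumn (map wz zs) + (count id (map sel G)).*2.
  have -> : sumn (map wz zs) = \sum_(z <- Fpts) \sum_(D <- AV | sel D)
      (if [&& inperp x D, mem7 D z & count (mem7 D) Fpts == 1] then wq (foot G D) else 0).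
    by rewrite sumnE big_map (perm_big _ Hz) /=; apply: eq_bigr => z _; apply: wzE.
  have -> : (count id (map sel G)).*2 = \sum_(D <- AV | sel D) (if inperp x D && ~~ vhas (mem7 D) Fpts then 2 else 0).
    rewrite count_map (permP HG) count_filter -muln2 -sum1_count big_distrl /=.
    rewrite big_mkcond [RHS]big_mkcond; apply: eq_bigr => D _ /=.
    by case: (sel D); case: (inperp x D) => //=; case: (vhas _ _).
  rewrite exchange_big -big_split; apply: eq_bigr => D _; rewrite /whole.
  case: (inperp x D); last by rewrite big1.
  rewrite !andTb; case: (boolP (vhas (mem7 D) Fpts)) => hF; last first.
    rewrite big1 // => z _; case: ifP => // /and3P[_ _ /eqP c1]; case/negP: hF.
    by rewrite vhasE has_count c1.
  rewrite /= addn0; case: (boolP (count (mem7 D) Fpts == 1)) => c1; last first.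
    by rewrite big1 // => z _; rewrite andbF.
  under eq_bigr => z _ do rewrite andbT.
  rewrite -big_mkcond /=; under eq_bigr => z _ do rewrite -[wq _]mul1n.
  by rewrite -big_distrl /= sum1_count (eqP c1) mul1n.
pose tz z : nat * seq bool := (wz z, foldl (fun m q => [seq t.1 || t.2 | t <- zip m q.1]) (nseq 16 false)
   [seq q <- Qof AV G x z | sel q.2]).
have -> : map wz zs = map fst (map tz zs) by rewrite -map_comp.
have := Hh; rewrite -HJ => Hh'; apply: (hdfsP Hh'); rewrite ?size_map //.
  by rewrite all_map; apply/allP => z _; apply: sort_sorted; apply: decr_total.
have selQ z q r : q \in Qof AV G x z -> r \in Qof AV G x z -> sel q.2 -> sel r.2 -> q.2 != r.2 -> ~~ conf q.2 r.2.
  by move=> /Qof_sub[qA _ _] /Qof_sub[rA _ _] sq sr qr; apply: selC.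
have tzP z : tz z \in indep (Qof AV G x z) [::] (nseq 16 false) 0.
  rewrite /tz /wz -[bigop _ _ _]add0n; apply: indepP; last by apply/allP.
  have := Qof_uniq z; move: (selQ z); elim: (Qof AV G x z) => //= q Q IH HQ /andP[qQ uQ].
  have {}IH := IH (fun a b aQ bQ => HQ a b (mem_behead (s := q :: Q) aQ) (mem_behead (s := q :: Q) bQ)) uQ.
  case: ifP => //= sq; rewrite IH andbT; apply/allP => r; rewrite mem_filter => /andP[sr rQ].
  apply: HQ; rewrite ?inE ?eqxx ?rQ ?orbT //; apply: contra qQ => /eqP <-; exact: map_f.
have tzA z : avoids (map sel G) (tz z).2.
  have gQ : all (fun q => (size q.1 == size (map sel G)) && avoids (map sel G) q.1) [seq q <- Qof AV G x z | sel q.2].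
    apply/allP => q; rewrite mem_filter => /andP[sq /Qof_sub[qA qf qF]].
    rewrite qf !size_map eqxx /=.
    have : {subset G <= G} by []. 
    elim: {-2}G => //= D G' IH sub; rewrite IH; last by move=> y yG; apply: sub; rewrite inE yG orbT.
    have [DA _ DF] := Gof_sub (sub D (mem_head _ _)).
    rewrite andbT; apply/negP => /andP[sD cD].
    have Dq : D != q.2 by apply: contraNneq DF => ->.
    by have := selC DA qA sD sq Dq; rewrite cD.
  apply: avoids_or; first by rewrite size_map sG size_nseq.
  - by apply: sub_all gQ => q /andP[].
  - by rewrite -sG; elim: (G) => //= D G' ->; rewrite andbF.
  - by apply: sub_all gQ => q /andP[].
elim: (zs) => //= z zs' ->; rewrite andbT tzA andbT.
by rewrite mem_sort.
Qed.
End Hole.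

Lemma selected_bound : check7 AV -> count sel AV <= 252.
Proof.
move=> /and5P[_ Hh HG Hw /andP[HL /eqP sL]].
have {}Hw : all (fun D => 4 <= (sumn [seq whole t.1.1.1 t.2 D | t <- [seq (h, Gord AV h.1.1 h.1.2) | h <- hints]]).*2 + inLam (Lam AV) D) AV.
  by rewrite -vallE.
have le1 : 4 * count sel AV <= \sum_(D <- AV | sel D) ((sumn [seq whole t.1.1.1 t.2 D | t <- [seq (h, Gord AV h.1.1 h.1.2) | h <- hints]]).*2 + inLam (Lam AV) D).
  rewrite -sum1_count big_distrr /= big_seq_cond [X in _ <= X]big_seq_cond; apply: leq_sum => D /andP[DA _].
  exact: (allP Hw).
have le2 : \sum_(D <- AV | sel D) inLam (Lam AV) D <= 448.
  rewrite -sL -sum1_size (eq_bigr (fun D => \sum_(l <- Lam AV) (mem7 D l.1 && mem7 D l.2 : nat))); last first.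
    by move=> D _; rewrite /inLam -sum1_count big_mkcond; apply: eq_bigr => l _; case: (mem7 D l.1); case: (mem7 D l.2).
  rewrite exchange_big big_seq [X in _ <= X]big_seq; apply: leq_sum => l lL /=.
  have l12 : l.1 != l.2 by move: HL; rewrite vallE => /allP /(_ _ lL); apply: contra => /eqP ->; apply/N.eqb_spec.
  rewrite (_ : bigop _ _ _ = count (fun D => sel D && (mem7 D l.1 && mem7 D l.2)) AV); last first.
    rewrite -sum1_count big_mkcond [RHS]big_mkcond; apply: eq_bigr => D _.
    by case: (sel D); case: (mem7 D l.1); case: (mem7 D l.2).
  rewrite -size_filter; set s := filter _ _; have us : uniq s by rewrite filter_uniq.
  have Hs D : D \in s -> [/\ D \in AV, sel D, l.1 \in D & l.2 \in D].
    by rewrite mem_filter !mem7E => /andP[/and3P[]].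
  (* Two selected planes containing the same line would share two functionals and so conflict. *)
  case: s us Hs => [|D [|D' s]] //= /andP[]; rewrite inE negb_or => /andP[DD' _] _ Hs.
  have [DA sD D1 D2] := Hs D (mem_head _ _).
  have [DA' sD' D1' D2'] : [/\ D' \in AV, sel D', l.1 \in D' & l.2 \in D'] by apply: Hs; rewrite !inE eqxx orbT.
  by have := selC DA DA' sD sD' DD'; rewrite (conf_in l12) ?AVD.
have le3 : \sum_(D <- AV | sel D) sumn [seq whole t.1.1.1 t.2 D | t <- [seq (h, Gord AV h.1.1 h.1.2) | h <- hints]] <= 8 * 35.
  have -> : 8 * 35 = \sum_(h <- hints) 35 by rewrite -[35]muln1 -big_distrr sum1_size size_hints mulnC.
  rewrite (eq_bigr (fun D => \sum_(h <- hints) whole h.1.1 (Gord AV h.1.1 h.1.2) D)); last first.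
    by move=> D _; rewrite sumnE !big_map.
  rewrite exchange_big big_seq [X in _ <= X]big_seq; apply: leq_sum => h hH /=.
  move: HG; rewrite vallE all_map => /allP /(_ _ hH) /= /and4P[/eqP HJ HGh /eqP sG Hz].
  by apply: hole_bound HJ HGh sG Hz Hh.
move: le1 le2 le3; rewrite big_split /= (eq_bigr _ (fun D _ => esym (mul2n _))) -big_distrr /=.
 set a := bigop _ _ _; set b := bigop _ _ _; lia.
Qed.
End Selected.

(** * Soundness of the search *)

Lemma Neqb x y : N.eqb x y = (x == y). Proof. exact/N.eqb_spec/eqP. Qed.

Lemma bit_mk s x : bit (mk s) x = (x \in s).
Proof.
rewrite /bit; elim: s => [|y s IH]; first exact: N.bits_0.
by rewrite [mk _]/= N.setbit_eqb IH inE Neqb eq_sym.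
Qed.

Lemma bit_setbit m y x : bit (N.setbit m y) x = (x == y) || bit m x.
Proof. by rewrite /bit N.setbit_eqb Neqb eq_sym. Qed.

Lemma bit_lor a b x : bit (N.lor a b) x = bit a x || bit b x.
Proof. by rewrite /bit N.lor_spec; case: (N.testbit a x). Qed.

Lemma bit_land a b x : bit (N.land a b) x = bit a x && bit b x.
Proof. exact: N.land_spec. Qed.

Lemma disjE a b : disj a b = (N.land a b == 0%num).
Proof.
case: a b => [|p] [|q] //=.
elim: p q => [p IH|p IH|] [q|q|] //=; rewrite ?IH; by case: (Pos.land p q).
Qed.

Lemma disjP a b : reflect (forall x, ~~ (bit a x && bit b x)) (disj a b).
Proof.
rewrite disjE; apply: (iffP eqP) => [E x | H].
  by rewrite -bit_land E /bit N.bits_0.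
by apply: N.bits_inj => x; rewrite N.bits_0; apply/negbTE; rewrite -[N.testbit _ _]/(bit _ _) bit_land.
Qed.

Lemma disjC a b : disj a b = disj b a. Proof. by rewrite !disjE N.land_comm. Qed.

Lemma disj_mk1 m z : ~~ disj m (mk [:: z]) = bit m z.
Proof.
apply/idP/idP => [|H].
  apply: contraR => H; apply/disjP => x; rewrite bit_mk inE; apply/negP => /andP[mx /eqP xz].
  by rewrite -xz mx in H.
by apply/negP => /disjP /(_ z); rewrite H bit_mk inE eqxx.
Qed.

Lemma mem_ptsp p i x : (x \in ptsp p i) = N.leb i x && N.testbit (Npos p) (x - i)%num.
Proof.
elim: p i x => [p IH|p IH|] i x; rewrite [ptsp _ _]/= ?inE ?IH.
- case: (boolP (x == i)) => [/eqP -> | /eqP xi].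
    by rewrite N.leb_refl N.sub_diag.
  rewrite orFb; case: (boolP (N.leb i x)) => [/N.leb_spec0 H|/N.leb_spec0 H]; last first.
    by case: (boolP (N.leb _ _)) => // /N.leb_spec0; lia.
  have -> : N.leb (N.succ i) x by apply/N.leb_spec0; lia.
  have -> : (x - i)%num = N.succ (x - N.succ i)%num by lia.
  by rewrite -[N.pos p~1]/(N.succ_double (Npos p)) N.succ_double_spec N.testbit_odd_succ //; lia.
- case: (boolP (N.leb i x)) => [/N.leb_spec0 H|/N.leb_spec0 H]; last first.
    by case: (boolP (N.leb _ _)) => // /N.leb_spec0; lia.
  case: (boolP (N.leb (N.succ i) x)) => [/N.leb_spec0 H'|/N.leb_spec0 H'].
    have -> : (x - i)%num = N.succ (x - N.succ i)%num by lia.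
    by rewrite -[N.pos p~0]/(N.double (Npos p)) N.double_spec N.testbit_even_succ //; lia.
  by have -> : (x - i)%num = 0%num by lia.
apply/idP/idP => [/eqP -> | /andP[/N.leb_spec0 H]]; first by rewrite N.leb_refl N.sub_diag.
case E : (x - i)%num => [|q]; first by move=> _; apply/eqP; lia.
by case: q E.
Qed.

Lemma mem_pts m x : (x \in pts m) = bit m x.
Proof.
case: m => [|p]; first by rewrite /bit N.bits_0.
by rewrite [pts _]/= mem_ptsp N.sub_0_r; case: x.
Qed.

Lemma div2_double_cases x : x = if N.odd x then N.succ_double (N.div2 x) else N.double (N.div2 x).
Proof. by rewrite -N.bit0_odd; case: x => [|[p|p|]]. Qed.

Lemma look_build A n (f : N -> A) x : N.to_nat x < 2 ^ n -> look (build n f) x = f x.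
Proof.
elim: n f x => [|n IH] f x; first by rewrite expn0 ltnS leqn0 => /eqP H /=; congr f; lia.
move=> H /=; have E := div2_double_cases x; rewrite expnS in H.
by case: (N.odd x) E => E; rewrite IH -?E //; rewrite E in H; lia.
Qed.

Lemma look7 A (f : N -> A) x : x \in R7 -> look (build 7 f) x = f x.
Proof. by rewrite mem_rng => H; apply: look_build. Qed.

Section DFSsound.
Variables (K T : eqType) (S : Type) (tm : T -> N) (step : S -> T -> S) (prune leaf : S -> bool).
Variables (sel : K -> T -> Prop) (good : S -> Prop).
Hypothesis sel_disj : forall k k' t t', sel k t -> sel k' t' -> k != k' -> disj (tm t) (tm t').
Hypothesis good_step : forall st k t, good st -> sel k t -> good (step st t).
Hypothesis good_prune : forall st, good st -> ~~ prune st.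
Hypothesis good_leaf : forall st, good st -> ~~ leaf st.

Lemma perm_pick (x : K * seq T) r : perm_eq ((pick x r).1 :: (pick x r).2) (x :: r).
Proof.
elim: r x => [|y r IH] x //=; case: (shorter _ _).
  have := IH y; case: (pick y r) => b s /= H.
  by rewrite (perm_catCA [:: b] [:: x] s) /= perm_cons.
have := IH x; case: (pick x r) => b s /= H.
rewrite (perm_catCA [:: b] [:: y] s) perm_sym (perm_catCA [:: x] [:: y] r) /= perm_cons perm_sym.
exact: H.
Qed.

(** An actual solution has an item in each list. Its items under different keys are disjoint, so
    they survive every filtering along the branch they define, and that branch cannot be refuted. *)
Lemma dfs_sound n st (rem : seq (K * seq T)) : good st -> uniq (map fst rem) ->
  (forall l : K * seq T, l \in rem -> exists2 t, t \in l.2 & sel l.1 t) -> ~~ dfs tm step prune leaf n st rem.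
Proof.
elim: n st rem => [|n IH] st rem gst urem Hrem /=; rewrite (negbTE (good_prune gst)) //.
case: rem urem Hrem => [|x r] urem Hrem; first exact: good_leaf.
have := perm_pick x r; case: (pick x r) => b s /= Hp.
have {urem} : uniq (map fst (b :: s)) by rewrite (perm_uniq (perm_map fst Hp)).
move=> /= /andP[bs us].
have {}Hrem (l : K * seq T) : l \in b :: s -> exists2 t, t \in l.2 & sel l.1 t.
  by move=> lbs; apply: Hrem; rewrite -(perm_mem Hp).
have [t tb tsel] := Hrem b (mem_head _ _).
rewrite vallE; apply/allPn; exists t => //; apply: IH; first exact: good_step tsel.
  by rewrite -map_comp.
move=> _ /mapP[l ls ->] /=; have [t' t'l t'sel] := Hrem l (mem_behead (s := b :: s) ls).
exists t' => //; rewrite mem_filter t'l andbT; apply: sel_disj t'sel tsel _.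
by apply: contraNneq bs => <-; apply: map_f.
Qed.
End DFSsound.

(** Each point is on at most one of the disjoint lines [ms], and each of these meets three
    points. *)
Lemma mu_prune (P l ms : seq N) : {in P, forall z, exists x, z = mk [:: x]} -> uniq ms -> {subset ms <= l} ->
  {in ms &, forall m m', m != m' -> disj m m'} ->
  {in ms, forall m, count (fun z => ~~ disj m z) P = 3} ->
  3 * size ms <= count (fun z => has (fun m => ~~ disj m z) l) P.
Proof.
move=> HP um sub dm m3.
have -> : 3 * size ms = \sum_(m <- ms) count (fun z => ~~ disj m z) P.
  rewrite (eq_big_seq (fun _ => 3 * 1)) => [|m mm]; last by rewrite m3.
  by rewrite -big_distrr sum1_size.
under eq_bigr => m _ do rewrite -sum1_count big_mkcond.
rewrite exchange_big -sum1_count [X in _ <= X]big_mkcond big_seq [X in _ <= X]big_seq.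
apply: leq_sum => z /HP[x ->] /=.
rewrite -big_mkcond sum1_count -size_filter; set s := filter _ _.
have us : uniq s by rewrite filter_uniq.
have Hs m : m \in s -> m \in ms /\ bit m x by rewrite mem_filter disj_mk1 => /andP[].
case: s us Hs => [|m [|m' s]] //=.
  move=> _ Hs; have [mm bm] := Hs m (mem_head _ _).
  by rewrite (_ : has _ _); last by apply/hasP; exists m; rewrite ?disj_mk1 ?sub.
rewrite inE negb_or => /andP[/andP[mm' _] _] Hs.
have [mm bm] := Hs m (mem_head _ _); have [m'm bm'] : m' \in ms /\ bit m' x by apply: Hs; rewrite !inE eqxx orbT.
by have /disjP/(_ x) := dm _ _ mm m'm mm'; rewrite bm bm'.
Qed.

Lemma Pm_mk : {in Pm, forall z, exists x, z = mk [:: x]}.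
Proof. rewrite /Pm => z. move/mapP => [x _ E]. exists x. exact: E. Qed.

Lemma PmE : Pm = [seq mk [:: z] | z <- P42]. Proof. by []. Qed.
Opaque Pm.
Lemma muP n k l ms : mu n k l -> uniq ms -> {subset ms <= l} ->
  {in ms &, forall m m', m != m' -> disj m m'} ->
  {in ms, forall m, count (fun z => ~~ disj m z) Pm = 3} -> size ms < k.
Proof.
have pr k' l' : (count (fun t => 0 < t.2) [seq (z, count (fun m => ~~ disj m z) l') | z <- Pm] < 3 * k') =
    (count (fun z => has (fun m => ~~ disj m z) l') Pm < 3 * k').
  by rewrite count_map; congr (_ < _); apply: eq_count => z /=; rewrite has_count.
elim: n k l ms => [|n IH] k l ms /=; rewrite pr; case: ifP => // H.
1,2: by move=> _ um sub dm m3; rewrite -(ltn_pmul2l (m := 3)) //; apply: leq_ltn_trans (mu_prune Pm_mk um sub dm m3) H.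
case: k H => // k H; set z := best _ _; rewrite vallE; case: ifP => // H1 H2 um sub dm m3.
case: (boolP (has (fun m => ~~ disj m z) ms)) => [/hasP[m mm mz] | nz]; last first.
  apply: IH H2 um _ dm m3 => m mm; rewrite mem_filter sub // andbT.
  by apply: contraNT nz => mz; apply/hasP; exists m.
have := allP H1 m; rewrite mem_filter mz sub // => /(_ isT) Hm.
have : size (rem m ms) < k.
  apply: IH Hm (rem_uniq _ um) _ _ _.
  - move=> t; rewrite mem_rem_uniq // inE => /andP[tm tms]; rewrite mem_filter sub // andbT.
    exact: dm.
  - by move=> t t' /mem_rem ts /mem_rem ts'; apply: dm.
  - by move=> t /mem_rem; apply: m3.
by rewrite size_rem //; case: (ms) mm.
Qed.

(** * Lines in the kernel of the functional 64 and dual lines *)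

Definition R6 := rng 64.

Lemma R7E : R7 = R6 ++ [seq (64 ^^ x)%num | x <- R6]. Proof. by vm_compute. Qed.
Lemma R6E : R6 = 0%num :: behead R6. Proof. by []. Qed.
Opaque R6 R7.
Lemma R6_R7 x : x \in R6 -> x \in R7. Proof. by rewrite R7E mem_cat => ->. Qed.

Lemma count_R7 (q : N -> bool) : count q R7 = count q R6 + count (fun x => q (64 ^^ x)%num) R6.
Proof. by rewrite R7E count_cat count_map. Qed.

Lemma R7_case x : x \in R7 -> x \in R6 \/ exists2 y, y \in R6 & x = (64 ^^ y)%num.
Proof. by rewrite R7E mem_cat => /orP[|/mapP[y]]; [left | right; exists y]. Qed.

Lemma R6_lxor x y : x \in R6 -> y \in R6 -> x ^^ y \in R6.
Proof.
have E : all (fun x => all (fun y => x ^^ y \in R6) R6) R6 by vm_compute.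
by move=> xR yR; apply: (allP (allP E x xR)).
Qed.

Lemma R6_64 x : x \in R6 -> (64 ^^ x)%num \in R7.
Proof. by move=> xR; rewrite R7E mem_cat; apply/orP; right; apply/mapP; exists x. Qed.

Lemma pdot64 x : x \in R6 -> (pdot x 64 = false) * (pdot (64 ^^ x) 64 = true).
Proof.
have E : all (fun x => ~~ pdot x 64 && pdot (64 ^^ x) 64) R6 by vm_compute.
by move=> /(allP E) /andP[/negbTE -> ->].
Qed.

Lemma mem_P42 x : (x \in P42) = isp x && (x \in R6). Proof. by rewrite /P42 mem_filter. Qed.
Lemma P42_R6 x : x \in P42 -> x \in R6. Proof. by rewrite mem_P42 => /andP[]. Qed.

Lemma mem_Ls l : l \in Ls -> exists a b, [/\ l = mk [:: a; b; a ^^ b], a \in P42, b \in P42, a ^^ b \in P42 &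
  uniq [:: a; b; a ^^ b]].
Proof.
rewrite /Ls => /flattenP[_ /mapP[a aP ->] /mapP[b]]; rewrite mem_filter => /andP[/and3P[H1 H2 H3] bP] ->.
exists a, b; split=> //.
  by rewrite mem_P42 H3; apply: R6_lxor; apply: P42_R6.
move/N.ltb_spec0: H1; move/N.ltb_spec0: H2 => H2 H1.
rewrite /= !inE negb_or; apply/and3P; split=> //; first (apply/andP; split).
all: try by []; set c := a ^^ b in H2 *; apply/eqP => E; clear -H1 H2 E; lia.
Qed.

Lemma Ls_mem a b : a \in P42 -> b \in P42 -> a ^^ b \in P42 -> N.ltb a b -> N.ltb b (a ^^ b) ->
  mk [:: a; b; a ^^ b] \in Ls.
Proof.
move=> aP bP; rewrite mem_P42 => /andP[abP _] H1 H2.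
rewrite /Ls; apply/flattenP; exists [seq mk [:: a; q; a ^^ q] | q <- P42 & [&& N.ltb a q, N.ltb q (a ^^ q) & isp (a ^^ q)]].
  by apply/mapP; exists a.
by apply/mapP; exists b; rewrite // mem_filter H1 H2 abP.
Qed.

Opaque Ls P42.

Lemma Ls_P42 l x : l \in Ls -> bit l x -> x \in P42.
Proof.
move=> lL; have [a [b [-> aP bP abP _]]] := mem_Ls lL => H; rewrite bit_mk !inE in H.
by case/or3P: H => /eqP ->.
Qed.

Lemma Ls_bit0 l : l \in Ls -> bit l 0 = false.
Proof. by move=> lL; apply/negbTE/negP => /(Ls_P42 lL). Qed.

Lemma Ls_inj l l' : l \in Ls -> l' \in Ls -> {in R6, bit l =1 bit l'} -> l = l'.
Proof.
move=> lL lL' E; apply: N.bits_inj => x; rewrite -![N.testbit _ _]/(bit _ _).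
case: (boolP (x \in R6)) => [/E //|xR].
have [/negbTE -> /negbTE ->] // : ~~ bit l x /\ ~~ bit l' x.
by split; apply: contra xR => /Ls_P42 H; apply: P42_R6; apply: H.
Qed.

Definition li (q : N -> bool) := mk [seq x <- R6 | q x && (x != 0%num)].

Lemma bit_li q x : bit (li q) x = [&& x \in R6, q x & x != 0%num].
Proof. by rewrite bit_mk mem_filter andbC. Qed.

(** In increasing order the three nonzero vectors are x < y < x + y, the form in which [Ls] lists a
    line. *)
Lemma li_Ls (q : N -> bool) : q 0%num -> {in R6 &, forall x y, q x -> q y -> q (x ^^ y)} -> count q R6 = 4 ->
  {in R6, forall x, q x -> x != 0%num -> isp x} -> li q \in Ls.
Proof.
move=> q0 qD c4 qi; rewrite /li; set s := filter _ _.
have ss : sorted (fun a b => N.ltb a b) s.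
  by apply: sorted_filter; [move=> b a c /N.ltb_spec0 ? /N.ltb_spec0 ?; apply/N.ltb_spec0; lia | vm_compute].
have sz : size s = 3.
  have : count q R6 = (count (fun x => q x && (x != 0%num)) R6).+1.
    rewrite R6E /= q0 add1n; congr _.+1; apply: eq_in_count => x.
    have : all (fun x => x != 0%num) (behead R6) by vm_compute.
      by move=> /allP H /H ->; rewrite andbT.
  by rewrite c4 size_filter => -[].
have Hs x : x \in s = [&& q x, x != 0%num & x \in R6] by rewrite mem_filter andbA.
move: ss sz Hs; case: s => [|x [|y [|z []]]] //= /and3P[xy yz _] _ Hs.
have /and3P[qx x0 xR] : [&& q x, x != 0%num & x \in R6] by rewrite -Hs inE eqxx.
have /and3P[qy y0 yR] : [&& q y, y != 0%num & y \in R6] by rewrite -Hs !inE eqxx orbT.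
have zE : z = x ^^ y.
  have : x ^^ y \in [:: x; y; z].
    rewrite Hs qD ?R6_lxor // andbT /=; apply/eqP => /lxor_eq0 E; move/N.ltb_spec0: xy; rewrite E; lia.
  rewrite !inE => /or3P[] /eqP; last by [].
    by move=> /(congr1 (N.lxor x)); rewrite -N.lxor_assoc N.lxor_nilpotent N.lxor_0_l => E; rewrite E eqxx in y0.
  by move=> /(congr1 (fun t => t ^^ y)); rewrite lxorK N.lxor_nilpotent => E; rewrite E eqxx in x0.
have /and3P[qz z0 zR] : [&& q z, z != 0%num & z \in R6] by rewrite -Hs !inE eqxx !orbT.
by rewrite zE; apply: Ls_mem; rewrite -?zE // mem_P42 ?xR ?yR ?zR andbT qi.
Qed.

Opaque li.

(** Translation by 64 + u exchanges the parts inside and outside the kernel. *)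
Lemma plane_half (q : N -> bool) u : closed q -> count q R7 = 8 -> u \in R6 -> q (64 ^^ u)%num -> count q R6 = 4.
Proof.
move=> [q0 qD] c8 uR qu.
have E : count (fun x => q (64 ^^ x)%num) R6 = count q R6.
  have pe : perm_eq (map (N.lxor u) R6) R6.
    have Us : uniq (map (N.lxor u) R6).
      rewrite map_inj_uniq ?rng_uniq // => a b /(congr1 (N.lxor u)).
      by rewrite -!N.lxor_assoc N.lxor_nilpotent !N.lxor_0_l.
    have sub : {subset map (N.lxor u) R6 <= R6} by move=> _ /mapP[x xR ->]; apply: R6_lxor.
    by have [|_ E] := uniq_min_size Us sub; rewrite ?size_map //; apply: uniq_perm; rewrite ?rng_uniq.
  transitivity (count q (map (N.lxor u) R6)); last exact: (permP pe).
  rewrite count_map; apply: eq_in_count => x xR; change (q (64 ^^ x)%num = q (u ^^ x)); apply/idP/idP => H.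
    have := qD _ _ (R6_64 uR) (R6_64 xR) qu H.
    by rewrite -N.lxor_assoc (N.lxor_comm 64 u) lxorK.
  have := qD _ _ (R6_64 uR) (R6_R7 (R6_lxor uR xR)) qu H.
  by rewrite -!N.lxor_assoc lxorK.
by move: c8; rewrite count_R7 E; lia.
Qed.

Lemma count_ge (q : N -> bool) s : uniq s -> all (fun x => (x \in R7) && q x) s -> size s <= count q R7.
Proof.
move=> us /allP Hs; rewrite -size_filter; apply: uniq_leq_size => // x /Hs /andP[xR qx].
by rewrite mem_filter qx.
Qed.

Lemma isp_cover : all (fun x => [|| isp x, bit planeA x, bit planeB x | bit planeC x]) R6.
Proof. by vm_compute. Qed.

Lemma orth_ABC : all (fun m => all (fun x => ~~ bit m (64 ^^ x)%num) R6) [:: planeA; planeB; planeC].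
Proof. by vm_compute. Qed.

Lemma not_isp_orth_ok : all (fun k => isp k ||
  has (fun m => all (fun x => bit m x ==> ~~ pdot x k) R7) [:: planeA; planeB; planeC]) R6.
Proof. by vm_compute. Qed.
Opaque planeA planeB planeC.

Lemma not_isp_orth k : k \in R6 -> ~~ isp k ->
  exists2 m, m \in [:: planeA; planeB; planeC] & {in R7, forall x, bit m x -> ~~ pdot x k}.
Proof.
move=> kR nk; have /orP[ik|/hasP[m mP /allP Hm]] := allP not_isp_orth_ok k kR; first by rewrite ik in nk.
by exists m => // x xR bx; move/implyP: (Hm x xR); apply.
Qed.

Lemma count_gt2 (q : N -> bool) x : x \in R6 -> x != 0%num ->
  q 0%num -> q 64%num -> q x -> 2 < count q R7.
Proof.
move=> xR x0 q0 q64 qx; apply: (@count_ge _ [:: 0%num; 64%num; x]).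
  have x64 : 64%num != x by apply: contraTneq xR => <-; vm_compute.
  by rewrite /= !inE [_ == x]eq_sym negb_or x0 x64.
have R0 : 0%num \in R7 by vm_compute.
have R64 : 64%num \in R7 by vm_compute.
by rewrite /all R0 R64 (R6_R7 xR) q0 q64 qx.
Qed.

Lemma R6_0 : 0%num \in R6. Proof. by vm_compute. Qed.
Lemma orth0 q : orth q 0.
Proof. by apply/allP => y _; rewrite pdotC /pdot N.land_0_l implybT. Qed.

Lemma Ls_count : all (fun l => count (fun x => (x == 0%num) || bit l x) R6 == 4) Ls.
Proof. by vm_compute. Qed.

Lemma R6_neq64 x y : x \in R6 -> y \in R6 -> (64 ^^ x)%num != y.
Proof. by move=> xR yR; apply: contraTneq isT => E; have := pdot64 yR; rewrite -E (pdot64 xR).2 => -[]. Qed.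

Lemma pdot_64 k : k \in R6 -> (pdot 64 k = false) * (pdot 64 (64 ^^ k) = true).
Proof. by move=> kR; rewrite ![pdot 64 _]pdotC !(pdot64 kR). Qed.

Section System.
Variables (X : finType) (I J : {set X}).
Implicit Types p d : X -> N -> bool.

Definition hasp p m := [exists i in I, all (fun x => p i x == bit m x) R7].
Definition lineb p l := [exists i in I, all (fun x => p i x == (x == 0%num) || bit l x) R6].
Definition lsof p := [seq l <- Ls | lineb p l].
(** Functionals on the kernel are functionals modulo 64, so a functional plane through 64 is a line
    of them, represented by numbers below 64. *)
Definition dlineb d m := [exists j in J, d j 64%num && all (fun x => d j x == (x == 0%num) || bit m x) R6].
Definition msof d := [seq m <- Ls | dlineb d m].

Lemma haspP p m : reflect (exists2 i, i \in I & {in R7, p i =1 bit m}) (hasp p m).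
Proof.
apply: (iffP exists_inP) => -[i iI H]; exists i => //.
  by move=> x xR; apply/eqP; apply: (allP H).
by apply/allP => x /H ->.
Qed.

Lemma linebP p l : reflect (exists2 i, i \in I & {in R6, forall x, p i x = (x == 0%num) || bit l x}) (lineb p l).
Proof.
apply: (iffP exists_inP) => -[i iI H]; exists i => //.
  by move=> x xR; apply/eqP; apply: (allP H).
by apply/allP => x /H ->.
Qed.

Lemma dlinebP d l : reflect (exists2 j, j \in J & d j 64%num /\ {in R6, forall x, d j x = (x == 0%num) || bit l x}) (dlineb d l).
Proof.
apply: (iffP exists_inP) => -[i iI]; [move=> /andP[d64 H] | move=> [d64 H]]; exists i => //.
  by split=> // x xR; apply/eqP; apply: (allP H).
by rewrite d64; apply/allP => x /H ->.
Qed.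

(** A supposed failure in coordinates: h is the functional 64, with c(h) = 3 + 13 at least, and its
    three planes are A, B and C. The search shows in [no_NS] that there is none. *)
Record NS p d : Prop := Nsys {
  ns_sys : sys I J p d;
  ns_bad : ~~ sgood I J p d;
  ns_A : hasp p planeA; ns_B : hasp p planeB; ns_C : hasp p planeC;
  ns_I : nI I p 64 = 3;
  ns_J : 13 <= nJ J d 64 }.

Section Normal.
Variables (p d : X -> N -> bool).
Hypothesis H : NS p d.
Let S := ns_sys H.

Lemma orth64 q : orth q 64 = all (fun x => ~~ q (64 ^^ x)%num) R6.
Proof.
apply/allP/allP => Hq x xR.
  by have := Hq _ (R6_64 xR); rewrite (pdot64 xR).2 implybF.
have [x6|[y y6 ->]] := R7_case xR; first by rewrite (pdot64 x6).1 implybT.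
by rewrite (negbTE (Hq y y6)).
Qed.

Lemma not_orth64 i : i \in I -> ~~ orth (p i) 64 -> exists2 u, u \in R6 & p i (64 ^^ u)%num.
Proof. by rewrite orth64 => _ /allPn[u uR]; rewrite negbK; exists u. Qed.

Lemma hasp_ABC : {in [:: planeA; planeB; planeC], forall m, hasp p m}.
Proof. by move=> m; rewrite !inE => /or3P[] /eqP ->; case: H. Qed.

Lemma hasp_ABC_orth m : m \in [:: planeA; planeB; planeC] ->
  exists2 i, i \in I & {in R7, p i =1 bit m} /\ orth (p i) 64.
Proof.
move=> mP; have /haspP[i iI E] := hasp_ABC mP; exists i => //; split=> //.
rewrite orth64; apply/allP => x xR; rewrite E ?R6_64 //; exact: (allP (allP orth_ABC m mP)).
Qed.

(** A plane outside the hyperplane meets it in four vectors; a nonzero one on A, B or C would be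
    shared with another plane of the system. *)
Lemma line_plane i : i \in I -> ~~ orth (p i) 64 ->
  li (p i) \in Ls /\ {in R6, forall x, p i x = (x == 0%num) || bit (li (p i)) x}.
Proof.
move=> iI no; have [cl c8] := sys_p S iI; have [u uR pu] := not_orth64 iI no.
have c4 := plane_half cl c8 uR pu; case: (cl) => q0 qD.
split; last first.
  by move=> x xR; rewrite bit_li xR; case: eqP => [->|_] /=; rewrite ?andbT ?andbF.
apply: li_Ls => //; first by move=> x y xR yR; apply: qD; apply: R6_R7.
move=> x xR px x0; apply: contraNT x0 => nx; apply/eqP.
have [m mP bx] : exists2 m, m \in [:: planeA; planeB; planeC] & bit m x.
  have := allP isp_cover x xR; rewrite (negbTE nx) orFb => /or3P[] bx.
  - by exists planeA; rewrite ?inE ?eqxx.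
  - by exists planeB; rewrite ?inE ?eqxx ?orbT.
  - by exists planeC; rewrite ?inE ?eqxx ?orbT.
have [j jI [E oj]] := hasp_ABC_orth mP.
have ij : i != j by apply: contraNneq no => ->.
by apply: (sys_pp S iI jI ij) => //; rewrite ?E // R6_R7.
Qed.

(** A nonzero functional vanishing on A, B or C would be a third one, besides 0 and 64, in the plane
    and in the annihilator of a codeword plane. *)
Lemma dline_plane j : j \in J -> d j 64 ->
  li (d j) \in Ls /\ {in R6, forall x, d j x = (x == 0%num) || bit (li (d j)) x}.
Proof.
move=> jJ dj; have [cl c8] := sys_d S jJ.
have c4 : count (d j) R6 = 4 by apply: (plane_half (u := 0%num) cl c8 R6_0).
case: (cl) => q0 qD.
split; last first.
  by move=> x xR; rewrite bit_li xR; case: eqP => [->|_] /=; rewrite ?andbT ?andbF.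
apply: li_Ls => //; first by move=> x y xR yR; apply: qD; apply: R6_R7.
move=> x xR px x0; apply: contraNT x0 => nx; apply/eqP/eqP; apply/negPn/negP => x0.
have [m mP ox] := not_isp_orth xR nx; have [i iI [E oi]] := hasp_ABC_orth mP.
have := sys_pd S iI jJ; rewrite leqNgt => /negP; apply.
apply: (count_gt2 xR x0) => /=; first by rewrite q0 orth0.
  by rewrite dj.
by rewrite px; apply/allP => y yR; apply/implyP; rewrite E //; apply: ox.
Qed.

Lemma lsof_disj : {in lsof p &, forall l m, l != m -> disj l m}.
Proof.
move=> l m; rewrite !mem_filter => /andP[/linebP[i iI Ei] lL] /andP[/linebP[j jI Ej] mL] lm.
apply/disjP => x; apply/negP => /andP[lx mx].
have xR := P42_R6 (Ls_P42 lL lx).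
case: (eqVneq i j) => [ij|ij].
  case/eqP: lm; apply: Ls_inj => // y yR.
  have := Ei y yR; rewrite ij Ej //; case: eqP => [-> _|_ /= -> //]; by rewrite !Ls_bit0.
have x0 : x = 0%num by apply: (sys_pp S iI jI ij); rewrite ?Ei ?Ej ?lx ?mx ?orbT ?R6_R7.
by move: lx; rewrite x0 Ls_bit0.
Qed.

Lemma msof_disj : {in msof d &, forall l m, l != m -> disj l m}.
Proof.
move=> l m; rewrite !mem_filter => /andP[/dlinebP[i iI [di Ei]] lL] /andP[/dlinebP[j jI [dj Ej]] mL] lm.
apply/disjP => x; apply/negP => /andP[lx mx].
have xR := P42_R6 (Ls_P42 lL lx).
case: (eqVneq i j) => [ij|ij].
  case/eqP: lm; apply: Ls_inj => // y yR.
  have := Ei y yR; rewrite ij Ej //; case: eqP => [-> _|_ /= -> //]; by rewrite !Ls_bit0.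
have := sys_dd S iI jI ij; rewrite leqNgt => /negP; apply.
have x0 : x != 0%num by apply: contraTneq lx => ->; rewrite Ls_bit0.
by apply: (count_gt2 xR x0); rewrite /= ?di ?dj // !Ei ?Ej ?R6_0 // ?lx ?mx ?orbT.
Qed.

Lemma size_lsof : 14 <= size (lsof p).
Proof.
set s := [seq i <- enum I | ~~ orth (p i) 64].
have sI i : i \in s -> i \in I /\ ~~ orth (p i) 64 by rewrite mem_filter mem_enum => /andP[].
have <- : size s = 14.
  have := ns_I H; rewrite /nI cardsE cardE => c3.
  have := sys_cI S; rewrite cardE -(count_predC (fun i => orth (p i) 64)) -!size_filter -/s.
  suff -> : size [seq i <- enum I | orth (p i) 64] = 3 by lia.
  by rewrite -c3; congr size; rewrite /enum_mem -filter_predI; apply: eq_filter => i; rewrite /= andbC.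
have us : uniq [seq li (p i) | i <- s].
  rewrite map_inj_in_uniq; first by rewrite filter_uniq ?enum_uniq.
  move=> i j /sI[iI oi] /sI[jI oj] E.
  apply/eqP/negPn/negP => ij.
  have [liL Ei] := line_plane iI oi; have [_ Ej] := line_plane jI oj.
  have [a [b [ab aP _ _ _]]] := mem_Ls liL; have aR := P42_R6 aP.
  have ba : bit (li (p i)) a by rewrite ab bit_mk inE eqxx.
  have a0 : a = 0%num by apply: (sys_pp S iI jI ij); rewrite ?Ei ?Ej -?E ?ba ?orbT ?R6_R7.
  by move: ba; rewrite a0 Ls_bit0.
rewrite -(size_map (fun i => li (p i))); apply: uniq_leq_size => // _ /mapP[i /sI[iI oi] ->].
have [liL Ei] := line_plane iI oi; rewrite mem_filter liL andbT; apply/linebP; by exists i.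
Qed.

Lemma size_msof : 13 <= size (msof d).
Proof.
apply: leq_trans (ns_J H) _; rewrite /nJ cardE.
set s := enum _; have sJ j : j \in s -> j \in J /\ d j 64 by rewrite mem_enum => /setIdP[].
have us : uniq [seq li (d j) | j <- s].
  rewrite map_inj_in_uniq; first by rewrite enum_uniq.
  move=> i j /sJ[iI oi] /sJ[jI oj] E.
  apply/eqP/negPn/negP => ij.
  have [liL Ei] := dline_plane iI oi; have [_ Ej] := dline_plane jI oj.
  have [a [b [ab aP _ _ _]]] := mem_Ls liL; have aR := P42_R6 aP.
  have ba : bit (li (d i)) a by rewrite ab bit_mk inE eqxx.
  have := sys_dd S iI jI ij; rewrite leqNgt => /negP; apply.
  have x0 : a != 0%num by apply: contraTneq ba => ->; rewrite Ls_bit0.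
  have bj : bit (li (d j)) a by rewrite -E.
  have [[di0 _] _] := sys_d S iI; have [[dj0 _] _] := sys_d S jI.
  have dia : d i a by rewrite (Ei a aR) ba orbT.
  have dja : d j a by rewrite (Ej a aR) bj orbT.
  by apply: (count_gt2 aR x0); rewrite /predI /= ?oi ?oj ?di0 ?dj0 ?dia ?dja.
rewrite -(size_map (fun i => li (d i))); apply: uniq_leq_size => // _ /mapP[i /sJ[iI oi] ->].
have [liL Ei] := dline_plane iI oi; rewrite mem_filter liL andbT; apply/dlinebP; by exists i.
Qed.

(** If the dual line annihilates the line, then for each of its functionals k either k or k + 64
    annihilates the whole plane over the line; with 0 this gives more than two common
    functionals. *)
Lemma not_orthl l m : l \in lsof p -> m \in msof d -> ~~ orthpts (pts l) (pts m).
Proof.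
rewrite !mem_filter => /andP[/linebP[i iI Ei] lL] /andP[/dlinebP[j jJ [dj Ej]] mL].
rewrite /orthpts vallE; apply/negP => /allP Ho.
have [a [b [mE aP bP _ abu]]] := mem_Ls mL; have aR := P42_R6 aP.
have {}Ho k x : bit l x -> bit m k -> ~~ pdot x k.
  by rewrite -!mem_pts => xl km; have := Ho x xl; rewrite vallE => /allP; apply.
have [cl c8] := sys_p S iI; case: (cl) => q0 qD.
have [u uR pu] : exists2 u, u \in R6 & p i (64 ^^ u)%num.
  apply/hasP; rewrite has_count; have := c8; rewrite count_R7.
  have -> : count (p i) R6 = 4.
    by rewrite -(eqP (allP Ls_count l lL)); apply: eq_in_count.
  by move=> /(congr1 (fun n => n - 4)); rewrite addKn => ->.
have lx0 k x : bit m k -> x \in R6 -> p i x -> pdot x k = false.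
  move=> km xR; rewrite Ei // => /orP[/eqP -> | lx]; last exact/negbTE/Ho.
  by rewrite /pdot N.land_0_l.
(* The plane is generated by the line and 64 + u, so only the value at 64 + u has to be
   corrected. *)
pose g k := if pdot u k then (64 ^^ k)%num else k.
have gR k : k \in R6 -> g k \in R7 by rewrite /g => kR; case: (pdot u k); rewrite ?R6_64 ?R6_R7.
have gd k : k \in R6 -> bit m k -> d j (g k).
  move=> kR km; have dk : d j k by rewrite Ej // km orbT.
  rewrite /g; case: (pdot u k) => //; have [[_ dD] _] := sys_d S jJ.
  have R64 : 64%num \in R7 by vm_compute.
  exact: dD R64 (R6_R7 kR) dj dk.
have go k : k \in R6 -> bit m k -> orth (p i) (g k).
  move=> kR km; apply/allP => x xR7; apply/implyP => px.
  have [xR|[y yR xE]] := R7_case xR7.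
    rewrite /g; case: (pdot u k); rewrite ?pdotDr (lx0 k) ?(pdot64 xR) //.
  have pyu : p i (y ^^ u).
    have := qD _ _ (R6_64 uR) xR7 pu px; rewrite xE -N.lxor_assoc (N.lxor_comm 64 u).
    by rewrite lxorK N.lxor_comm.
  have := lx0 _ _ km (R6_lxor yR uR) pyu; rewrite pdotD xE /g.
  by case: (pdot u k); case yk : (pdot y k) => // _; rewrite !pdotD ?(pdot_64 kR) ?yk // pdotDr (pdot64 yR) yk.
have bR := P42_R6 bP.
have ma : bit m a by rewrite mE bit_mk !inE eqxx.
have mb : bit m b by rewrite mE bit_mk !inE eqxx orbT.
have := sys_pd S iI jJ; rewrite leqNgt => /negP; apply.
apply: (@count_ge _ [:: 0%num; g a; g b]).
  have g0 k : k \in R6 -> k != 0%num -> 0%num != g k.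
    by move=> kR k0; rewrite /g eq_sym; case: (pdot u k); rewrite ?R6_neq64 ?R6_0.
  have m0 k : bit m k -> k != 0%num by move=> km; apply: contraTneq km => ->; rewrite Ls_bit0.
  rewrite /= !inE negb_or !g0 ?m0 // andbT /=.
  move: abu; rewrite /= !inE negb_or => /andP[/andP[ab _] _].
  rewrite /g; case: (pdot u a); case: (pdot u b).
  - rewrite andbT; apply: contra ab => /eqP /(congr1 (N.lxor 64)).
    by rewrite -!N.lxor_assoc N.lxor_nilpotent !N.lxor_0_l => ->.
  - by rewrite R6_neq64.
  - by rewrite eq_sym R6_neq64.
  - by rewrite ab.
have [[d0 _] _] := sys_d S jJ.
have A k : k \in R6 -> bit m k -> (g k \in R7) && predI (d j) (orth (p i)) (g k).
  by move=> kR km; rewrite gR //=; apply/andP; split; [apply: gd | apply: go].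
apply/allP => x xs; rewrite !inE in xs; case/or3P: xs => /eqP ->; [|exact: A|exact: A].
by rewrite (R6_R7 R6_0) andTb; apply/andP; split=> //; apply: orth0.
Qed.
End Normal.
End System.

(** * Every line of the Fano plane is the domain of exactly two lines *)

Definition line_no i := nth 0%num fano i.
(** Each point of the Fano plane with the positions in [fano] of the three lines through it. *)
Definition incidence : seq (N * seq nat) :=
  [:: (1%num, [:: 0; 1; 2]); (2%num, [:: 0; 3; 4]); (3%num, [:: 0; 5; 6]); (4%num, [:: 1; 3; 5]);
      (5%num, [:: 1; 4; 6]); (6%num, [:: 2; 3; 6]); (7%num, [:: 2; 4; 5])].
Definition column x := [seq z <- P42 | N.land z 7 == x].
Lemma fano_ok : all (fun l => all (fun xs =>
  count (bit l) (column xs.1) == sumn [seq nat_of_bool (dom l == line_no i) | i <- xs.2]) incidence) Ls.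
Proof. by vm_compute. Qed.
Lemma column_ok : all (fun xs => size (column xs.1) == 6) incidence. Proof. by vm_compute. Qed.
Lemma Ls_count3 : all (fun l => count (bit l) P42 == 3) Ls. Proof. by vm_compute. Qed.
Lemma size_P42 : size P42 = 42. Proof. by vm_compute. Qed.
Lemma Ls_Pm3 : all (fun m => count (fun z => ~~ disj m z) Pm == 3) Ls. Proof. by vm_compute. Qed.
Lemma Ls_uniq : uniq Ls. Proof. by vm_compute. Qed.
Lemma fanoE k : k \in fano -> exists2 i, i < 7 & k = line_no i.
Proof. by move=> H; exists (index k fano); rewrite ?index_mem /line_no ?nth_index. Qed.
Opaque fano dom.

Lemma sum_count_swap (A B : Type) (r : A -> B -> bool) s t :
  \sum_(a <- s) count (r a) t = \sum_(b <- t) count (r^~ b) s.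
Proof.
under eq_bigr => a _ do rewrite -sum1_count big_mkcond.
by rewrite exchange_big; apply: eq_bigr => b _; rewrite -big_mkcond sum1_count.
Qed.

Section Domains.
Variable ls : seq N.
Hypotheses (lsu : uniq ls) (lsL : {subset ls <= Ls}) (lsd : {in ls &, forall l m, l != m -> disj l m}).
Hypothesis size_ls : 14 <= size ls.

Lemma cover_le1 z : count (bit^~ z) ls <= 1.
Proof.
rewrite -size_filter; set s := filter _ _; have us : uniq s by rewrite filter_uniq.
have Hs l : l \in s -> l \in ls /\ bit l z by rewrite mem_filter => /andP[].
case: s us Hs => [|l [|m s]] // us Hs; have lm : l != m by case/and3P: us; rewrite inE negb_or => /andP[].
have [lls bl] := Hs l (mem_head _ _); have [mls bm] : m \in ls /\ bit m z by apply: Hs; rewrite !inE eqxx orbT.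
by have /disjP/(_ z) := lsd lls mls lm; rewrite bl bm.
Qed.

(** Fourteen disjoint lines of three points fill all 42 points. *)
Lemma cover1 z : z \in P42 -> count (bit^~ z) ls = 1.
Proof.
move=> zP; apply/eqP; rewrite eqn_leq cover_le1 lt0n; apply/negP => /eqP c0.
have : \sum_(l <- ls) count (bit l) P42 = 3 * size ls.
  rewrite -sum1_size big_distrr; apply: eq_big_seq => l /lsL lL.
  by rewrite (eqP (allP Ls_count3 l lL)).
rewrite sum_count_swap (big_rem z zP) /= c0 add0n => E.
have : \sum_(y <- rem z P42) count (bit^~ y) ls <= \sum_(y <- rem z P42) 1 by apply: leq_sum => y _; apply: cover_le1.
by rewrite sum1_size size_rem // size_P42 E; lia.
Qed.

(** The six points with first coordinate x are covered once each, and precisely by the lines whose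
    domain contains x. *)
Lemma incidence_sum xs : xs \in incidence ->
  \sum_(i <- xs.2) count (fun l => dom l == line_no i) ls = 6.
Proof.
move=> xI; have : \sum_(l <- ls) count (bit l) (column xs.1) = 6.
  rewrite sum_count_swap -(eqP (allP column_ok xs xI)) -sum1_size; apply: eq_big_seq => z.
  by rewrite mem_filter => /andP[_ zP]; apply: cover1.
move=> <-; rewrite -sum_count_swap; apply: eq_big_seq => l /lsL lL.
rewrite (eqP (allP (allP fano_ok l lL) xs xI)) sumnE big_map -sum1_count big_mkcond.
by apply: eq_bigr => i _; case: (_ == _).
Qed.

(** The incidence matrix of the Fano plane is invertible, so the seven equations with right-hand
    side 6 have the single solution 2, ..., 2. *)
Lemma domain_pair k : k \in fano -> exists l m, [/\ l \in ls, m \in ls, l != m, dom l = k & dom m = k].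
Proof.
move=> /fanoE[i i7 ->].
have c2 : count (fun l => dom l == line_no i) ls = 2.
  have inc := @incidence_sum; rewrite /incidence in inc.
  have := inc (1%num, [:: 0; 1; 2]) isT; have := inc (2%num, [:: 0; 3; 4]) isT; have := inc (3%num, [:: 0; 5; 6]) isT.
  have := inc (4%num, [:: 1; 3; 5]) isT; have := inc (5%num, [:: 1; 4; 6]) isT; have := inc (6%num, [:: 2; 3; 6]) isT.
  have := inc (7%num, [:: 2; 4; 5]) isT; rewrite !big_cons !big_nil !addn0 /=.
  pose c j := count (fun l => dom l == line_no j) ls.
  rewrite -/(c 0) -/(c 1) -/(c 2) -/(c 3) -/(c 4) -/(c 5) -/(c 6) -/(c i).
  move: c => c; case: i i7 => [|[|[|[|[|[|[|i]]]]]]] // _; lia.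
move: c2; rewrite -size_filter; set s := filter _ _; have us : uniq s by rewrite filter_uniq.
have Hs l : l \in s -> l \in ls /\ dom l = line_no i by rewrite mem_filter => /andP[/eqP].
case: s us Hs => [|l [|m [|]]] // us Hs _; exists l, m.
have [lls dl] := Hs l (mem_head _ _); have [mls dm] : m \in ls /\ dom m = line_no i by apply: Hs; rewrite !inE eqxx orbT.
by split=> //; case/and3P: us; rewrite inE.
Qed.
End Domains.

(** * Pairs of lines, masks of dual lines and the stages of the search *)

Section FoldBits.
Variables (A : Type) (f : A -> bool) (a0 : A).
Lemma bit_fold s i : i < size s -> bit (fold_bits f s) (N.of_nat i) = f (nth a0 s i).
Proof.
elim: s i => [|t s IH] [|i] // H; rewrite [fold_bits _ _]/=.
  by rewrite /bit; case: (f t); rewrite N.bit0_odd; case: (fold_bits f s).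
rewrite Nnat.Nat2N.inj_succ /bit; case: (f t); rewrite ?N.succ_double_spec ?N.double_spec.
  by rewrite N.testbit_odd_succ; [exact: IH | lia].
by rewrite N.testbit_even_succ; [exact: IH | lia].
Qed.
End FoldBits.

Lemma avlP a l i : i < size l -> bit a (N.of_nat i) -> nth 0%num l i \in avl a l.
Proof.
elim: l a i => [|m l IH] a [|i] // H.
  by rewrite /bit N.bit0_odd /= => ->; rewrite inE eqxx.
rewrite /bit Nnat.Nat2N.inj_succ -N.add_1_r -N.shiftr_spec' -N.div2_spec => Hb.
have H2 := IH (N.div2 a) i H Hb; rewrite /=; case: (N.odd a) => /=; by rewrite ?inE H2 ?orbT.
Qed.

Lemma avmaskE L s : avmask L s = foldr (fun t a => if orthpts s t.2 then N.double a else N.succ_double a) 0%num L.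
Proof. by []. Qed.
Opaque avmask.
Definition av l := avmask Lp (pts l).
Lemma nth_Lp i : i < size Ls -> nth (0%num, [::]) Lp i = (nth 0%num Ls i, pts (nth 0%num Ls i)).
Proof. by move=> H; rewrite /Lp (nth_map 0%num). Qed.
Lemma size_Lp : size Lp = size Ls. Proof. by rewrite /Lp size_map. Qed.
Lemma LTE : LT = [seq (m, av m, dom m) | m <- Ls].
Proof. by rewrite /LT {2}/Lp -map_comp; apply: eq_map => m; rewrite /comp /av. Qed.
Lemma entriesE : entries = [seq (d, pairsof [seq t.1 | t <- LT & t.2 == d]) | d <- fano].
Proof. by rewrite /entries. Qed.
Opaque Lp LT entries.

Lemma bit_av l i : i < size Ls -> bit (av l) (N.of_nat i) = ~~ orthpts (pts l) (pts (nth 0%num Ls i)).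
Proof.
move=> H; have -> : av l = fold_bits (fun t : N * seq N => ~~ orthpts (pts l) t.2) Lp.
  rewrite /av avmaskE /fold_bits; by elim: (Lp) => //= t s ->; case: (orthpts _ _).
by rewrite (bit_fold _ (0%num, [::])) ?size_Lp // nth_Lp.
Qed.

Lemma pairsof_sound T e : e \in pairsof T -> exists t u, [/\ t \in T, u \in T &
  e = E t.1 u.1 (N.lor t.1 u.1) (N.land t.2 u.2)].
Proof.
elim: T => [|[m a] T IH] //=; rewrite mem_cat => /orP[/mapP[u] | /IH[t [u [tT uT ->]]]].
  by rewrite mem_filter => /andP[_ uT] ->; exists (m, a), u; rewrite !inE eqxx uT orbT.
by exists t, u; rewrite !inE tT uT !orbT.
Qed.

Lemma pairsof_complete T t u : t \in T -> u \in T -> t != u -> disj t.1 u.1 ->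
  exists2 e, e \in pairsof T & (e1 e = t.1 /\ e2 e = u.1) \/ (e1 e = u.1 /\ e2 e = t.1).
Proof.
elim: T => [|[m a] T IH] //; rewrite !inE => /orP[/eqP -> | tT] /orP[/eqP -> | uT] tu dj.
- by rewrite eqxx in tu.
- exists (E m u.1 (N.lor m u.1) (N.land a u.2)); last by left.
  by rewrite /= mem_cat; apply/orP; left; apply/mapP; exists u; rewrite // mem_filter dj.
- exists (E m t.1 (N.lor m t.1) (N.land a t.2)); last by right.
  by rewrite /= mem_cat; apply/orP; left; apply/mapP; exists t; rewrite // mem_filter disjC dj.
by have [e eT He] := IH tT uT tu dj; exists e; rewrite // /= mem_cat eT orbT.
Qed.

Section Search.
Variables (X : finType) (I J : {set X}).
Implicit Types p d : X -> N -> bool.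

Definition sel p (k : N) (e : entry) : Prop :=
  [/\ e1 e \in lsof I p, e2 e \in lsof I p, dom (e1 e) = k /\ dom (e2 e) = k,
      em e = N.lor (e1 e) (e2 e) & ea e = N.land (av (e1 e)) (av (e2 e))].

Lemma lsof_Ls p : {subset lsof I p <= Ls}. Proof. by move=> l; rewrite mem_filter => /andP[]. Qed.
Lemma msof_Ls d : {subset msof J d <= Ls}. Proof. by move=> l; rewrite mem_filter => /andP[]. Qed.

Lemma lsof_uniq p : uniq (lsof I p). Proof. exact: filter_uniq Ls_uniq. Qed.
Lemma msof_uniq d : uniq (msof J d). Proof. exact: filter_uniq Ls_uniq. Qed.

Lemma entries_sel p d : NS I J p d -> forall l, l \in entries -> exists2 e, e \in l.2 & sel p l.1 e.
Proof.
move=> H l; rewrite entriesE => /mapP[k kF ->].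
have [a [b [als bls ab da db]]] := domain_pair (lsof_uniq p) (@lsof_Ls p) (lsof_disj H) (size_lsof H) kF.
set T := [seq t.1 | t <- LT & t.2 == k].
have TP t : t \in T -> [/\ t.1 \in Ls, t.2 = av t.1 & dom t.1 = k].
  by rewrite /T LTE => /mapP[u]; rewrite mem_filter => /andP[/eqP uk /mapP[m mL E] ->]; move: uk; rewrite E => uk; split.
have inT m : m \in Ls -> dom m = k -> (m, av m) \in T.
  move=> mL dm; apply/mapP; exists (m, av m, k); rewrite // mem_filter eqxx LTE.
  by apply/mapP; exists m; rewrite // dm.
have [||e eT He] := pairsof_complete (inT a (lsof_Ls als) da) (inT b (lsof_Ls bls) db).
- by apply: contra ab => /eqP[->].
- exact: lsof_disj H _ _ als bls ab.
exists e => //; have [t [u [tT uT eE]]] := pairsof_sound eT.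
have [_ ta dt] := TP t tT; have [_ ua du] := TP u uT.
move: He; rewrite /sel eE /e1 /e2 /em /ea /= ta ua => He.
by case: He => -[E1 E2]; split=> //; rewrite ?E1 ?E2 //.
Qed.

Lemma sel_disj p d k k' e e' : NS I J p d -> sel p k e -> sel p k' e' -> k != k' -> disj (em e) (em e').
Proof.
move=> H [l1 l2 [d1 d2] -> _] [l1' l2' [d1' d2'] -> _] kk'; apply/disjP => x.
rewrite !bit_lor; apply/negP => /andP[bx bx'].
have [l [ls bl dl]] : exists l, [/\ l \in lsof I p, bit l x & dom l = k].
  by case/orP: bx => b; [exists (e1 e) | exists (e2 e)].
have [m [ms bm dm]] : exists m, [/\ m \in lsof I p, bit m x & dom m = k'].
  by case/orP: bx' => b; [exists (e1 e') | exists (e2 e')].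
have lm : l != m by apply: contraNneq kk' => E; rewrite -dl -dm E.
by have /disjP/(_ x) := lsof_disj H ls ms lm; rewrite bl bm.
Qed.

(** The search invariant: no dual line of the system ever drops out of the mask. *)
Definition okav d a := forall i, i < size Ls -> nth 0%num Ls i \in msof J d -> bit a (N.of_nat i).

Lemma okav_av p d l : NS I J p d -> l \in lsof I p -> okav d (av l).
Proof. by move=> H ls i iL im; rewrite bit_av //; apply: (not_orthl H ls im). Qed.

Lemma okav_land d a b : okav d a -> okav d b -> okav d (N.land a b).
Proof. by move=> Ha Hb i iL im; rewrite bit_land Ha ?Hb. Qed.

Definition okst p d st := okav d (sa st) /\ {subset sl st <= lsof I p}.

Lemma okst_step p d st k e : NS I J p d -> okst p d st -> sel p k e -> okst p d (sstep st e).
Proof.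
move=> H [Ha Hl] [l1 l2 _ _ eE]; split=> /=.
  by apply: okav_land => //; rewrite eE; apply: okav_land; apply: okav_av H _.
by move=> l; rewrite !inE => /or3P[/eqP -> // | /eqP -> // | /Hl].
Qed.

Lemma ptmaskE : ptmask = [seq fold_bits (bit^~ z) Ls | z <- P42]. Proof. by rewrite /ptmask. Qed.
Opaque ptmask.

Lemma okst_prune p d st : NS I J p d -> okst p d st -> ~~ sprune 3 ptmask st.
Proof.
move=> H [Ha _]; rewrite /sprune negb_and; apply/orP; right; rewrite -ltnNge ltnS /dead.
have sub : {subset msof J d <= msof J d} by [].
have m3 : {in msof J d, forall m, count (fun z => ~~ disj m z) Pm = 3}.
  by move=> m /msof_Ls mL; apply/eqP; apply: (allP Ls_Pm3).
have := mu_prune Pm_mk (msof_uniq d) sub (msof_disj H) m3.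
move=> C; have := size_msof H; rewrite PmE count_map in C; rewrite ptmaskE count_map => s13.
set c := count _ _; set c' := count _ _ in C.
suff : c' + c <= 42 by lia.
rewrite -size_P42 -(count_predC (preim (fun z => mk [:: z]) (fun z => has (fun m => ~~ disj m z) (msof J d)))).
rewrite leq_add2l; apply: sub_count => z dz; have {}dz : disj (sa st) (fold_bits (bit^~ z) Ls) := dz.
change (~~ has (fun m => ~~ disj m (mk [:: z])) (msof J d)).
apply/hasPn => m mm; rewrite disj_mk1.
apply/negP => mz; have mL := msof_Ls mm.
have iL : index m Ls < size Ls by rewrite index_mem.
have := disjP _ _ dz (N.of_nat (index m Ls)).
by rewrite (bit_fold _ 0%num) // nth_index // mz Ha ?nth_index.
Qed.

Lemma okst_leaf p d st r : NS I J p d -> okst p d st ->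
  (forall ls, {subset ls <= lsof I p} -> ~~ lifts kill r.1 r.2 ls) -> ~~ leaf r st.
Proof.
move=> H [Ha Hl] Hlift; rewrite /leaf; case: ifP => [Hmu|_]; last exact: Hlift.
have := size_msof H; rewrite leqNgt => /negP []; apply: muP Hmu (msof_uniq d) _ (msof_disj H) _.
  move=> m mm; have mL := msof_Ls mm; have iL : index m Ls < size Ls by rewrite index_mem.
  have := avlP iL (Ha _ iL _); rewrite nth_index //; exact.
by move=> m /msof_Ls mL; apply/eqP; apply: (allP Ls_Pm3).
Qed.

Lemma stage_sound p d r (ents : seq (N * seq entry)) : NS I J p d -> r.1 \in lsof I p -> r.2 \in lsof I p -> dom r.2 = dom r.1 ->
  (forall ls, {subset ls <= lsof I p} -> ~~ lifts kill r.1 r.2 ls) ->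
  uniq (map fst ents) -> (forall l, l \in ents -> exists2 e, e \in l.2 & sel p l.1 e) ->
  ~~ stage leaf ptmask r ents.
Proof.
move=> H r1 r2 d12 Hlift uents Hents.
have sd := @sel_disj p d; apply: (@dfs_sound _ _ _ _ _ _ _ (sel p) (okst p d)).
- by move=> k k' e e' s s' kk'; apply: (sel_disj H s s').
- by move=> st k e; apply: okst_step.
- by move=> st; apply: okst_prune.
- by move=> st ok; apply: (okst_leaf H ok Hlift).
- by split=> //; apply: okav_land; apply: okav_av H _.
- rewrite -map_comp; have -> : map (fst \o (fun l : N * seq entry => (l.1, [seq t <- l.2 | disj (em t) (N.lor r.1 r.2)])))
    [seq l <- ents | ~~ N.eqb l.1 (dom r.1)] = map fst [seq l <- ents | ~~ N.eqb l.1 (dom r.1)] by apply: eq_map.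
  exact: subseq_uniq (map_subseq _ (filter_subseq _ _)) uents.
move=> l0 /mapP[l]; rewrite mem_filter => /andP[ld lE] -> /=.
have [e el se] := Hents l lE; exists e => //; rewrite mem_filter el andbT.
have sr : sel p (dom r.1) (E r.1 r.2 (N.lor r.1 r.2) (N.land (av r.1) (av r.2))) by [].
by apply: sel_disj H se sr _; rewrite -Neqb.
Qed.
End Search.

(** * Changes of basis *)

Lemma pdot_linl b x y : pdot (linN b x) y = lin addb false [seq pdot v y | v <- b] x.
Proof.
elim: b x => [|v b IH] x; first by rewrite /pdot N.land_0_l.
by rewrite [linN _ _]/= pdotD IH /=; case: (N.odd x); rewrite // /pdot N.land_0_l.
Qed.

(** The form on two images depends on the bases only through their Gram matrix; comparison with the
    standard basis then yields [frame_pdot]. *)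
Lemma pdot_lin2 b d x k :
  pdot (linN b x) (linN d k) = lin addb false [seq lin addb false r k | r <- gram b d] x.
Proof.
rewrite pdot_linl; congr (lin _ _ _ _); rewrite /gram -map_comp; apply: eq_map => v /=.
by rewrite pdotC pdot_linl; congr (lin _ _ _ _); apply: eq_map => w; apply: pdotC.
Qed.

Lemma linN_std : all (fun x => linN stdb x == x) R7. Proof. by vm_compute. Qed.
Lemma pdot_nondeg : all (fun x => (x == 0%num) || has (pdot x) R7) R7. Proof. by vm_compute. Qed.
Opaque stdb.

Definition ABC := [:: planeA; planeB; planeC].
Lemma ABC_pts : all (fun m => all (fun y => y \in R7) (pts m)) ABC. Proof. by vm_compute. Qed.
Lemma ABC_R7 m y : m \in ABC -> bit m y -> y \in R7.
Proof. by move=> mA; rewrite -mem_pts => ym; apply: (allP (allP ABC_pts m mA)). Qed.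

Section Frame.
Variables (b d : seq N).
Hypothesis bd : dualb b d.

Lemma frame_R7l x : linN b x \in R7.
Proof.
apply: linN_R7 => y yb; rewrite mem_R7; case/andP: bd; rewrite vallE => /allP H _.
by apply: H; rewrite mem_cat yb.
Qed.

Lemma frame_R7r x : linN d x \in R7.
Proof.
apply: linN_R7 => y yb; rewrite mem_R7; case/andP: bd; rewrite vallE => /allP H _.
by apply: H; rewrite mem_cat yb orbT.
Qed.

Lemma frame_pdot : {in R7 &, forall x k, pdot (linN b x) (linN d k) = pdot x k}.
Proof.
move=> x k xR kR; case/andP: bd => _ /eqP E.
by rewrite pdot_lin2 E -pdot_lin2 (eqP (allP linN_std x xR)) (eqP (allP linN_std k kR)).
Qed.

Lemma pdot_sep x y : x \in R7 -> y \in R7 -> {in R7, pdot x =1 pdot y} -> x = y.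
Proof.
move=> xR yR E; apply: lxor_eq0; apply/eqP.
have /orP[//|/hasP[k kR]] := allP pdot_nondeg _ (R7_lxor xR yR).
by rewrite pdotD E // addbb.
Qed.

Lemma frame_injl : {in R7 &, injective (linN b)}.
Proof. by move=> x y xR yR E; apply: pdot_sep => // k kR; rewrite -frame_pdot // E frame_pdot. Qed.

Lemma frame_injr : {in R7 &, injective (linN d)}.
Proof.
move=> x y xR yR E; apply: pdot_sep => // k kR; rewrite pdotC [RHS]pdotC -frame_pdot //.
by rewrite E frame_pdot.
Qed.

Lemma bit_imgm m x : (forall y, bit m y -> y \in R7) -> x \in R7 -> bit (imgm b m) (linN b x) = bit m x.
Proof.
move=> mR xR; rewrite bit_mk -mem_pts; apply/mapP/idP => [[y ym E] | xm]; last by exists x.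
by rewrite (frame_injl xR _ E) //; apply: mR; rewrite -mem_pts.
Qed.

Variables (X : finType) (I J : {set X}).

Lemma frame_sys p e : sys I J p e ->
  sys I J (fun i => p i \o linN b) (fun j => e j \o linN d) /\
  {in R7, forall k, nI I (fun i => p i \o linN b) k = nI I p (linN d k)} /\
  (sgood I J (fun i => p i \o linN b) (fun j => e j \o linN d) -> sgood I J p e).
Proof.
move=> Hs; apply: sys_pull => //; first by move=> x _; apply: frame_R7l.
- exact: frame_injl.
- exact: linN_lxor.
- by move=> x _; apply: frame_R7r.
- exact: frame_injr.
- by move=> x y _ _; apply: linN_lxor.
- exact: frame_pdot.
Qed.

Lemma frame_hasp p m : (forall y, bit m y -> y \in R7) -> hasp I p (imgm b m) ->
  hasp I (fun i => p i \o linN b) m.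
Proof.
move=> mR /haspP[i iI E]; apply/haspP; exists i => // x xR /=.
by rewrite E ?frame_R7l // bit_imgm.
Qed.

Lemma frame_lineb p l : l \in Ls -> {in R6, forall x, linN b x \in R6} -> lineb I p (imgm b l) ->
  lineb I (fun i => p i \o linN b) l.
Proof.
move=> lL b6 /linebP[i iI E]; apply/linebP; exists i => // x xR /=.
rewrite E ?b6 // bit_imgm ?R6_R7 //; last by move=> y /(Ls_P42 lL) /P42_R6 /R6_R7.
congr (_ || _); apply/eqP/eqP => [H | ->]; last exact: linN0.
by apply: frame_injl; rewrite ?R6_R7 ?R6_0 // linN0.
Qed.

Definition frame_ok := [&& linN d 64%num == 64%num, all (fun m => imgm b m \in ABC) ABC & all (fun x => linN b x \in R6) R6].


Lemma frame_NS p e : frame_ok -> NS I J p e -> NS I J (fun i => p i \o linN b) (fun j => e j \o linN d).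
Proof.
move=> /and3P[/eqP d64 /allP HA _] H; have [s' [nI' sg']] := frame_sys (ns_sys H).
have R64 : 64%num \in R7 by vm_compute.
have hA m : m \in ABC -> hasp I (fun i => p i \o linN b) m.
  move=> mA; apply: frame_hasp; first by move=> y; apply: ABC_R7.
  by apply: (hasp_ABC H); apply: HA.
split=> //.
- by apply: contra (ns_bad H).
- by apply: hA; rewrite inE eqxx.
- by apply: hA; rewrite !inE eqxx orbT.
- by apply: hA; rewrite !inE eqxx !orbT.
- by rewrite nI' // d64 (ns_I H).
- by have := ns_J H; rewrite /nJ /= d64.
Qed.
End Frame.

Lemma group_ok : all (fun g => dualb g.1 g.2 && frame_ok g.1 g.2) group.
Proof. by vm_compute. Qed.

Definition inl l x := (x == 0%num) || bit l x.

Lemma inl_lxor l x y : l \in Ls -> inl l x -> inl l y -> inl l (x ^^ y).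
Proof.
move=> /mem_Ls[a [b [-> _ _ _ _]]]; rewrite /inl !bit_mk !inE.
have aab : a ^^ (a ^^ b) = b by rewrite -N.lxor_assoc N.lxor_nilpotent N.lxor_0_l.
have bab : b ^^ (a ^^ b) = a by rewrite N.lxor_comm lxorK.
have aba : a ^^ b ^^ a = b by rewrite (N.lxor_comm a b) lxorK.
by case/or4P=> /eqP ->; case/or4P=> /eqP ->;
  rewrite ?N.lxor_0_l ?N.lxor_0_r ?N.lxor_nilpotent ?aab ?bab ?aba ?lxorK ?(N.lxor_comm b a) ?eqxx ?orbT.
Qed.

Lemma inl_lxorE l x y : l \in Ls -> inl l y -> inl l (x ^^ y) = inl l x.
Proof.
move=> lL ly; apply/idP/idP => H; last exact: inl_lxor.
by rewrite -(lxorK x y); apply: inl_lxor.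
Qed.

Lemma bit_coset l q x : bit (coset l q) x = inl l (x ^^ q).
Proof.
rewrite /coset bit_mk inE /inl; congr (_ || _).
  by apply/eqP/eqP => [-> | /lxor_eq0 //]; rewrite N.lxor_nilpotent.
rewrite -mem_pts; apply/mapP/idP => [[z zl ->] | H].
  by rewrite (N.lxor_comm q z) lxorK.
by exists (x ^^ q); rewrite // N.lxor_comm lxorK.
Qed.

Lemma R6_bounds : all (fun x => [&& N.ltb x 64, N.leb 64 (64 ^^ x) & ((64 ^^ x) - 64)%num == x]) R6.
Proof. by vm_compute. Qed.

Lemma bit_plane_lo l q x : x \in R6 -> bit (plane l q) x = inl l x.
Proof.
move=> xR; have /and3P[/N.ltb_spec0 x64 _ _] := allP R6_bounds x xR.
by rewrite /plane bit_lor bit_setbit [X in _ || X]/bit N.shiftl_spec_low // orbF.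
Qed.

Lemma bit_plane_hi l q x : l \in Ls -> x \in R6 -> bit (plane l q) (64 ^^ x)%num = inl l (x ^^ q).
Proof.
move=> lL xR; have /and3P[_ /N.leb_spec0 x64 /eqP xE] := allP R6_bounds x xR.
rewrite /plane bit_lor bit_setbit [X in _ || X]/bit N.shiftl_spec_high'; last exact: x64.
rewrite xE -[N.testbit _ _]/(bit _ _) bit_coset (negbTE (R6_neq64 xR R6_0)).
case: (boolP (bit l _)) => // /(Ls_P42 lL) /P42_R6 H.
by have := R6_neq64 xR H; rewrite eqxx.
Qed.

Lemma qreps_ok : all (fun l => let Q := qreps l in all (fun q0 => has (fun q => inl l (q ^^ q0)) Q) R6) Ls.
Proof. by vm_compute. Qed.

(** The shear that fixes the kernel pointwise and sends 64 to 64 + s. Its contragredient [ed] adds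
    64 to the unit functionals that do not vanish at s. *)
Definition eb s := [:: 1; 2; 4; 8; 16; 32; 64 ^^ s]%num.
Definition ed s := rcons [seq (if N.testbit s i then 64 ^^ N.pow 2 i else N.pow 2 i)%num | i <- rng 6] 64%num.
Lemma eframe_ok : all (fun s => [&& dualb (eb s) (ed s), frame_ok (eb s) (ed s),
  all (fun x => linN (eb s) x == x) R6 & linN (eb s) 64 == 64 ^^ s]%num) R6.
Proof. by vm_compute. Qed.

(** The last clause says that every second lift reaches [qreps2] by a translation along the first
    line, up to the second line itself. *)
Definition rep_ok (r : N * N) := [&& r.1 \in Ls, r.2 \in Ls, N.eqb (dom r.2) (dom r.1) &
  all (fun q => has (fun t => has (fun q' => inl r.2 (q' ^^ (q ^^ t))) (qreps2 r.1 r.2)) (0%num :: pts r.1)) R6].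
Lemma reps_ok : all rep_ok reps. Proof. by vm_compute. Qed.
Lemma qreps_R6 l q : q \in qreps l -> q \in R6.
Proof. by rewrite /qreps mem_filter => /andP[]. Qed.
Opaque qreps.

(** * Lifting lines to planes *)

Section Lifts.
Variables (X : finType) (I J : {set X}).
Implicit Types p d : X -> N -> bool.

Lemma mem_lsof p l : (l \in lsof I p) = lineb I p l && (l \in Ls). Proof. by rewrite mem_filter. Qed.

Lemma hasp_coset p l q q' : l \in Ls -> hasp I p (plane l q) -> inl l (q ^^ q') -> hasp I p (plane l q').
Proof.
move=> lL /haspP[i iI E] lq; apply/haspP; exists i => // x xR; rewrite E //.
have [x6|[y y6 ->]] := R7_case xR; first by rewrite !bit_plane_lo.
rewrite !bit_plane_hi // -(inl_lxorE (y ^^ q) lL lq).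
by rewrite -N.lxor_assoc lxorK.
Qed.

Lemma lift_exists p d l : NS I J p d -> l \in lsof I p -> exists2 q, q \in R6 & hasp I p (plane l q).
Proof.
move=> H; rewrite mem_lsof => /andP[/linebP[i iI E] lL].
have [cl c8] := sys_p (ns_sys H) iI; case: (cl) => q0 qD.
have [u uR pu] : exists2 u, u \in R6 & p i (64 ^^ u)%num.
  apply/hasP; rewrite has_count; have := c8; rewrite count_R7.
  have -> : count (p i) R6 = 4.
    by rewrite -(eqP (allP Ls_count l lL)); apply: eq_in_count.
  by move=> /(congr1 (fun n => n - 4)); rewrite addKn => ->.
exists u => //; apply/haspP; exists i => // x xR.
have [x6|[y y6 ->]] := R7_case xR; first by rewrite bit_plane_lo // E.
rewrite bit_plane_hi // /inl -E ?R6_lxor //; apply/idP/idP => Hp.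
  have := qD _ _ (R6_64 uR) (R6_64 y6) pu Hp; rewrite -N.lxor_assoc (N.lxor_comm 64 u).
  by rewrite lxorK N.lxor_comm.
have := qD _ _ (R6_64 uR) (R6_R7 (R6_lxor y6 uR)) pu Hp.
by rewrite (N.lxor_comm y u) -N.lxor_assoc lxorK.
Qed.

Definition lsel p (l : N) (t : N * N) : Prop :=
  l \in lsof I p /\ exists2 q, q \in R6 & t = (coset l q, plane l q) /\ hasp I p (plane l q).

(** An element x common to two cosets makes 64 + x a nonzero vector common to two planes. *)
Lemma lsel_disj p d l l' t t' : NS I J p d -> lsel p l t -> lsel p l' t' -> l != l' -> disj t.1 t'.1.
Proof.
move=> H [ls [q qR [-> /haspP[i iI E]]]] [ls' [q' qR' [-> /haspP[j jI E']]]] ll'.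
move: ls ls'; rewrite !mem_lsof => /andP[_ lL] /andP[_ lL'].
apply/disjP => x; rewrite !bit_coset; apply/negP => /andP[b b'].
have xR : x \in R6.
  rewrite -(lxorK x q); apply: R6_lxor => //; move: b; rewrite /inl => /orP[/eqP -> | /(Ls_P42 lL) /P42_R6 //].
  exact: R6_0.
case: (eqVneq i j) => [ij|ij].
  case/eqP: ll'; apply: Ls_inj => // y yR.
  have := E y (R6_R7 yR); rewrite ij E' ?R6_R7 // !bit_plane_lo // /inl.
  by case: eqP => [-> _|_ /= ->]; rewrite ?Ls_bit0.
have : (64 ^^ x)%num = 0%num.
  by apply: (sys_pp (ns_sys H) iI jI ij); rewrite ?R6_64 // ?E ?E' ?R6_64 // bit_plane_hi.
by move/eqP; apply/negP; apply: R6_neq64 => //; apply: R6_0.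
Qed.

Lemma lifts_sound p d r ls : NS I J p d -> r.1 \in lsof I p -> r.2 \in lsof I p ->
  hasp I p (plane r.1 0) -> (exists2 q, q \in qreps2 r.1 r.2 & hasp I p (plane r.2 q)) ->
  (forall cfg, (forall m, m \in cfg -> hasp I p m) -> ~~ kill cfg) ->
  {subset ls <= lsof I p} -> ~~ lifts kill r.1 r.2 ls.
Proof.
move=> H r1 r2 h1 [q2 q2r h2] Hkill lsub; rewrite /lifts; case: ifP => // /negbFE ul.
apply: (@dfs_sound _ _ _ _ _ _ _ (lsel p) (fun st => forall m, m \in st -> hasp I p m)).
- by move=> k k' t t'; apply: lsel_disj H.
- move=> st k t Hst [_ [q _ [-> hq]]] m; rewrite inE => /orP[/eqP -> // |]; exact: Hst.
- by [].
- exact: Hkill.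
- move=> m; rewrite !inE => /or3P[] /eqP ->; [exact: ns_A H|exact: ns_B H|exact: ns_C H].
- by rewrite /= -map_comp (eq_map (g := id)) ?map_id.
move=> l0; rewrite !inE => /or3P[/eqP -> | /eqP -> | /mapP[l ll ->]] /=.
- exists (coset r.1 0, plane r.1 0); first exact: mem_head.
  by split=> //; exists 0%num; rewrite ?R6_0.
- exists (coset r.2 q2, plane r.2 q2); first by apply/mapP; exists q2.
  split=> //; exists q2 => //; apply: (@qreps_R6 r.2); move: q2r; by rewrite /qreps2 mem_filter => /andP[].
have ls' := lsub l ll; have [q0 q0R hq] := lift_exists H ls'.
have lL : l \in Ls by move: ls'; rewrite mem_lsof => /andP[].
have /hasP[q qQ lq] := allP (allP qreps_ok l lL) q0 q0R.
exists (coset l q, plane l q); first by apply/mapP; exists q.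
split=> //; exists q; first exact: qreps_R6 qQ.
by split=> //; apply: hasp_coset hq _; rewrite // N.lxor_comm.
Qed.

Lemma lsof_ext p p' : (forall i x, x \in R6 -> p' i x = p i x) -> lsof I p' = lsof I p.
Proof.
move=> E; apply: eq_filter => l; apply: eq_existsb => i; congr (_ && _).
by apply: eq_in_all => x xR; rewrite E.
Qed.

Lemma normalise p d r : rep_ok r -> NS I J p d -> r.1 \in lsof I p -> r.2 \in lsof I p ->
  exists p' d', [/\ NS I J p' d', r.1 \in lsof I p', r.2 \in lsof I p', hasp I p' (plane r.1 0) &
    exists2 q, q \in qreps2 r.1 r.2 & hasp I p' (plane r.2 q)].
Proof.
rewrite /rep_ok => /and4P[L1 L2 _ Hr] H r1 r2.
have [q1 q1R h1] := lift_exists H r1; have [q2 q2R h2] := lift_exists H r2.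
have /hasP[t tl /hasP[q qr lq]] := allP Hr _ (R6_lxor q2R q1R).
have lt : inl r.1 t by move: tl; rewrite inE mem_pts.
have tR : t \in R6.
  by move: lt => /orP[/eqP -> | /(Ls_P42 L1) /P42_R6 //]; apply: R6_0.
(* The shear by s turns the first lift into t, equivalent to 0 since t lies on the first line, and
   the second into q2 + q1 + t, equivalent to the representative q. *)
set s := q1 ^^ t; have sR : s \in R6 by apply: R6_lxor.
have := allP eframe_ok s sR => /and4P[ds fs /allP f6 /eqP f64].
have H' := frame_NS ds fs H.
set p' := (fun i => p i \o linN (eb s)) in H'.
have p6 i x : x \in R6 -> p' i x = p i x by move=> xR; change (p i (linN (eb s) x) = p i x); rewrite (eqP (f6 x xR)).
have ph i x : x \in R6 -> p' i (64 ^^ x)%num = p i (64 ^^ (s ^^ x))%num.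
  move=> xR; change (p i (linN (eb s) (64 ^^ x)%num) = p i (64 ^^ (s ^^ x))%num).
  by rewrite linN_lxor f64 (eqP (f6 x xR)) N.lxor_assoc.
clearbody p'; clear ds fs f6 f64 Hr tl.
move: (qreps2 r.1 r.2) qr => Q qr.
have hp l u : l \in Ls -> hasp I p (plane l u) -> hasp I p' (plane l (s ^^ u)).
  move=> lL /haspP[i iI E]; apply/haspP; exists i => // x xR.
  have [x6|[y y6 ->]] := R7_case xR; first by rewrite p6 // E // !bit_plane_lo.
  rewrite ph // E ?R6_64 ?R6_lxor // !bit_plane_hi ?R6_lxor //.
  by rewrite (N.lxor_comm s y) N.lxor_assoc.
have hl l : l \in lsof I p -> l \in lsof I p' by rewrite (lsof_ext p6).
exists p', (fun j => d j \o linN (ed s)); split; [exact: H' | exact: hl | exact: hl | |].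
  apply: (hasp_coset L1 (hp _ _ L1 h1)).
  by rewrite /s N.lxor_0_r (N.lxor_comm q1 t) lxorK.
exists q; first exact: qr.
apply: (hasp_coset L2 (hp _ _ L2 h2)).
rewrite N.lxor_comm; have -> // : s ^^ q2 = q2 ^^ q1 ^^ t.
by rewrite /s N.lxor_comm N.lxor_assoc.
Qed.

Lemma mem_remove o ents (l0 : N * seq entry) : l0 \in remove o ents -> exists2 l, l \in ents &
  l0.1 = l.1 /\ forall e, e \in l.2 -> (forall x, x \in o -> ~~ samepair x e) -> e \in l0.2.
Proof.
move=> /mapP[l lE ->]; exists l => //; split=> // e el He.
rewrite mem_filter el andbT vhasE; apply/hasPn => x /mapP[y].
by rewrite mem_filter => /andP[_ /mapP[z zo ->]] ->; apply: He.
Qed.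

(** Quantified over all systems, because a group element carries a system with a pair in the orbit
    to another system, with the representative. *)
Definition allsel (ents : seq (N * seq entry)) := forall p d, NS I J p d -> forall l : N * seq entry, l \in ents -> exists2 e, e \in l.2 & sel I p l.1 e.

Lemma stages_sound rs ents :
  (forall p d, NS I J p d -> forall cfg, (forall m, m \in cfg -> hasp I p m) -> ~~ kill cfg) ->
  all rep_ok rs -> uniq (map fst ents) -> ents != [::] -> allsel ents ->
  stages leaf ptmask rs ents -> forall p d, ~ NS I J p d.
Proof.
move=> Hkill; elim: rs ents => [|r rs IH] ents.
  rewrite [stages _ _ _ _]/= vallE => _ _; case: ents => // l ents _ Hs /andP[nl _] p d H.
  by have [e] := Hs p d H l (mem_head _ _); move: nl; case: (l.2).
move=> /= /andP[rok rsok] uents ne Hs; case: ifP => // Hst.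
have Hno p d : NS I J p d -> r.1 \in lsof I p -> r.2 \in lsof I p -> False.
  move=> H r1 r2; have [p' [d' [H' r1' r2' h1 h2]]] := normalise rok H r1 r2.
  have := rok; rewrite /rep_ok => /and4P[_ _ /N.eqb_spec d12 _].
  have /negP[] := stage_sound H' r1' r2' d12 (fun ls => lifts_sound H' r1' r2' h1 h2 (Hkill _ _ H')) uents (Hs _ _ H').
  exact: Hst.
apply: IH => //.
- by rewrite /remove -map_comp.
- by rewrite /remove; case: (ents) ne.
move=> p d H l0 /mem_remove[l lE [l01 l02]]; have [e el se] := Hs p d H l lE.
exists e; last by rewrite l01.
apply: l02 el _ => z; rewrite /orbit => /mapP[g gG ->]; apply/negP => sp.
have /andP[dg fg] := allP group_ok g gG; have := fg; rewrite /frame_ok => /and3P[_ _ /allP f6].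
have [e1s e2s _ _ _] := se.
have [i1 i2] : imgm g.1 r.1 \in lsof I p /\ imgm g.1 r.2 \in lsof I p.
  by move: sp; rewrite /samepair /= !Neqb => /orP[] /andP[/eqP -> /eqP ->].
have := rok; rewrite /rep_ok => /and4P[L1 L2 _ _].
have hl l' : l' \in Ls -> imgm g.1 l' \in lsof I p -> l' \in lsof I (fun i => p i \o linN g.1).
  move=> lL H0; have [il _] : lineb I p (imgm g.1 l') /\ imgm g.1 l' \in Ls.
    by apply/andP; rewrite -mem_lsof.
  by rewrite mem_lsof lL andbT; apply: (frame_lineb dg).
by apply: (Hno _ _ (frame_NS dg fg H)); apply: hl.
Qed.
End Lifts.

(** * Refuting a complete configuration *)

Lemma R7_cons : R7 = 0%num :: behead R7. Proof. by vm_compute. Qed.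

Lemma R7_0 : 0%num \in R7. Proof. by vm_compute. Qed.

Lemma R7_min (q : N -> bool) : has q R7 ->
  exists x, [/\ x \in R7, q x & forall y, y \in R7 -> q y -> N.leb x y].
Proof.
move=> /hasP[x0 x0R qx0].
have ex : exists n, (N.of_nat n \in R7) && q (N.of_nat n) by exists (N.to_nat x0); rewrite Nnat.N2Nat.id x0R.
case: (ex_minnP ex) => n /andP[nR qn] Hn; exists (N.of_nat n); split=> // y yR qy.
apply/N.leb_spec0; have := Hn (N.to_nat y); rewrite Nnat.N2Nat.id yR qy => /(_ isT); lia.
Qed.

Definition orthm m k := vall (fun x => ~~ pdot x k) (pts m).

Lemma extra_point (q : N -> bool) s : count q R7 = 8 -> size s < 8 ->
  exists z, [/\ z \in R7, q z & z \notin s].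
Proof.
move=> c8 s8; case: (boolP (has (fun z => q z && (z \notin s)) R7)) => [/hasP[z zR /andP[qz zs]]|/hasPn Hs].
  by exists z.
suff : count q R7 <= size s by rewrite c8 leqNgt s8.
rewrite -size_filter; apply: uniq_leq_size; first by rewrite filter_uniq ?rng_uniq.
by move=> x; rewrite mem_filter => /andP[qx xR]; have := Hs x xR; rewrite qx negbK.
Qed.

Lemma has_filt (T : Type) (a p : T -> bool) s : has p (filter a s) = has (fun x => a x && p x) s.
Proof. by elim: s => //= x s <-; case: (a x). Qed.

Section Kill.
Variables (X : finType) (I J : {set X}) (p d : X -> N -> bool).
Hypothesis S : sys I J p d.

Section Config.
Variable cfg : seq N.
Hypothesis cfgR : forall m, m \in cfg -> forall x, bit m x -> x \in R7.
Hypothesis cfgp : forall m, m \in cfg -> hasp I p m.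

Lemma orthmE m i k : m \in cfg -> {in R7, p i =1 bit m} -> orth (p i) k = orthm m k.
Proof.
move=> mc E; rewrite /orthm vallE; apply/allP/allP => H x.
  rewrite mem_pts => bx; have xR := cfgR mc bx.
  by have := H x xR; rewrite E // bx.
by move=> xR; rewrite E //; apply/implyP => bx; apply: H; rewrite mem_pts.
Qed.

Definition bt := badtab [seq pperp m | m <- cfg].

Lemma look_pperp m k : k \in R7 -> look (pperp m) k = orthm m k.
Proof. by move=> kR; rewrite /pperp look7. Qed.

Lemma look_bt a b : a \in R7 -> b \in R7 ->
  look (look bt a) b = has (fun m => orthm m a && orthm m b) cfg.
Proof.
move=> aR bR; rewrite /bt /badtab look7 // look7 // vhasE has_filt has_map.
apply: eq_has => m; change (look (pperp m) a && look (pperp m) b = orthm m a && orthm m b).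
by rewrite !look_pperp.
Qed.

Lemma nobad j a b : j \in J -> a \in R7 -> b \in R7 -> d j a -> d j b ->
  a != 0%num -> b != 0%num -> a != b -> look (look bt a) b = false.
Proof.
move=> jJ aR bR da db a0 b0 ab; rewrite look_bt //; apply/negbTE/hasPn => m mc.
have /haspP[i iI E] := cfgp mc; rewrite -!(orthmE _ mc E); apply/negP => /andP[oa ob].
have := sys_pd S iI jJ; rewrite leqNgt => /negP; apply.
have [[d0 _] _] := sys_d S jJ.
apply: (@count_ge _ [:: 0%num; a; b]); first by rewrite /= !inE negb_or ![0%num == _]eq_sym a0 b0 ab.
apply/allP => x xs; rewrite !inE in xs; case/or3P: xs => /eqP ->; apply/andP; split=> //; apply/andP; split=> //.
exact: orth0.
Qed.

Lemma alive_bound k : k \in R7 -> k != 0%num -> 6 * nJ J d k <= alive bt k.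
Proof.
move=> kR k0; pose D j y := [&& d j y, y != 0%num & y != k].
have D6 j : j \in J -> d j k -> count (D j) R7 = 6.
  move=> jJ djk; have [[d0 _] c8] := sys_d S jJ; move: c8; rewrite -!size_filter => c8.
  have pe : perm_eq (0%num :: k :: [seq y <- R7 | D j y]) [seq y <- R7 | d j y].
    apply: uniq_perm; [ | by rewrite filter_uniq ?rng_uniq | ].
      rewrite !cons_uniq in_cons !mem_filter {1 2}/D (eqxx 0%num) (eqxx k) !andbF orbF eq_sym k0.
      by rewrite filter_uniq ?rng_uniq.
    move=> y; rewrite !in_cons !mem_filter.
    case: (eqVneq y 0%num) => [->|y0]; first by rewrite d0 R7_0.
    case: (eqVneq y k) => [->|yk]; first by rewrite djk kR.
    by rewrite !orFb /D y0 yk !andbT.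
  by have := perm_size pe; rewrite c8 /= => -[].
pose K := [set j in J | d j k].
have -> : 6 * nJ J d k = \sum_(j in K) count (D j) R7.
  rewrite /nJ mulnC -sum_nat_const; apply: eq_bigr => j; rewrite inE => /andP[jJ dj].
  by rewrite D6.
have -> : \sum_(j in K) count (D j) R7 = \sum_(y <- R7) \sum_(j in K) D j y.
  rewrite exchange_big; apply: eq_bigr => j _; rewrite -sum1_count big_mkcond; apply: eq_bigr => y _.
  by case: (D j y).
rewrite /alive count_filter -sum1_count [X in _ <= X]big_mkcond big_seq [X in _ <= X]big_seq.
apply: leq_sum => y yR.
case: (boolP [exists j in K, D j y]) => [/exists_inP[j jK Dj]|]; last first.
  by move/exists_inPn => H; rewrite big1 // => j jK; rewrite (negbTE (H j jK)).
have [jJ djk] : j \in J /\ d j k by move: jK; rewrite inE => /andP[].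
have /and3P[dy y0 yk] := Dj; have [cl c8] := sys_d S jJ; case: (cl) => d0 dD.
have S1 : \sum_(j in K) D j y <= 1.
  rewrite (bigD1 j) //= Dj big1 ?addn0 // => j' /andP[]; rewrite inE => /andP[jJ' djk'] jj'.
  case E : (D j' y) => //; have /and3P[dy' _ _] := E.
  have := sys_dd S jJ' jJ jj'; rewrite leqNgt => /negP[].
  have [[d0' _] _] := sys_d S jJ'.
  apply: (@count_ge _ [:: 0%num; k; y]); first by rewrite /= !inE negb_or ![0%num == _]eq_sym k0 y0 eq_sym yk.
  by apply/allP => x xs; rewrite !inE in xs; case/or3P: xs => /eqP ->; rewrite ?R7_0 ?kR ?yR /= ?d0 ?d0' ?djk ?djk' ?dy ?dy'.
apply: leq_trans S1 _.
(* Four of the eight functionals lie in the span of k and y, so the plane has a further z. *)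
have s8 : size [:: 0%num; k; y; y ^^ k] < 8 by [].
have E := extra_point c8 s8.
case: E => z [zR dz zs].
rewrite !in_cons in_nil orbF !negb_or in zs.
case/and4P: zs => z0 zk zy zyk.
have nb a b (aR : a \in R7) (bR : b \in R7) := nobad jJ aR bR.
have ykR := R7_lxor yR kR; have zkR := R7_lxor zR kR; have yzR := R7_lxor yR zR.
have dyk : d j (y ^^ k) by apply: dD.
have dzk : d j (z ^^ k) by apply: dD.
have dyz : d j (y ^^ z) by apply: dD.
have ne a b : a != b -> a ^^ b != 0%num by move=> ab; apply: contra ab => /eqP /lxor_eq0 ->.
have yk0 : y ^^ k != 0%num by apply: ne.
have zk0 : z ^^ k != 0%num by apply: ne.
have yz0 : y ^^ z != 0%num by apply: ne; rewrite eq_sym.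
have n1 : y != z by rewrite eq_sym.
have n2 : k != y ^^ z.
  by apply: contra zyk => /eqP ->; rewrite -N.lxor_assoc N.lxor_nilpotent N.lxor_0_l.
have n3 : y != z ^^ k by apply: contra zyk => /eqP ->; rewrite lxorK.
have n4 : y ^^ k != z by rewrite eq_sym.
have n5 : y ^^ k != z ^^ k by apply: contra n1 => /eqP /(congr1 (N.lxor^~ k)); rewrite !lxorK => ->.
have Yz : forall x, x \in R7 -> d j x -> x != 0%num -> x != k ->
    x \in [seq y <- R7 | if look (look bt k) y then false else if N.eqb y 0 then false else ~~ N.eqb y k].
  by move=> x xR dx x0 xk; rewrite mem_filter xR andbT nb // 1?eq_sym // !Neqb (negbTE x0) xk.
case: ifP => [_|/negP[]]; first exact: leqnn.
apply/andP; split; last first.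
  by have := Yz y yR dy y0 yk; rewrite mem_filter => /andP[].
rewrite vhasE; apply/hasP; exists z; first exact: Yz.
by rewrite !nb // !Neqb (negbTE n1) zyk.
Qed.


(** Seventeen distinct planes out of a system of 17 are all of them. *)
Lemma nI_cfg k : uniq cfg -> size cfg = 17 -> nI I p k = count (orthm^~ k) cfg.
Proof.
move=> ucfg s17; pose mi i := mk [seq x <- R7 | p i x].
have miE i x : bit (mi i) x = (x \in R7) && p i x by rewrite bit_mk mem_filter andbC.
have sub : {subset cfg <= map mi (enum I)}.
  move=> m mc; have /haspP[i iI E] := cfgp mc; apply/mapP; exists i; first by rewrite mem_enum.
  apply: N.bits_inj => x; rewrite -![N.testbit _ _]/(bit _ _) miE.
  by case: (boolP (x \in R7)) => [/E -> //|xR]; apply/negbTE; apply: contra xR => /(cfgR mc).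
have s2 : size (map mi (enum I)) = 17 by rewrite size_map -cardE (sys_cI S).
have le17 : size (map mi (enum I)) <= size cfg by rewrite s2 s17.
have [_ E] := uniq_min_size ucfg sub le17.
have pe : perm_eq cfg (map mi (enum I)).
  by apply: uniq_perm => //; rewrite -(eq_uniq _ E) // s2 s17.
rewrite (permP pe) count_map -size_filter /nI cardsE cardE /enum_mem -filter_predI.
congr size; apply: eq_filter => i /=; rewrite andbC; congr (_ && _); rewrite /orth /orthm vallE; apply/allP/allP => H x.
  by rewrite mem_pts miE => /andP[xR px]; have := H x xR; rewrite px.
by move=> xR; apply/implyP => px; apply: H; rewrite mem_pts miE xR.
Qed.

Lemma wt_anti a b : a <= b -> wt (14 - b) <= wt (14 - a).
Proof.
move=> ab; have : 14 - b <= 14 - a by rewrite leq_sub2l.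
move: (14 - b) (14 - a) => x y; rewrite /wt.
by case: (leqP x 1) => h1; case: (leqP y 1) => h2; case: (leqP x 3) => h3; case: (leqP y 3) => h4; lia.
Qed.

Lemma alivetest_sound : uniq cfg -> size cfg = 17 -> alivetest cfg -> sgood I J p d.
Proof.
move=> ucfg s17; rewrite /alivetest -/bt /sgood => H; apply: leq_trans H _.
rewrite sumnE big_map big_filter big_mkcond [X in _ <= X]big_mkcond big_seq [X in _ <= X]big_seq.
apply: leq_sum => k kR.
have -> : count (fun p0 => look p0 k) [seq pperp m | m <- cfg] = nI I p k.
  rewrite (nI_cfg k ucfg s17) count_map; apply: eq_count => m.
  by change (look (pperp m) k = orthm m k); rewrite look_pperp.
case: (boolP (nI I p k == 3)) => n3; last exact: leqnn.
apply: wt_anti; rewrite leq_divRL // mulnC; apply: alive_bound => //.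
apply: contraTneq n3 => ->; rewrite (nI_cfg 0 ucfg s17) (eq_count (a2 := predT)) ?count_predT ?s17 //.
by move=> m; rewrite /orthm vallE; apply/allP => x _; rewrite pdotC /pdot N.land_0_l.
Qed.
End Config.

Lemma planes_of_complete q b : closed q -> count q R7 = 8 ->
  (forall x y, x \in R7 -> y \in R7 -> q x -> q y -> x != 0%num -> y != 0%num -> x != y -> look (look b x) y = false) ->
  exists2 D, D \in planes_of b & all q D.
Proof.
move=> cl c8 nb; case: (cl) => q0 qD.
pose lt x y := N.ltb x y.
(* Greedy choice: applied to {0}, {0, a} and the span of a and b, it yields the least basis under
   which [planes_of] lists the plane. *)
have minP s : size s < 8 -> exists x, [/\ x \in R7, q x, x \notin s & forall y, y \in R7 -> q y -> y \notin s -> y != x -> N.ltb x y].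
  move=> s8; have [z [zR qz zs]] := extra_point c8 s8.
  have [|x [xR /andP[qx xs] Hx]] := @R7_min (fun x => q x && (x \notin s)).
    by apply/hasP; exists z; rewrite ?qz.
  exists x; split=> // y yR qy ys /eqP yx; apply/N.ltb_spec0.
  have /N.leb_spec0 H0 := Hx y yR (introT andP (conj qy ys)); clear -H0 yx; lia.
have [a [aR qa a0 Ha]] := minP [:: 0%num] isT; rewrite inE in a0.
have [b' [bR qb b0 Hb]] := minP [:: 0%num; a] isT; rewrite !inE negb_or in b0; case/andP: b0 => b0 ba.
have [c [cR qc c0 Hc]] := minP [:: 0%num; a; b'; a ^^ b'] isT.
rewrite !inE !negb_or in c0; case/and4P: c0 => c0 ca cb cab.
have nz x y : x != y -> x ^^ y != 0%num by move=> xy; apply: contra xy => /eqP /lxor_eq0 ->.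
have n1 : a ^^ b' != a.
  by apply: contra b0 => /eqP /(congr1 (N.lxor a)); rewrite -N.lxor_assoc N.lxor_nilpotent N.lxor_0_l => ->.
have n2 : a ^^ b' != b'.
  by apply: contra a0 => /eqP /(congr1 (N.lxor^~ b')); rewrite lxorK N.lxor_nilpotent => ->.
have abR := R7_lxor aR bR; have qab : q (a ^^ b') by apply: qD.
have cx s : s \in R7 -> q s -> s \in [:: 0%num; a; b'; a ^^ b'] -> s != 0%num -> N.ltb c (s ^^ c).
  move=> sR qs ss s0; apply: Hc; first exact: R7_lxor.
  - by apply: qD.
  - have sc t : t \in [:: 0%num; a; b'; a ^^ b'] -> s ^^ c != t.
      move=> ts; apply/eqP => E; have cE : c = s ^^ t by rewrite -E -N.lxor_assoc N.lxor_nilpotent N.lxor_0_l.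
      have a1 : a ^^ (a ^^ b') = b' by rewrite -N.lxor_assoc N.lxor_nilpotent N.lxor_0_l.
      have a2 : b' ^^ (a ^^ b') = a by rewrite N.lxor_comm lxorK.
      have a3 : a ^^ b' ^^ a = b' by rewrite (N.lxor_comm a) lxorK.
      rewrite !inE in ss ts; move: cE c0 ca cb cab.
      by case/or4P: ss => /eqP ->; case/or4P: ts => /eqP ->;
        rewrite ?N.lxor_0_l ?N.lxor_0_r ?N.lxor_nilpotent ?a1 ?a2 ?a3 ?lxorK ?(N.lxor_comm b' a) => ->; rewrite eqxx.
    by rewrite !inE !negb_or !sc // !inE eqxx ?orbT.
  by apply: contra s0 => /eqP /(congr1 (N.lxor^~ c)); rewrite lxorK N.lxor_nilpotent => ->.
have ab0 : a ^^ b' != 0%num by apply: nz; rewrite eq_sym.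
have s1 : b' \notin [:: 0%num] by rewrite mem_seq1.
have lab : N.ltb a b' := Ha b' bR qb s1 ba.
have s2 : a ^^ b' \notin [:: 0%num; a] by rewrite in_cons mem_seq1 negb_or ab0 n1.
have lbab : N.ltb b' (a ^^ b') := Hb _ abR qab s2 n2.
have s3 : c \notin [:: 0%num; a] by rewrite in_cons mem_seq1 negb_or c0 ca.
have lbc : N.ltb b' c := Hb c cR qc s3 cb.
have i1 : a \in [:: 0%num; a; b'; a ^^ b'] by rewrite !in_cons eqxx orbT.
have i2 : b' \in [:: 0%num; a; b'; a ^^ b'] by rewrite !in_cons eqxx !orbT.
have i3 : a ^^ b' \in [:: 0%num; a; b'; a ^^ b'] by rewrite !in_cons eqxx !orbT.
have lac : N.ltb c (a ^^ c) := cx a aR qa i1 a0.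
have lbc' : N.ltb c (b' ^^ c) := cx b' bR qb i2 b0.
have labc : N.ltb c (a ^^ b' ^^ c) := cx _ abR qab i3 ab0.
have bcR := R7_lxor bR cR; have acR := R7_lxor aR cR.
have qbc : q (b' ^^ c) by apply: qD.
have qac : q (a ^^ c) by apply: qD.
have bc0 : b' ^^ c != 0%num by apply: nz; rewrite eq_sym.
have ac0 : a ^^ c != 0%num by apply: nz; rewrite eq_sym.
have e1 : a != b' ^^ c.
  by apply: contra cab => /eqP ->; rewrite (N.lxor_comm b') N.lxor_assoc N.lxor_nilpotent N.lxor_0_r.
have e2 : b' != a ^^ c.
  by apply: contra cab => /eqP ->; rewrite -N.lxor_assoc N.lxor_nilpotent N.lxor_0_l.
have e3 : a ^^ b' != a ^^ c.
  by apply: contra cb => /eqP /(congr1 (N.lxor a)); rewrite -!N.lxor_assoc N.lxor_nilpotent !N.lxor_0_l => ->.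
exists (span3 a b' c); last first.
  have qabc : q (a ^^ b' ^^ c) := qD _ _ abR cR qab qc.
  by rewrite /span3 /all qa qb qab qc qac qbc qabc.
have aB : a \in behead R7.
  by move: aR; rewrite {1}R7_cons in_cons (negbTE a0).
rewrite /planes_of; apply/flattenP; eexists; first by apply/mapP; exists a; [exact: aB | reflexivity].
apply/flattenP; eexists.
  apply/mapP; exists b'; [|reflexivity].
  by rewrite mem_filter lab lbab bR nb // eq_sym.
apply/mapP; exists c; [|reflexivity].
rewrite mem_filter lbc lac lbc' labc cR.
by rewrite nb // 1?eq_sym // nb // 1?eq_sym // nb // nb // nb // 1?eq_sym // nb.
Qed.
End Kill.

(** * The exceptional configuration admits at most 252 functional planes *)

Definition btc := badtab [seq pperp m | m <- CF].
Lemma AVcE : AVc = planes_of btc. Proof. by rewrite /AVc. Qed.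
Lemma AVc_ok : all (fun D => [&& uniq D, size D == 7 & all (fun x => N.ltb x 128 && (x != 0%num)) D]) AVc.
Proof. by vm_compute. Qed.
Lemma AVc_inj : uniq (map mk AVc). Proof. by vm_compute. Qed.
Lemma isos_ok : all (fun g => dualb g.1 g.2) isos. Proof. by vm_compute. Qed.
Lemma AVc_check : check7 AVc. Proof. by vm_compute. Qed.
Lemma CF_R7 : all (fun m => all (fun x => N.ltb x 128) (pts m)) CF. Proof. by vm_compute. Qed.
Opaque AVc CF.

Lemma count_nz q : closed q -> count q R7 = (count (fun y => q y && (y != 0%num)) R7).+1.
Proof.
move=> [q0 _]; rewrite R7_cons; set t := behead R7.
have t0 : all (fun y => y != 0%num) t by vm_compute.
rewrite /count -/(count _ t) -/(count (fun y => q y && (y != 0%num)) t) q0 eqxx add1n add0n; congr _.+1.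
by apply: eq_in_count => y yt; rewrite (allP t0 y yt) andbT.
Qed.

Lemma conf_common D D' : uniq D' -> conf D D' ->
  exists x y, [/\ x != y, x \in D, y \in D, x \in D' & y \in D'].
Proof.
move=> uD; rewrite /conf -size_filter; set s := filter _ _; have us : uniq s by rewrite filter_uniq.
have Hs x : x \in s -> x \in D /\ x \in D' by rewrite mem_filter mem7E => /andP.
case: s us Hs => [|x [|y s]] // us Hs _; exists x, y.
have [xD xD'] := Hs x (mem_head _ _).
have [yD yD'] : y \in D /\ y \in D' by apply: Hs; rewrite !inE eqxx orbT.
by split=> //; move: us; rewrite /= inE negb_or => /andP[/andP[]].
Qed.

Section Count.
Variables (X : finType) (I J : {set X}) (p d : X -> N -> bool) (AV : seq (seq N)).
Hypothesis S : sys I J p d.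
Hypothesis AVD : {in AV, forall D, uniq D}.
Hypothesis AVR : forall D x, D \in AV -> x \in D -> x \in R7 /\ x != 0%num.
Hypothesis AVi : {in AV &, forall D D', D =i D' -> D = D'}.
Hypothesis Hpl : forall j, j \in J ->
  exists2 D, D \in AV & {in R7, forall x, d j x = (x == 0%num) || (x \in D)}.
Hypothesis bnd : forall sel : seq N -> bool,
  {in AV &, forall D D', sel D -> sel D' -> D != D' -> ~~ conf D D'} -> count sel AV <= 252.

Let psel j (D : seq N) := all (fun x => d j x == (x == 0%num) || (x \in D)) R7.

Lemma pselP j D : psel j D -> {in R7, forall x, d j x = (x == 0%num) || (x \in D)}.
Proof. by move=> /allP H x xR; apply/eqP; apply: H. Qed.

(** Distinct indices select distinct lists, as equal planes would share eight functionals, and by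
    [sys_dd] the selected lists are free of conflicts. *)
Lemma count_planes : #|J| <= 252.
Proof.
pose sel (D : seq N) := [exists j in J, psel j D].
apply: (@leq_trans (count sel AV)); last first.
  apply: bnd => D D' DA DA' /exists_inP[j jJ /pselP E] /exists_inP[j' jJ' /pselP E'] DD'.
  apply/negP => /(conf_common (AVD DA'))[x [y [xy xD yD xD' yD']]].
  have [xR x0] := AVR DA xD; have [yR y0] := AVR DA yD.
  case: (eqVneq j j') => [jj|jj].
    case/eqP: DD'; apply: AVi => // z; apply/idP/idP => zD.
      by have [zR z0] := AVR DA zD; have := E' z zR; rewrite -jj E // zD orbT (negbTE z0).
    by have [zR z0] := AVR DA' zD; have := E z zR; rewrite jj E' // zD orbT (negbTE z0).
  have := sys_dd S jJ jJ' jj; rewrite leqNgt => /negP[].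
  apply: (@count_ge _ [:: 0%num; x; y]); first by rewrite /= !inE negb_or ![0%num == _]eq_sym x0 y0 xy.
  apply/allP => z zs; rewrite !inE in zs; have zR : z \in R7 by case/or3P: zs => /eqP -> //; apply: R7_0.
  rewrite zR /= E // E' //; by case/or3P: zs => /eqP ->; rewrite ?eqxx ?xD ?xD' ?yD ?yD' ?orbT.
pose Dj j := nth [::] AV (find (psel j) AV).
have DjP j : j \in J -> Dj j \in AV /\ psel j (Dj j).
  move=> jJ; have [D DA E] := Hpl jJ.
  have hD : has (psel j) AV by apply/hasP; exists D => //; apply/allP => x xR; rewrite E.
  by split; [apply: mem_nth; rewrite -has_find | apply: nth_find].
have injD : {in enum J &, injective Dj}.
  move=> i j; rewrite !mem_enum => iJ jJ E; apply/eqP/negPn/negP => ij.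
  have [_ /pselP Ei] := DjP i iJ; have [_ /pselP Ej] := DjP j jJ.
  have := sys_dd S iJ jJ ij; rewrite leqNgt => /negP[].
  have [_ c8] := sys_d S iJ.
  have -> : count (predI (d i) (d j)) R7 = 8; last by [].
  by rewrite -c8; apply: eq_in_count => x xR /=; rewrite Ei // Ej // E andbb.
rewrite cardE -(size_map Dj) -size_filter; apply: uniq_leq_size; first by rewrite map_inj_in_uniq ?enum_uniq.
move=> D0 /mapP[j]; rewrite mem_enum => jJ ->; have [DA E] := DjP j jJ.
by rewrite mem_filter DA andbT; apply/exists_inP; exists j.
Qed.
End Count.

Lemma AVc_uniq : {in AVc, forall D, uniq D}.
Proof. by move=> D DA; case/and3P: (allP AVc_ok D DA). Qed.
Lemma AVc_size D : D \in AVc -> size D = 7.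
Proof. by move=> DA; case/and3P: (allP AVc_ok D DA) => _ /eqP. Qed.
Lemma AVc_R7 D x : D \in AVc -> x \in D -> x \in R7 /\ x != 0%num.
Proof.
move=> DA xD; case/and3P: (allP AVc_ok D DA) => _ _ H; rewrite mem_R7.
by apply/andP; apply: (allP H x xD).
Qed.
Lemma AVc_ext : {in AVc &, forall D D', D =i D' -> D = D'}.
Proof.
have inj (T U : eqType) (f : T -> U) s x y : uniq (map f s) -> x \in s -> y \in s -> f x = f y -> x = y.
  elim: s => //= z s IH /andP[zs us]; rewrite !inE => /orP[/eqP -> | xs] /orP[/eqP -> // | ys].
  - by move=> E; rewrite E map_f in zs.
  - by move=> E; rewrite -E map_f in zs.
  - exact: IH.
move=> D D' DA DA' E; apply: inj AVc_inj DA DA' _.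
by apply: N.bits_inj => z; rewrite -![N.testbit _ _]/(bit _ _) !bit_mk E.
Qed.

Lemma CF_sub m : m \in CF -> forall x, bit m x -> x \in R7.
Proof. by move=> mC x; rewrite -mem_pts mem_R7; apply: (allP (allP CF_R7 m mC)). Qed.

Lemma plane_AVc (X : finType) (I J : {set X}) p d j : sys I J p d ->
  (forall m, m \in CF -> hasp I p m) -> j \in J ->
  exists2 D, D \in AVc & {in R7, forall x, d j x = (x == 0%num) || (x \in D)}.
Proof.
move=> S Hp jJ; have [cl c8] := sys_d S jJ.
have [|D DA Dq] := @planes_of_complete (d j) btc cl c8.
  by move=> x y xR yR dx dy x0 y0 xy; apply: (nobad S CF_sub Hp jJ).
rewrite -AVcE in DA; exists D; first exact: DA.
have uD := AVc_uniq DA; have sD := AVc_size DA; have D0 := fun x => @AVc_R7 D x DA; clear DA.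
move=> x xR; case: (eqVneq x 0%num) => [->|x0]; first by case: cl => ->.
have sub : {subset D <= [seq y <- R7 | d j y && (y != 0%num)]}.
  by move=> y yD; have [yR y0] := D0 y yD; rewrite mem_filter yR y0 !andbT; apply: (allP Dq).
have c7 : size [seq y <- R7 | d j y && (y != 0%num)] <= size D.
  by rewrite sD size_filter -ltnS -count_nz ?c8.
have [_ E] := uniq_min_size uD sub c7.
by rewrite E mem_filter x0 xR !andbT.
Qed.

Lemma type3_bound (X : finType) (I J : {set X}) p d : sys I J p d ->
  (forall m, m \in CF -> hasp I p m) -> #|J| <= 252.
Proof.
move=> S Hp; apply: (count_planes S AVc_uniq AVc_R7 AVc_ext (fun j => plane_AVc S Hp)) => sel Hsel.
exact: (selected_bound (map_uniq AVc_inj) AVc_uniq Hsel AVc_check).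
Qed.

(** In the second case the system is pulled back along the isomorphism to one containing all planes
    of [CF]; then the bound 252 contradicts the 256 functional planes. *)
Lemma kill_sound (X : finType) (I J : {set X}) p d : NS I J p d ->
  forall cfg, (forall m, m \in cfg -> hasp I p m) -> ~~ kill cfg.
Proof.
move=> H cfg Hc; rewrite /kill; case: ifP => // /and3P[/eqP s17 uc]; rewrite vallE => /allP cR.
have CR m : m \in cfg -> forall x, bit m x -> x \in R7.
  by move=> mC x; rewrite -mem_pts mem_R7 => xm; have := cR m mC; rewrite vallE => /allP; apply.
case: ifP => [alv|_]; first by have := ns_bad H; rewrite (alivetest_sound (ns_sys H) CR Hc uc s17 alv).
apply/negP; rewrite /isotest vhasE => /hasP[g gI]; rewrite vallE => /allP Hg.
have dg := allP isos_ok g gI; have [S' _] := frame_sys dg (ns_sys H).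
have := type3_bound S'; rewrite leqNgt.
have := sys_cJ (ns_sys H) => cJ Hf; have /negP[] : ~~ (252 < #|J|).
  apply: Hf => m mC; apply: (frame_hasp dg).
    exact: CF_sub mC.
  by have := Hg m mC; rewrite vhasE => /hasP[m' m'c /N.eqb_spec ->]; apply: Hc.
exact: leq_trans cJ.
Qed.

Lemma stages_ok : stages leaf ptmask reps entries. Proof. by vm_compute. Qed.
Lemma entries_keys : uniq (map fst entries) /\ entries != [::].
Proof. by rewrite entriesE -map_comp; split; vm_compute. Qed.

Lemma no_NS (X : finType) (I J : {set X}) p d : ~ NS I J p d.
Proof.
have [uk ne] := entries_keys.
apply: (stages_sound (@kill_sound X I J) reps_ok uk ne) stages_ok _ _.
by move=> p' d' H' l lE; apply: entries_sel H' l lE.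
Qed.

(** * From a functional with three planes to normal form *)

Lemma closed_linN q b t : closed q -> {subset b <= R7} -> all q b -> q (linN b t).
Proof.
move=> [q0 qD]; elim: b t => [|v b IH] t //= bR /andP[qv qb].
have bR' : {subset b <= R7} by move=> x xb; apply: bR; rewrite inE xb orbT.
have vR : v \in R7 by apply: bR; rewrite inE eqxx.
apply: qD; [|exact: linN_R7| |exact: IH]; case: (N.odd t) => //; exact: R7_0.
Qed.

Lemma linN_map (f : N -> N) b t : f 0%num = 0%num -> (forall x y, f (x ^^ y) = f x ^^ f y) ->
  f (linN b t) = linN (map f b) t.
Proof. by move=> f0 fD; elim: b t => //= v b IH t; rewrite fD IH; case: (N.odd t); rewrite ?f0. Qed.

Lemma linN_add b c t : size b = size c ->
  linN [seq v.1 ^^ v.2 | v <- zip b c] t = linN b t ^^ linN c t.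
Proof.
elim: b c t => [|v b IH] [|w c] t //= [s]; rewrite IH //.
set x := linN b _; set y := linN c _; case: (N.odd t) => //=.
by rewrite !N.lxor_assoc; congr (_ ^^ _); rewrite -!N.lxor_assoc (N.lxor_comm w).
Qed.

Section Dual.
Variable b : seq N.
Hypotheses (bR : {subset b <= R7}) (b7 : size b = 7) (binj : {in R7 &, injective (linN b)}).

Let col k := [seq pdot v k | v <- b].

Lemma col_inj : {in R7 &, injective col}.
Proof.
move=> k l kR lR E; apply: pdot_sep => // x xR.
have [y yR <-] := R7_surj (fun x _ => linN_R7 x bR) binj xR.
rewrite ![pdot _ (linN b y)]pdotC !pdot_linl -/(col k) -/(col l) E; by [].
Qed.

Lemma fold_bits_inj (s t : seq bool) : size s = size t -> fold_bits id s = fold_bits id t -> s = t.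
Proof.
move=> st E; apply: (eq_from_nth (x0 := false)) => // i i_s.
have := bit_fold id false i_s; rewrite E (bit_fold id false) -?st // => ->; by [].
Qed.

Lemma fold_bits_R7 (s : seq bool) : size s = 7 -> fold_bits id s \in R7.
Proof.
move=> s7; rewrite mem_R7; move: s s7.
by do 7 (case=> // -[] ); case.
Qed.

Lemma std_size : size stdb = 7. Proof. by vm_compute. Qed.

Lemma col_surj w : exists2 k, k \in R7 & col k = [seq pdot v w | v <- stdb].
Proof.
have sc k : size (col k) = 7 by rewrite size_map.
have fR : {in R7, forall k, fold_bits id (col k) \in R7} by move=> k _; apply: fold_bits_R7.
have fI : {in R7 &, injective (fun k => fold_bits id (col k))}.
  by move=> k l kR lR /fold_bits_inj E; apply: col_inj => //; apply: E; rewrite !sc.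
have [|k kR E] := R7_surj fR fI (y := fold_bits id [seq pdot v w | v <- stdb]).
  by apply: fold_bits_R7; rewrite size_map.
by exists k => //; apply: fold_bits_inj E; rewrite sc size_map.
Qed.

(** A functional is determined by its values on the basis [b]; counting 128 columns, every column of
    values occurs, in particular those of the dual basis. *)
Lemma dual_exists : exists d, dualb b d.
Proof.
pose kf w := nth 0%num R7 (find (fun k => col k == [seq pdot v w | v <- stdb]) R7).
have kfP w : kf w \in R7 /\ col (kf w) = [seq pdot v w | v <- stdb].
  have [k kR E] := col_surj w.
  have h : has (fun k => col k == [seq pdot v w | v <- stdb]) R7 by apply/hasP; exists k; rewrite ?E.
  split; first by apply: mem_nth; rewrite -has_find.
  by apply/eqP; apply: (nth_find 0%num h).
exists (map kf stdb); rewrite /dualb vallE; apply/andP; split.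
  apply/allP => x; rewrite -mem_R7 mem_cat => /orP[/bR //|/mapP[w _ ->]].
  by have [] := kfP w.
apply/eqP; apply: (eq_from_nth (x0 := [::])); first by rewrite !size_map b7.
move=> i; rewrite size_map => ib.
rewrite (nth_map 0%num) // [RHS](nth_map 0%num) ?std_size -?b7 // -map_comp.
apply: eq_map => w; have [_ E] := kfP w.
have E1 : nth false (col (kf w)) i = pdot (nth 0%num b i) (kf w) by rewrite (nth_map 0%num).
have E2 : nth false [seq pdot v w | v <- stdb] i = pdot (nth 0%num stdb i) w.
  by rewrite (nth_map 0%num) // std_size -b7.
by change (pdot (nth 0%num b i) (kf w) = pdot (nth 0%num stdb i) w); rewrite -E1 E E2.
Qed.
End Dual.

Lemma ker_count : all (fun k => (k == 0%num) || (count (fun x => ~~ pdot x k) R7 == 64)) R7.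
Proof. by vm_compute. Qed.

Definition gA := [:: 1; 2; 4]%num.
Definition gB := [:: 8; 16; 32]%num.
Definition gC := [:: 9; 18; 36]%num.
Lemma planes_gen : [/\ planeA = mk [seq linN gA t | t <- rng 8], planeB = mk [seq linN gB t | t <- rng 8] &
  planeC = mk [seq linN gC t | t <- rng 8]].
Proof. by split; vm_compute. Qed.
Lemma planes_count : all (fun m => count (bit m) R7 == 8) ABC. Proof. by vm_compute. Qed.
Lemma split_R6 : all (fun z => has (fun t => has (fun u => z == linN gA t ^^ linN gB u) (rng 8)) (rng 8)) R6.
Proof. by vm_compute. Qed.
Section Good.
Variables (X : finType) (I J : {set X}) (p d : X -> N -> bool).
Hypothesis S : sys I J p d.

Lemma nI0 : nI I p 0 = 17.
Proof.
rewrite -(sys_cI S) /nI; apply: eq_card => i; rewrite inE orth0 andbT; by [].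
Qed.

(** If each of the eight functionals had at most 12 functional planes, each would weigh at least 2
    and the sum would reach 16. *)
Lemma bad_functional : ~~ sgood I J p d -> exists k, [/\ k \in R7, k != 0%num, nI I p k = 3 & 13 <= nJ J d k].
Proof.
move=> bad; case: (boolP (has (fun k => (nI I p k == 3) && (13 <= nJ J d k)) R7)).
  move=> /hasP[k kR /andP[/eqP n3 nj]]; exists k; split=> //.
  by apply: contra_eq_neq n3 => ->; rewrite nI0.
move=> /hasPn H; case/negP: bad; rewrite /sgood.
apply: (@leq_trans (\sum_(k <- R7 | nI I p k == 3) 2)).
  by rewrite big_const_seq iter_addn_0 (sys_8 S).
rewrite big_seq_cond [X in _ <= X]big_seq_cond; apply: leq_sum => k /andP[kR n3].
have := H k kR; rewrite n3 /= -ltnNge => nj.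
have : 2 <= 14 - nJ J d k by rewrite leq_subRL; move: nj; case: (nJ J d k) => // n; lia.
rewrite /wt; case: leqP => // _ _; by case: ifP.
Qed.

Lemma three_planes k : nI I p k = 3 -> exists i1 i2 i3,
  [/\ i1 \in I, i2 \in I & i3 \in I] /\ [/\ i1 != i2, i1 != i3 & i2 != i3] /\
  [/\ orth (p i1) k, orth (p i2) k & orth (p i3) k].
Proof.
rewrite /nI cardE; set s := enum _ => s3; have us : uniq s by apply: enum_uniq.
have Hs i : i \in s -> i \in I /\ orth (p i) k by rewrite mem_enum => /setIdP.
case: s s3 us Hs => [|i1 [|i2 [|i3 []]]] // _ us Hs; exists i1, i2, i3.
have [I1 O1] := Hs i1 (mem_head _ _).
have [I2 O2] : i2 \in I /\ orth (p i2) k by apply: Hs; rewrite !inE eqxx orbT.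
have [I3 O3] : i3 \in I /\ orth (p i3) k by apply: Hs; rewrite !inE eqxx !orbT.
by move: us; rewrite /= !inE negb_or => /and3P[/andP[-> ->] -> _].
Qed.

Lemma plane_basis q : closed q -> count q R7 = 8 -> exists c1 c2 c3,
  [/\ [/\ c1 \in R7, c2 \in R7 & c3 \in R7], [/\ q c1, q c2 & q c3] &
   forall t, t \in rng 8 -> linN [:: c1; c2; c3] t = 0%num -> t = 0%num].
Proof.
move=> cl c8.
have [c1 [R1 q1 n1]] := extra_point (s := [:: 0%num]) c8 isT; rewrite !inE in n1.
have [c2 [R2 q2 n2]] := extra_point (s := [:: 0%num; c1]) c8 isT; rewrite !inE negb_or in n2; case/andP: n2 => n20 n21.
have [c3 [R3 q3 n3]] := extra_point (s := [:: 0%num; c1; c2; c1 ^^ c2]) c8 isT.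
rewrite !inE !negb_or in n3; case/and4P: n3 => n30 n31 n32 n33.
exists c1, c2, c3; split=> // t.
have -> : rng 8 = [:: 0; 1; 2; 3; 4; 5; 6; 7]%num by [].
rewrite !in_cons in_nil orbF.
move=> /orP[/eqP ->|/orP[/eqP ->|/orP[/eqP ->|/orP[/eqP ->|/orP[/eqP ->|/orP[/eqP ->|/orP[/eqP ->|/eqP ->]]]]]]].
all: rewrite /= ?N.lxor_0_r ?N.lxor_0_l //.
- by move/eqP; rewrite (negbTE n1).
- by move/eqP; rewrite (negbTE n20).
- by move=> /lxor_eq0 E; rewrite E eqxx in n21.
- by move/eqP; rewrite (negbTE n30).
- by move=> /lxor_eq0 E; rewrite E eqxx in n31.
- by move=> /lxor_eq0 E; rewrite E eqxx in n32.
by rewrite -N.lxor_assoc => /lxor_eq0 E; rewrite E eqxx in n33.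
Qed.

Section Frame.
Variables (k0 : N) (iA iB iC : X).
Hypotheses (k0R : k0 \in R7) (k00 : k0 != 0%num).
Hypotheses (AI : iA \in I) (BI : iB \in I) (CI : iC \in I).
Hypotheses (AB : iA != iB) (AC : iA != iC) (BC : iB != iC).
Hypotheses (oA : orth (p iA) k0) (oB : orth (p iB) k0) (oC : orth (p iC) k0).

Lemma orthP q x : orth q k0 -> x \in R7 -> q x -> pdot x k0 = false.
Proof. by move=> /allP H xR qx; have := H x xR; rewrite qx => /negbTE. Qed.

(** The two planes meet in 0, so their 64 sums are distinct and fill the kernel of [k0]. *)
Lemma decompose c : c \in R7 -> p iC c -> exists a b, [/\ a \in R7, b \in R7, p iA a, p iB b & c = a ^^ b].
Proof.
move=> cR pc; pose As := [seq x <- R7 | p iA x]; pose Bs := [seq x <- R7 | p iB x].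
have [[A0 AD] A8] := sys_p S AI; have [[B0 BD] B8] := sys_p S BI.
have Ain x : x \in As -> x \in R7 /\ p iA x by rewrite mem_filter => /andP[].
have Bin x : x \in Bs -> x \in R7 /\ p iB x by rewrite mem_filter => /andP[].
have us : uniq [seq x ^^ y | x <- As, y <- Bs].
  apply: allpairs_uniq; [by rewrite filter_uniq ?rng_uniq|by rewrite filter_uniq ?rng_uniq|].
  move=> [x y] [x' y'] /allpairsP[[u v] /= [uA vB [-> ->]]] /allpairsP[[u' v'] /= [uA' vB' [-> ->]]] E.
  have [uR pu] := Ain u uA; have [uR' pu'] := Ain u' uA'; have [vR pv] := Bin v vB; have [vR' pv'] := Bin v' vB'.
  have E2 : u ^^ u' = v ^^ v'.
    have := congr1 (fun z => u' ^^ z ^^ v) E; rewrite -!N.lxor_assoc N.lxor_nilpotent N.lxor_0_l lxorK => E3.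
    by rewrite (N.lxor_comm u) E3 N.lxor_comm.
  have z0 : u ^^ u' = 0%num.
    by apply: (sys_pp S AI BI AB); [exact: R7_lxor|exact: AD|rewrite E2; exact: BD].
  by rewrite (lxor_eq0 z0) (lxor_eq0 (etrans (esym E2) z0)).
have sub : {subset [seq x ^^ y | x <- As, y <- Bs] <= [seq x <- R7 | ~~ pdot x k0]}.
  move=> _ /allpairsP[[u v] /= [uA vB ->]]; have [uR pu] := Ain u uA; have [vR pv] := Bin v vB.
  by rewrite mem_filter R7_lxor // andbT pdotD (orthP oA uR pu) (orthP oB vR pv).
have sz : size [seq x <- R7 | ~~ pdot x k0] <= size [seq x ^^ y | x <- As, y <- Bs].
  rewrite size_allpairs !size_filter A8 B8.
  by have := allP ker_count k0 k0R; rewrite (negbTE k00) /= => /eqP ->.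
have [_ E] := uniq_min_size us sub sz.
have : c \in [seq x <- R7 | ~~ pdot x k0] by rewrite mem_filter cR (orthP oC cR pc).
rewrite -E => /allpairsP[[a b] /= [aA bB ->]]; exists a, b.
by have [aR pa] := Ain a aA; have [bR pb] := Bin b bB.
Qed.

Lemma plane_img (f : N -> N) i m g : {subset g <= R7} ->
  (forall x y, f (x ^^ y) = f x ^^ f y) -> {in R7, forall x, f x \in R7} -> {in R7 &, injective f} ->
  i \in I -> m = mk [seq linN g t | t <- rng 8] -> count (bit m) R7 = 8 -> all (fun v => p i (f v)) g ->
  {in R7, forall x, p i (f x) = bit m x}.
Proof.
move=> gR fD fR fI iI mE m8 pg.
have f0 : f 0%num = 0%num by rewrite -(N.lxor_nilpotent 0%num) fD N.lxor_nilpotent.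
have [cl c8] := sys_p S iI.
have sub : {subset [seq x <- R7 | bit m x] <= [seq x <- R7 | p i (f x)]}.
  move=> x; rewrite !mem_filter => /andP[mx xR]; rewrite xR andbT.
  move: mx; rewrite mE bit_mk => /mapP[t _ ->]; rewrite linN_map //.
  by apply: closed_linN => //; [move=> _ /mapP[v vg ->]; apply: fR; apply: gR | rewrite all_map].
have cE : count (fun x => p i (f x)) R7 = 8 by rewrite -c8; exact: (@count_pull f (p i) fR fI).
have [||_ E] := uniq_min_size _ sub; first by rewrite filter_uniq ?rng_uniq.
  by rewrite !size_filter cE m8.
by move=> x xR; have := E x; rewrite !mem_filter xR !andbT => ->.
Qed.

(** Splitting a basis of the third plane along the first two gives bases of these in which the third
    is diagonal; a vector e outside the kernel of [k0] plays the role of 64. *)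
Lemma sys_frame : ~~ sgood I J p d -> nI I p k0 = 3 -> 13 <= nJ J d k0 ->
  exists p' d', NS I J p' d'.
Proof.
move=> bad n3 nj.
have [clA cA] := sys_p S AI; have [clB cB] := sys_p S BI; have [clC cC] := sys_p S CI.
have [c1 [c2 [c3 [[R1 R2 R3] [q1 q2 q3] indC]]]] := plane_basis clC cC.
have [a1 [b1 [aR1 bR1 pa1 pb1 E1]]] := decompose R1 q1.
have [a2 [b2 [aR2 bR2 pa2 pb2 E2]]] := decompose R2 q2.
have [a3 [b3 [aR3 bR3 pa3 pb3 E3]]] := decompose R3 q3.
have [e eR ke] : exists2 e, e \in R7 & pdot e k0.
  have /orP[|/hasP[e eR ke]] := allP pdot_nondeg k0 k0R; first by rewrite (negbTE k00).
  by exists e; rewrite // pdotC.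
pose a := [:: a1; a2; a3]; pose b := [:: b1; b2; b3].
have aR : {subset a <= R7} by apply/allP; rewrite /= aR1 aR2 aR3.
have bR : {subset b <= R7} by apply/allP; rewrite /= bR1 bR2 bR3.
have pa t : p iA (linN a t) by apply: closed_linN; rewrite //= pa1 pa2 pa3.
have pb t : p iB (linN b t) by apply: closed_linN; rewrite //= pb1 pb2 pb3.
have lc t : linN [:: c1; c2; c3] t = linN a t ^^ linN b t.
  by rewrite -linN_add //; congr (linN _ t); rewrite E1 E2 E3.
have pc t : p iC (linN a t ^^ linN b t).
  rewrite -lc; apply: closed_linN => //; last by rewrite /all q1 q2 q3.
  by apply/allP; rewrite /all R1 R2 R3.
have laR t : linN a t \in R7 := linN_R7 t aR.
have lbR t : linN b t \in R7 := linN_R7 t bR.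
(* If the first component vanishes, the vector of the third plane lies in the second, hence is 0. *)
have indA t : t \in rng 8 -> linN a t = 0%num -> t = 0%num.
  move=> tR a0; apply: (indC t tR); rewrite lc a0 N.lxor_0_l.
  have pct : p iC (linN b t) by have := pc t; rewrite a0 N.lxor_0_l.
  exact: (sys_pp S BI CI BC (lbR t) (pb t) pct).
have indB t : t \in rng 8 -> linN b t = 0%num -> t = 0%num.
  move=> tR b0; apply: (indC t tR); rewrite lc b0 N.lxor_0_r.
  have pct : p iC (linN a t) by have := pc t; rewrite b0 N.lxor_0_r.
  exact: (sys_pp S AI CI AC (laR t) (pa t) pct).
pose B := [:: a1; a2; a3; b1; b2; b3; e]; pose f := linN B.
have BR : {subset B <= R7} by apply/allP; rewrite /= aR1 aR2 aR3 bR1 bR2 bR3 eR.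
have fR : {in R7, forall x, f x \in R7} by move=> x _; apply: linN_R7.
have fA t : t \in rng 8 -> f (linN gA t) = linN a t.
  by move=> _; rewrite /f linN_map ?linN0 //; [rewrite /= 12?N.lxor_0_r 12?N.lxor_0_l | apply: linN_lxor].
have fB t : t \in rng 8 -> f (linN gB t) = linN b t.
  by move=> _; rewrite /f linN_map ?linN0 //; [rewrite /= 12?N.lxor_0_r 12?N.lxor_0_l | apply: linN_lxor].
have f64 : f 64%num = e by rewrite /f /= 7?N.lxor_0_l 7?N.lxor_0_r.
have fk x : x \in R7 -> pdot (f x) k0 = pdot x 64.
  have f6 z : z \in R6 -> pdot (f z) k0 = false.
    move=> zR; have /hasP[t tR /hasP[u uR /eqP ->]] := allP split_R6 z zR.
    rewrite /f linN_lxor -/f fA // fB // pdotD.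
    by rewrite (orthP oA (laR t) (pa t)) (orthP oB (lbR u) (pb u)).
  move=> xR; have [x6|[y y6 ->]] := R7_case xR; first by rewrite f6 // (pdot64 x6).
  by rewrite /f linN_lxor -/f f64 pdotD ke f6 // (pdot64 y6).
have fI : {in R7 &, injective f}.
  move=> x y xR yR E; apply: lxor_eq0; set z := x ^^ y; have zR : z \in R7 by apply: R7_lxor.
  have fz : f z = 0%num by rewrite /f linN_lxor -/f E N.lxor_nilpotent.
  have z6 : z \in R6.
    have := fk z zR; rewrite fz; have [//|[w w6 ->]] := R7_case zR.
    by rewrite (pdot64 w6) /pdot N.land_0_l.
  have /hasP[t tR /hasP[u uR /eqP zE]] := allP split_R6 z z6.
  have ab : linN a t = linN b u.
    by apply: lxor_eq0; rewrite -fA // -fB // -/f -linN_lxor -zE.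
  have a0 : linN a t = 0%num by apply: (sys_pp S AI BI AB) => //; rewrite ab.
  by rewrite zE (indA t tR a0) (indB u uR (etrans (esym ab) a0)) !linN0.
have [D bD] := dual_exists BR erefl fI.
have [s' [nI' sg']] := frame_sys bD S.
have hk : linN D 64%num = k0.
  apply: pdot_sep => //; first exact: frame_R7r bD _.
  move=> x xR; have [y yR <-] := R7_surj fR fI xR.
  rewrite pdotC [RHS]pdotC fk // (frame_pdot bD) //; by vm_compute.
have R64 : 64%num \in R7 by vm_compute.
have [eA eB eC] := planes_gen.
have fD x y : f (x ^^ y) = f x ^^ f y by apply: linN_lxor.
have p8 m : m \in ABC -> count (bit m) R7 = 8 by move=> mA; apply/eqP; apply: (allP planes_count).
have gR g : all (fun v => v \in R7) g -> {subset g <= R7} by move=> /allP.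
exists (fun i => p i \o linN B), (fun j => d j \o linN D); split.
- exact: s'.
- by apply: contra bad.
- apply/haspP; exists iA => //.
  have gAR : {subset gA <= R7} by apply: gR; vm_compute.
  have mA : planeA \in ABC by rewrite inE eqxx.
  apply: (plane_img gAR fD fR fI AI eA (p8 _ mA)).
  have r t : t \in rng 8 -> p iA (f (linN gA t)) by move=> tR; rewrite fA // pa.
  by apply/and4P; split; [exact: (r 1%num isT)|exact: (r 2%num isT)|exact: (r 4%num isT)|].
- apply/haspP; exists iB => //.
  have gBR : {subset gB <= R7} by apply: gR; vm_compute.
  have mB : planeB \in ABC by rewrite !inE eqxx orbT.
  apply: (plane_img gBR fD fR fI BI eB (p8 _ mB)).
  have r t : t \in rng 8 -> p iB (f (linN gB t)) by move=> tR; rewrite fB // pb.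
  by apply/and4P; split; [exact: (r 1%num isT)|exact: (r 2%num isT)|exact: (r 4%num isT)|].
- apply/haspP; exists iC => //.
  have gCR : {subset gC <= R7} by apply: gR; vm_compute.
  have mC : planeC \in ABC by rewrite !inE eqxx !orbT.
  apply: (plane_img gCR fD fR fI CI eC (p8 _ mC)).
  have fC t : t \in rng 8 -> p iC (f (linN gA t ^^ linN gB t)) by move=> tR; rewrite fD fA // fB // pc.
  by apply/and4P; split; [exact: (fC 1%num isT)|exact: (fC 2%num isT)|exact: (fC 4%num isT)|].
- by rewrite nI' // hk.
- by have := nj; rewrite /nJ /= hk.
Qed.
End Frame.

Lemma sys_good : sgood I J p d.
Proof.
apply/negPn/negP => bad; have [k [kR k0 n3 nj]] := bad_functional bad.
have [iA [iB [iC [[AI BI CI] [[AB AC BC] [oA oB oC]]]]]] := three_planes n3.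
have [p' [d' H]] := sys_frame kR k0 AI BI CI AB AC BC oA oB oC bad n3 nj.
exact: no_NS H.
Qed.
End Good.

(** * Counting flags *)

Lemma fold_bits_xor (A : Type) (f g : A -> bool) s :
  fold_bits (fun x => f x (+) g x) s = fold_bits f s ^^ fold_bits g s.
Proof.
elim: s => //= x s ->; case: (f x); case: (g x); case: (fold_bits f s) => [|a]; case: (fold_bits g s) => [|b] //=.
all: by case: (Pos.lxor a b).
Qed.

Lemma pdot_double a k : pdot (N.double a) k = pdot a (N.div2 k).
Proof. by case: a k => [|a] [|[k|k|]] //=; rewrite /pdot /=; case: (Pos.land a k). Qed.

Lemma pdot_succ_double a k : pdot (N.succ_double a) k = N.odd k (+) pdot a (N.div2 k).
Proof. by case: a k => [|a] [|[k|k|]] //=; rewrite /pdot /=; case: (Pos.land a k). Qed.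

Lemma pdot_fold_bits (A : Type) (f : A -> bool) s k :
  pdot (fold_bits f s) k = lin addb false [seq f x | x <- s] k.
Proof.
elim: s k => [|x s IH] k; first by rewrite /pdot N.land_0_l.
by rewrite [fold_bits _ _]/=; case E : (f x); rewrite ?pdot_succ_double ?pdot_double IH /= E; case: (N.odd k).
Qed.

(** * Codes in an abstract space of 256 vectors with a nondegenerate form *)

Section Spaces.
Variables (T : finType) (add : T -> T -> T) (o : T) (dot : T -> T -> bool).
Local Notation "x +o y" := (add x y) (at level 50, left associativity).
Hypothesis addA : associative add.
Hypothesis add0 : right_id o add.
Hypothesis addvv : forall x, x +o x = o.
Hypothesis dotD : forall x y z, dot (x +o y) z = dot x z (+) dot y z.
Hypothesis dotC : forall x y, dot x y = dot y x.
Hypothesis dot_nondeg : forall x, x != o -> exists y, dot x y.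
Hypothesis cardT : #|T| = 256.
Implicit Types (U W : {set T}) (x y P h : T).

Definition subsp U := (o \in U) && [forall x in U, forall y in U, (x +o y) \in U].

Lemma subsp0 U : subsp U -> o \in U. Proof. by case/andP. Qed.
Lemma subspD U x y : subsp U -> x \in U -> y \in U -> (x +o y) \in U.
Proof. by case/andP=> _ /'forall_implyP H xU yU; move/forallP: (H x xU) => /(_ y) /implyP; apply. Qed.

Lemma subspP U : o \in U -> (forall x y, x \in U -> y \in U -> (x +o y) \in U) -> subsp U.
Proof.
move=> U0 UD; rewrite /subsp U0 /=; apply/'forall_implyP => x xU.
by apply/'forall_implyP => y yU; apply: UD.
Qed.

Lemma dot0 x : dot o x = false.
Proof. by have := dotD o o x; rewrite add0; case: (dot _ _). Qed.

Lemma dotDr x y z : dot x (y +o z) = dot x y (+) dot x z.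
Proof. by rewrite dotC dotD !(dotC x). Qed.

Lemma addvK x y : x +o y +o y = x. Proof. by rewrite -addA addvv add0. Qed.

Fact perp_key : unit. Proof. exact: tt. Qed.
Definition perp U := locked_with perp_key [set y | [forall x in U, ~~ dot x y]].

Lemma perpP U y : reflect (forall x, x \in U -> dot x y = false) (y \in perp U).
Proof.
rewrite [perp U]unlock inE; apply: (iffP 'forall_implyP) => H x /H; first by move/negbTE.
by move=> ->.
Qed.

Lemma subsp_perp U : subsp (perp U).
Proof.
apply: subspP; first by apply/perpP => x _; rewrite dotC dot0.
by move=> x y /perpP Hx /perpP Hy; apply/perpP => z zU; rewrite dotDr Hx ?Hy.
Qed.

(** Translation by a vector of U not orthogonal to y exchanges the two values of the form. *)
Lemma card_dot_half U y : subsp U -> y \notin perp U ->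
  #|[set x in U | ~~ dot x y]| * 2 = #|U|.
Proof.
move=> sU; rewrite [perp U]unlock inE negb_forall => /existsP[u]; rewrite negb_imply negbK => /andP[uU duy].
have tr (x : T) : x \in U -> (x +o u) \in U by move=> xU; apply: subspD.
have E : [set x in U | dot x y] = [set (x +o u) | x in [set x in U | ~~ dot x y]].
  apply/setP => x; rewrite inE; apply/andP/imsetP => [[xU dx] | [z]].
    by exists (x +o u); rewrite ?addvK // inE tr //= dotD dx duy.
  by rewrite inE => /andP[zU dz] ->; rewrite tr // dotD duy (negbTE dz).
have C : #|[set x in U | dot x y]| = #|[set x in U | ~~ dot x y]|.
  by rewrite E card_imset // => a b /(congr1 (fun t => (t +o u))); rewrite !addvK.
rewrite muln2 -addnn -{1}C -cardsUI; apply/eqP; rewrite -[X in _ == X]addn0; apply/eqP; congr (_ + _).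
  by apply: eq_card => x; rewrite !inE; case: (x \in U); case: (dot x y).
by apply/eqP; rewrite cards_eq0; apply/eqP/setP => x; rewrite !inE; case: (dot x y); rewrite ?andbF.
Qed.

Lemma subspT : subsp [set: T].
Proof. by apply: subspP => *; rewrite inE. Qed.

Lemma perpT : perp [set: T] = [set o].
Proof.
apply/setP => y; rewrite in_set1; apply/perpP/eqP => [H | -> x _]; last by rewrite dotC dot0.
apply/eqP/negP => /negP /dot_nondeg[x]; rewrite dotC H //; by rewrite inE.
Qed.

Lemma card_orth U y : subsp U ->
  #|[set x in U | ~~ dot x y]| * 2 = #|U| + (y \in perp U) * #|U|.
Proof.
move=> sU; case: (boolP (y \in perp U)) => [Hy | Hn].
  have H := perpP _ _ Hy; rewrite mul1n addnn -muln2; congr (_ * 2); apply: eq_card => x; rewrite inE.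
  by case: (boolP (x \in U)) => //= /H ->.
by rewrite card_dot_half // addn0.
Qed.

(* Count the orthogonal pairs in U x W twice. *)
Lemma orth_pairs U W : subsp U -> subsp W ->
  #|W| * (#|U| + #|U :&: perp W|) = #|U| * (#|W| + #|W :&: perp U|).
Proof.
have half (A B : {set T}) : subsp B ->
    2 * \sum_(x in A) #|[set y in B | ~~ dot y x]| = #|B| * (#|A| + #|A :&: perp B|).
  move=> sB; rewrite big_distrr /=.
  under eq_bigr => x _ do rewrite mulnC card_orth //.
  rewrite big_split /= sum_nat_const -big_distrl /= mulnDr [#|A| * _]mulnC; congr (_ + _).
  rewrite mulnC; congr (_ * _); rewrite -sum1_card big_mkcond [RHS]big_mkcond /=.
  by apply: eq_bigr => x _; rewrite !inE; case: (x \in A).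
move=> sU sW; rewrite -!half //; congr (2 * _).
transitivity (\sum_(x in U) \sum_(y in W | ~~ dot y x) 1).
  by apply: eq_bigr => x _; rewrite sum1_card; apply: eq_card => y; rewrite !inE.
rewrite (exchange_big_dep (mem W)) /=; last by move=> x y _ /andP[].
apply: eq_bigr => y yW; rewrite sum1_card; apply: eq_card => x.
by rewrite !inE /= unfold_in /= yW dotC.
Qed.

Lemma card_perp U : subsp U -> #|U| * #|perp U| = 256.
Proof.
move=> sU; have := orth_pairs sU subspT.
rewrite perpT setTI cardsT cardT.
have -> : U :&: [set o] = [set o].
  by apply/setP => x; rewrite !inE; case: eqP => [->|]; rewrite ?subsp0 ?andbF.
rewrite cards1; nia.
Qed.

Lemma perpK U : subsp U -> perp (perp U) = U.
Proof.
move=> sU; apply/esym/eqP; rewrite eqEcard; apply/andP; split.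
  by apply/subsetP => x xU; apply/perpP => y /perpP H; rewrite dotC H.
have := card_perp sU; have := card_perp (subsp_perp U); nia.
Qed.

(** This is [orth_pairs] for [perp U] and [W], both of size 16. *)
Lemma card_perpI U W : subsp U -> subsp W -> #|U| = 16 -> #|W| = 16 ->
  #|perp U :&: perp W| = #|U :&: W|.
Proof.
move=> sU sW cU cW; have := orth_pairs (subsp_perp U) sW.
have := card_perp sU; rewrite cU perpK // => E; have -> : #|perp U| = 16 by lia.
rewrite cW (setIC W); lia.
Qed.

Definition code (C : {set {set T}}) :=
  (forall U, U \in C -> subsp U /\ #|U| = 16) /\
  (forall U W, U \in C -> W \in C -> U != W -> #|U :&: W| <= 2).

Definition thru (C : {set {set T}}) P := #|[set U in C | P \in U]|.
(** A hyperplane is given by its normal vector, so points and hyperplanes have the same type and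
    [dual] exchanges [thru] and [under]. *)
Definition under (C : {set {set T}}) h := #|[set U in C | h \in perp U]|.
Definition flag (C : {set {set T}}) P h := #|[set U in C | (P \in U) && (h \in perp U)]|.
Definition dual (C : {set {set T}}) := [set perp U | U in C].

Section Code.
Variable C : {set {set T}}.
Hypothesis codeC : code C.

Lemma code_subsp U : U \in C -> subsp U. Proof. by case/(proj1 codeC). Qed.
Lemma code_card U : U \in C -> #|U| = 16. Proof. by case/(proj1 codeC). Qed.

Lemma code_card_perp U : U \in C -> #|perp U| = 16.
Proof. by move=> UC; have := card_perp (code_subsp UC); rewrite code_card //; lia. Qed.

Lemma perp_inj_code : {in C &, injective perp}.
Proof.
move=> U W UC WC E; rewrite -(perpK (code_subsp UC)) E perpK //; exact: code_subsp.
Qed.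

Lemma code_dual : code (dual C).
Proof.
split=> [_ /imsetP[U UC ->] | _ _ /imsetP[U UC ->] /imsetP[W WC ->]].
  by split; [apply: subsp_perp | apply: code_card_perp].
move=> UW; rewrite card_perpI; try exact: code_subsp; try exact: code_card.
by apply: (proj2 codeC) UC WC _; apply: contraNneq UW => ->.
Qed.

Lemma card_dual : #|dual C| = #|C|.
Proof. exact: card_in_imset perp_inj_code. Qed.

Lemma dual_count (p : pred {set T}) :
  #|[set U in dual C | p U]| = #|[set U in C | p (perp U)]|.
Proof.
rewrite -(card_in_imset (D := [set U in C | p (perp U)]) (f := perp)).
  apply: eq_card => U; rewrite inE; apply/andP/imsetP => [[/imsetP[W WC ->] pW] | [W]].
    by exists W; rewrite // inE WC.
  by rewrite inE => /andP[WC pW] ->; split=> //; apply: imset_f.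
by move=> U W; rewrite !inE => /andP[UC _] /andP[WC _]; apply: perp_inj_code.
Qed.

Lemma thru_dual h : thru (dual C) h = under C h.
Proof. exact: dual_count. Qed.

Lemma under_dual P : under (dual C) P = thru C P.
Proof.
rewrite /under dual_count; apply: eq_card => U; rewrite !inE.
by case: (boolP (U \in C)) => // UC; rewrite perpK //; apply: code_subsp.
Qed.

Lemma flag_dual P h : flag (dual C) h P = flag C P h.
Proof.
rewrite /flag dual_count; apply: eq_card => U; rewrite !inE.
by case: (boolP (U \in C)) => // UC; rewrite (perpK (code_subsp UC)) /= andbC.
Qed.

Lemma code_capP P U W : P != o -> U \in C -> W \in C -> P \in U -> P \in W -> U != W ->
  U :&: W = [set o; P].
Proof.
move=> P0 UC WC PU PW UW; apply/esym/eqP; rewrite eqEcard cards2 eq_sym P0.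
rewrite (proj2 codeC U W UC WC UW) andbT; apply/subsetP => x; rewrite !inE.
by case/orP=> /eqP ->; rewrite ?PU ?PW ?(subsp0 (code_subsp _)).
Qed.

(* [ctr a] is (a-1)(a-2), which truncated subtraction would get wrong at a = 0. *)
Definition ctr a := if a is 0 then 2 else a.-1 * a.-2.

Lemma ctrE a : a * a + 2 = 3 * a + ctr a.
Proof. by case: a => [|[|a]] //=; nia. Qed.

Definition hyps P := [set h | (h != o) && ~~ dot P h].

Lemma perp_sub_hyps P U : P \in U -> perp U :\ o \subset hyps P.
Proof.
by move=> PU; apply/subsetP => h; rewrite !inE => /andP[-> /perpP ->].
Qed.

Lemma card_hyps P : P != o -> #|hyps P| = 127.
Proof.
move=> P0; have : P \notin perp [set: T] by rewrite perpT in_set1.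
move/(card_dot_half subspT); rewrite cardsT cardT => E.
have -> : hyps P = [set h in [set: T] | ~~ dot h P] :\ o.
  by apply/setP => h; rewrite !inE dotC.
move: E; rewrite (cardsD1 o) !inE dot0 /=; lia.
Qed.

Section Point.
Variable P : T.
Hypothesis P0 : P != o.
Local Notation CP := [set U in C | P \in U].
Local Notation a := (thru C P).

Lemma flagE h : flag C P h = \sum_(U in CP) (h \in perp U).
Proof.
rewrite /flag -sum1_card [LHS]big_mkcond [RHS]big_mkcond; apply: eq_bigr => U _.
by rewrite !inE; case: (U \in C); case: (P \in U); case: (h \in perp U).
Qed.

Lemma sum_hyps (A : {set T}) : A :\ o \subset hyps P ->
  \sum_(h in hyps P) (h \in A : nat) = #|A :\ o|.
Proof.
move=> sA; rewrite -sum1_card [LHS]big_mkcond [RHS]big_mkcond; apply: eq_bigr => h _.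
move/subsetP: sA => /(_ h); rewrite !inE.
by case: (h == o) => //=; case: (h \in A) => //= [-> //|_]; case: (dot P h).
Qed.

Lemma sum_flag : \sum_(h in hyps P) flag C P h = 15 * a.
Proof.
under eq_bigr => h _ do rewrite flagE.
rewrite exchange_big /= (eq_bigr (fun _ => 15)); first by rewrite sum_nat_const mulnC.
move=> U; rewrite inE => /andP[UC PU]; rewrite sum_hyps ?perp_sub_hyps //.
have := cardsD1 o (perp U); rewrite (subsp0 (subsp_perp _)) code_card_perp //; lia.
Qed.

(** A codeword U through P lies in 15 hyperplanes, and with each other codeword through P, which it
    meets only in P, it spans one hyperplane: 15 + (a - 1) for each U. *)
Lemma sum_flag_sqr : \sum_(h in hyps P) flag C P h * flag C P h = a * (a + 14).
Proof.
under eq_bigr => h _ do rewrite flagE big_distrlr /=.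
rewrite exchange_big /= (eq_bigr (fun _ => a + 14)); first by rewrite sum_nat_const.
move=> U UP; have := UP; rewrite inE => /andP[UC PU].
rewrite exchange_big /= (bigD1 U) //= (eq_bigr (fun h => (h \in perp U : nat))); last first.
  by move=> h _; case: (h \in perp U).
rewrite sum_hyps ?perp_sub_hyps // (eq_bigr (fun _ => 1)).
  rewrite sum1_card; have := cardsD1 o (perp U).
  rewrite (subsp0 (subsp_perp _)) code_card_perp //.
  have := cardsD1 U CP; rewrite UP -[#|CP|]/a.
  have -> : #|[pred W in CP | W != U]| = #|CP :\ U|.
    by apply: eq_card => W; rewrite !inE andbC.
  set k1 := #|CP :\ U|. set k2 := #|perp U :\ o|. set k3 := thru C P. lia.
move=> W /andP[]; rewrite inE => /andP[WC PW] WU.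
rewrite (eq_bigr (fun h => (h \in perp U :&: perp W : nat))); last first.
  by move=> h _; rewrite inE; case: (h \in perp U); case: (h \in perp W).
rewrite sum_hyps; last by apply: subset_trans (perp_sub_hyps PU); rewrite setSD ?subsetIl.
have := cardsD1 o (perp U :&: perp W); rewrite inE !(subsp0 (subsp_perp _)).
rewrite card_perpI; try exact: code_subsp; try exact: code_card.
by rewrite (code_capP P0) // 1?eq_sym // cards2 eq_sym P0; lia.
Qed.

Lemma sum_ctr : \sum_(h in hyps P) ctr (flag C P h) + 31 * a = a * a + 254.
Proof.
have : \sum_(h in hyps P) (flag C P h * flag C P h + 2) =
       \sum_(h in hyps P) (3 * flag C P h + ctr (flag C P h)).
  by apply: eq_bigr => h _; apply: ctrE.
rewrite !big_split /= sum_flag sum_flag_sqr !sum_nat_const card_hyps //; set k := a; set s := bigop _ _ _; lia.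
Qed.

Lemma disjoint_union (A : {set T}) : A \subset ~: [set o; P] ->
  \sum_(U in CP) #|U :&: A| <= #|A|.
Proof.
move=> sA; rewrite (eq_bigr (fun U : {set T} => \sum_(x in A) (x \in U : nat))); last first.
  move=> U _; rewrite -sum1_card big_mkcond [RHS]big_mkcond; apply: eq_bigr => x _.
  by rewrite inE andbC; case: (x \in A); case: (x \in U).
rewrite exchange_big -sum1_card; apply: leq_sum => x xA.
have : ~~ (x \in [set o; P]) by have /subsetP/(_ _ xA) := sA; rewrite inE.
apply: contraNT; rewrite -ltnNge => H.
have [U UP xU] : exists2 U, U \in CP & x \in U.
  apply/exists_inP; apply: contraLR H => /exists_inPn H; rewrite -leqNgt big1 // => U UP.
  by rewrite (negbTE (H _ UP)).
move: H; rewrite (bigD1 U) //= xU => H.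
have [W WP xW] : exists2 W, W \in CP :\ U & x \in W.
  apply/exists_inP; apply: contraLR H => /exists_inPn H; rewrite -leqNgt big1 // => W /andP[WP WU].
  by rewrite (negbTE (H _ _)) // in_setD1 WU.
move: UP WP; rewrite !inE => /andP[UC PU] /and3P[WU WC PW].
by have := code_capP P0 UC WC PU PW; rewrite eq_sym => /(_ WU) /setP/(_ x); rewrite !inE xU xW.
Qed.

Lemma union_bound : 14 * a <= 254.
Proof.
have := disjoint_union (subxx _); rewrite (eq_bigr (fun _ => 14)).
  rewrite sum_nat_const -[#|CP|]/a; have := cardsC [set o; P].
  by rewrite cardT cards2 eq_sym P0; lia.
move=> U; rewrite inE => /andP[UC PU]; have := cardsID [set o; P] U.
have -> : U :&: [set o; P] = [set o; P].
  by apply/setIidPr/subsetP => x; rewrite !inE => /orP[] /eqP ->; rewrite ?(subsp0 (code_subsp _)).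
by rewrite setDE (code_card UC) cards2 eq_sym P0 => /(congr1 (fun n => n - 2)); rewrite addKn.
Qed.

(** Outside 0 and P, codewords through P are disjoint. Of the 126 such vectors in h, a codeword
    takes 14 if it lies in h and 6 otherwise; of the 128 vectors off h, one not in h takes 8. *)
Lemma flag_bounds h : h \in hyps P ->
  8 * flag C P h + 6 * a <= 126 /\ a <= flag C P h + 16.
Proof.
rewrite inE => /andP[h0 Ph].
have hT : h \notin perp [set: T] by rewrite perpT in_set1.
have := card_dot_half subspT hT; rewrite cardsT cardT => cH.
have cU U : U \in CP -> #|[set x in U | ~~ dot x h]| = 8 + 8 * (h \in perp U).
  rewrite inE => /andP[UC PU]; have := card_orth h (code_subsp UC); rewrite (code_card UC); set k := #|_|; case: (h \in _); lia.
have sf : \sum_(U in CP) (8 + 8 * (h \in perp U)) = 8 * a + 8 * flag C P h.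
  by rewrite big_split /= sum_nat_const -big_distrr /= -flagE mulnC.
set H := [set x in [set: T] | ~~ dot x h] in cH.
have PH : [set o; P] \subset H.
  by apply/subsetP => x; rewrite !inE => /orP[] /eqP ->; rewrite ?dot0.
split.
  have := disjoint_union (A := H :\: [set o; P]); rewrite setDE subsetIr => /(_ isT).
  rewrite -setDE cardsD (setIidPr PH) cards2 eq_sym P0.
  rewrite (eq_bigr (fun U => 6 + 8 * (h \in perp U))); last first.
    move=> U UP; have := cU _ UP; move: UP; rewrite inE => /andP[UC PU].
    rewrite setDE setIA; have -> : U :&: H = [set x in U | ~~ dot x h].
      by apply/setP => x; rewrite !inE.
    set UH := [set x in U | _]; have := cardsID [set o; P] UH; rewrite setDE.
    have -> : UH :&: [set o; P] = [set o; P].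
      apply/setIidPr/subsetP => x; rewrite !inE => /orP[] /eqP ->; rewrite ?dot0 ?PU //.
      by rewrite (subsp0 (code_subsp UC)).
    by rewrite cards2 eq_sym P0; set k := #|_|; set k' := #|UH|; lia.
  move: sf; rewrite !big_split /= !sum_nat_const -[#|CP|]/a; lia.
have := disjoint_union (A := ~: H); rewrite setCS PH => /(_ isT).
have := cardsC H; rewrite cardT.
rewrite [\sum_(U in CP) _](eq_bigr (fun U : {set T} => 8 - 8 * (h \in perp U))); last first.
  move=> U UP; have := cU _ UP; move: UP; rewrite inE => /andP[UC PU].
  have := cardsID H U; rewrite setDE (code_card UC); have -> : U :&: H = [set x in U | ~~ dot x h].
    by apply/setP => x; rewrite !inE.
  lia.
have : \sum_(U in CP) (8 - 8 * (h \in perp U)) + \sum_(U in CP) 8 * (h \in perp U) =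
       \sum_(U in CP) 8.
  by rewrite -big_split; apply: eq_bigr => U _; case: (h \in perp U).
move: sf; rewrite !big_split /= !sum_nat_const -[#|CP|]/a; lia.
Qed.

(** At degree 18 the two bounds force every flag to be 2, where [ctr] vanishes, whereas [sum_ctr]
    asks for a total of 20. *)
Lemma thru_le17 : a <= 17.
Proof.
have := union_bound; rewrite leqNgt => Ha; apply/negP => a17.
have a18 : a = 18 by lia.
have := sum_ctr; rewrite big1 ?a18 // => h /flag_bounds; rewrite a18 => -[].
by case: (flag C P h) => [|[|[|k]]] //=; lia.
Qed.

Lemma flag17 h : a = 17 -> h \in hyps P -> ctr (flag C P h) = 2 * (flag C P h == 3).
Proof.
by move=> a17 /flag_bounds; rewrite a17; case: (flag C P h) => [|[|[|[|k]]]] //=; lia.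
Qed.

(** The total of [ctr] is 17^2 - 31 * 17 + 254 = 16, and the flags lie between 1 and 3, so only the
    value 3 contributes, with 2 each. *)
Lemma count_flag3 : a = 17 -> #|[set h in hyps P | flag C P h == 3]| = 8.
Proof.
move=> a17; have := sum_ctr; rewrite a17 (eq_bigr (fun h => 2 * (flag C P h == 3))).
  rewrite -big_distrr /=; have -> : \sum_(h in hyps P) (flag C P h == 3) =
      #|[set h in hyps P | flag C P h == 3]|.
    rewrite -sum1_card big_mkcond [RHS]big_mkcond; apply: eq_bigr => h _.
    by rewrite !inE; case: (h == o); case: (dot P h); case: (_ == 3).
  lia.
by move=> h; apply: flag17.
Qed.

Local Notation g := #|[set h in hyps P | flag C P h == 3]|.

(** A flag of 3 contributes 2 to the sum of [ctr] and 6 to the sum of f (f - 1), which is a^2 -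
    a. *)
Lemma flag3_bounds : 2 * g + 31 * a <= a * a + 254 /\ 6 * g + a <= a * a.
Proof.
have le (f : T -> nat) c : (forall h, flag C P h = 3 -> c <= f h) -> c * g <= \sum_(h in hyps P) f h.
  move=> Hf; rewrite mulnC -sum_nat_const big_mkcond [X in _ <= X]big_mkcond; apply: leq_sum => h _.
  rewrite inE; case: (h \in hyps P) => //=; case: eqP => // /Hf; lia.
split.
  by rewrite -sum_ctr leq_add2r; apply: le => h ->.
have : 6 * g <= \sum_(h in hyps P) (flag C P h * flag C P h - flag C P h).
  by apply: le => h ->.
have : \sum_(h in hyps P) (flag C P h * flag C P h - flag C P h) + \sum_(h in hyps P) flag C P h
  = \sum_(h in hyps P) flag C P h * flag C P h.
  by rewrite -big_split; apply: eq_bigr => h _ /=; rewrite subnK //; case: (flag C P h) => // k; nia.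
by rewrite sum_flag sum_flag_sqr; nia.
Qed.
End Point.
End Code.

Definition good C P := 14 <= \sum_(h in hyps P | flag C P h == 3) wt (17 - under C h).

(** The first inequality suffices for degrees 8 to 17, the second takes over below. *)
Lemma wt_bound a g : a <= 17 -> 2 * g + 31 * a <= a * a + 254 -> 6 * g + a <= a * a ->
  wt (17 - a) * g <= 14 * (17 - a).-1.
Proof. by do 18! [case: a => [|a]; first by rewrite /wt /=; lia]. Qed.

Lemma sum_thru C : code C -> \sum_(P | P != o) thru C P = 15 * #|C|.
Proof.
move=> codeC; rewrite (eq_bigr (fun P => \sum_(U in C) (P \in U : nat))); last first.
  move=> P _; rewrite /thru -sum1_card [LHS]big_mkcond [RHS]big_mkcond; apply: eq_bigr => U _.
  by rewrite !inE; case: (U \in C); case: (P \in U).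
rewrite exchange_big /= (eq_bigr (fun _ => 15)); first by rewrite sum_nat_const mulnC.
move=> U UC; have := cardsD1 o U; rewrite (subsp0 (code_subsp codeC UC)) (code_card codeC UC).
have -> : #|U :\ o| = \sum_(P | P != o) (P \in U).
  rewrite -sum1_card big_mkcond [RHS]big_mkcond; apply: eq_bigr => P _.
  by rewrite !inE; case: (P == o); case: (P \in U).
by set k := bigop _ _ _; lia.
Qed.

(** Double count of the pairs (P, h) where h is full and holds exactly three codewords through P,
    each pair weighted by the deficiency of P. *)
Lemma accounting C : code C -> 273 <= #|C| ->
  (forall h, h != o -> under C h = 17 -> good (dual C) h) ->
  #|[set h | (h != o) && (under C h == 17)]| + 15 <= #|[set P | (P != o) && (thru C P == 17)]|.
Proof.
move=> codeC Cn Hg; set Z' := [set h | _]; set Z := [set P | _].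
pose F P := #|[set h in hyps P | flag C P h == 3]|.
have le1 : 14 * #|Z'| <= \sum_(P | P != o) wt (17 - thru C P) * F P.
  apply: (@leq_trans (\sum_(h in Z') \sum_(P in hyps h | flag C P h == 3) wt (17 - thru C P))).
    rewrite mulnC -sum_nat_const; apply: leq_sum => h; rewrite inE => /andP[h0 /eqP uh].
    apply: leq_trans (Hg h h0 uh) _; apply: eq_leq.
    by apply: eq_big => [P|P _]; rewrite ?flag_dual ?under_dual.
  rewrite (exchange_big_dep (fun P => P != o)) /=; last first.
    by move=> h P _ /andP[]; rewrite inE => /andP[].
  apply: leq_sum => P P0; rewrite mulnC -sum_nat_const big_mkcond [X in _ <= X]big_mkcond.
  apply: leq_sum => h _; rewrite !inE [dot P h]dotC.
  by case: (h == o) => //=; case: (under C h == 17); case: (dot h P); case: (_ == 3); rewrite ?P0.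
have le2 : \sum_(P | P != o) wt (17 - thru C P) * F P <= 14 * \sum_(P | P != o) (17 - thru C P).-1.
  rewrite big_distrr; apply: leq_sum => P P0 /=.
  by have [] := flag3_bounds codeC P0; apply: wt_bound; apply: thru_le17.
have card1 : \sum_(P : T | P != o) 1 = 255.
  rewrite sum1_card; have := cardC1 o; rewrite cardT => /= E.
  by rewrite -[RHS]/(256.-1) -E; apply: eq_card => x; rewrite !inE.
(* The truncated predecessor takes 1 off at each of the 255 points except those of degree 17. *)
have e1 : \sum_(P | P != o) (17 - thru C P).-1 + 255 =
          \sum_(P | P != o) (17 - thru C P) + #|Z|.
  rewrite -card1 -[#|Z|]sum1_card [\sum_(P in Z) 1]big_mkcond /=.
  rewrite [\sum_(P : T) _](bigID (fun P => P != o)) /= [X in _ = _ + (_ + X)]big1 ?addn0; last first.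
    by move=> P; rewrite negbK inE => /eqP ->; rewrite eqxx.
  rewrite -!big_split; apply: eq_bigr => P P0 /=; rewrite inE P0 /=.
  by have := thru_le17 codeC P0; case: eqP => [->|] //; lia.
(* The total deficiency is at most 17 * 255 - 15 * 273 = 240, which is 15 less than the number of
   points. *)
have e2 : \sum_(P | P != o) (17 - thru C P) + 15 * #|C| = 17 * 255.
  rewrite -sum_thru // -big_split -card1 big_distrr; apply: eq_bigr => P P0 /=.
  by rewrite subnK ?thru_le17.
move: le1 le2 e1 e2 Cn; set k1 := #|Z'|; set k2 := #|Z|; set k3 := #|C|.
set s1 := bigop _ _ _; set s2 := bigop _ _ _; set s3 := bigop _ _ _; lia.
Qed.

Lemma code_size_bound : (forall C, code C -> 273 <= #|C| ->
    forall P, P != o -> thru C P = 17 -> good C P) ->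
  forall C, code C -> #|C| <= 272.
Proof.
move=> H C codeC; rewrite leqNgt; apply/negP => Cn.
have codeD := code_dual codeC; have Dn : 273 <= #|dual C| by rewrite card_dual.
have K1 h : h != o -> under C h = 17 -> good (dual C) h.
  by move=> h0 uh; apply: H => //; rewrite thru_dual.
have := accounting codeC Cn K1.
have dd U : U \in C -> perp (perp U) = U by move=> UC; rewrite perpK //; apply: code_subsp UC.
have := accounting codeD Dn.
have -> : dual (dual C) = C.
  apply/setP => U; apply/imsetP/idP => [[_ /imsetP[W WC ->] ->] | UC]; first by rewrite dd.
  by exists (perp U); rewrite ?dd // imset_f.
have K h : h != o -> under (dual C) h = 17 -> good C h.
  by move=> h0; rewrite under_dual // => uh; apply: H.
move/(_ K).
have -> : [set h | (h != o) && (under (dual C) h == 17)] = [set P | (P != o) && (thru C P == 17)].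
  by apply/setP => P; rewrite !inE under_dual.
have -> : [set P | (P != o) && (thru (dual C) P == 17)] = [set h | (h != o) && (under C h == 17)].
  by apply/setP => P; rewrite !inE thru_dual.
set k1 := #|_|; set k2 := #|_|; lia.
Qed.

Lemma add0l x : o +o x = x. Proof. by rewrite -{1}(addvv x) -addA addvv add0. Qed.

Lemma addC x y : x +o y = y +o x.
Proof.
have E : (x +o y) +o (y +o x) = o by rewrite addA -(addA x y y) addvv add0 addvv.
by rewrite -(addvK (x +o y) (y +o x)) E add0l.
Qed.

(** Greedy extension: n independent vectors have at most 2^n combinations, so a larger subspace has
    a vector outside their span. *)
Lemma lin_kernel n (H : {set T}) : subsp H -> 2 ^ n <= #|H| -> exists h : seq T,
  [/\ size h = n, {subset h <= H} & forall x : N, N.to_nat x < 2 ^ n -> lin add o h x = o -> x = 0%num].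
Proof.
move=> sH; elim: n => [|n IH] Hn.
  by exists [::]; split=> // x; rewrite expn0 ltnS leqn0 => /eqP x0 _; clear -x0; lia.
have Hn' : 2 ^ n <= #|H| by apply: leq_trans Hn; rewrite leq_exp2l.
have [h [sh hH hk]] := IH Hn'.
pose im := [set lin add o h (N.of_nat i) | i : 'I_(2 ^ n)].
have [w wH wim] : exists2 w, w \in H & w \notin im.
  apply/exists_inP; apply: contraLR Hn => /exists_inPn Hw; rewrite -ltnNge.
  apply: (@leq_ltn_trans #|im|).
    by apply/subset_leq_card/subsetP => w wH; have := Hw w wH; rewrite negbK.
  by apply: leq_ltn_trans (leq_imset_card _ _) _; rewrite card_ord ltn_exp2l.
exists (w :: h); split; first by rewrite /= sh.
  by move=> x; rewrite inE => /orP[/eqP -> // | /hH].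
move=> x xn /=; have E := div2_double_cases x; rewrite expnS in xn.
have dn : N.to_nat (N.div2 x) < 2 ^ n by move: (2 ^ n) xn => m xn; clear -xn E; case: (N.odd x) E => E; lia.
case: (N.odd x) E => E H0; last first.
  rewrite add0l in H0; have d0 := hk _ dn H0.
  by rewrite d0 in E.
case/negP: wim; apply/imsetP; exists (Ordinal dn) => //=; rewrite Nnat.N2Nat.id.
have := congr1 (fun z => z +o lin add o h (N.div2 x)) H0; rewrite addvK add0l; exact.
Qed.

(** * The local system at a point of degree 17 *)

Section FromCode.
Variables (C : {set {set T}}) (P : T).
Hypotheses (codeC : code C) (C273 : 273 <= #|C|) (P0 : P != o) (P17 : thru C P = 17).

Let H := perp [set o; P].

Lemma subsp_line : subsp [set o; P].
Proof.
apply: subspP => [|x y]; first by rewrite !inE eqxx.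
by rewrite !inE => /orP[] /eqP -> /orP[] /eqP ->; rewrite ?add0 ?add0l ?addvv ?eqxx ?orbT.
Qed.

Lemma card_H : #|H| = 128.
Proof. by have := card_perp subsp_line; rewrite cards2 eq_sym P0 -/H; lia. Qed.

Lemma in_H h : (h \in H) = ~~ dot P h.
Proof.
apply/perpP/idP => [Hh|dP x]; first by rewrite Hh // !inE eqxx orbT.
by rewrite !inE => /orP[] /eqP ->; [apply: dot0 | apply/negbTE].
Qed.

Variable hb : seq T.
Hypotheses (hb7 : size hb = 7) (hbH : {subset hb <= H}).
Hypothesis hbk : forall x : N, N.to_nat x < 2 ^ 7 -> lin add o hb x = o -> x = 0%num.

(** [psi] numbers the functionals vanishing at P; [Phi] is the quotient map onto V/P in dual
    coordinates, its digits being the values of the functionals [hb]. *)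
Let psi := lin add o hb.
Let Phi v := fold_bits (dot v) hb.

Lemma psi_lxor (x y : N) : psi (x ^^ y) = psi x +o psi y.
Proof. by apply: lin_lxor => //; apply: addC. Qed.

Lemma psi_H k : psi k \in H.
Proof.
rewrite /psi; move: hbH; elim: (hb) k => [|w s IH] k sH /=; first exact: subsp0 (subsp_perp _).
have kH : lin add o s (N.div2 k) \in H by apply: IH => x xs; apply: sH; rewrite inE xs orbT.
have wH : (if N.odd k then w else o) \in H.
  by case: (N.odd k); [apply: sH; rewrite inE eqxx | exact: subsp0 (subsp_perp _)].
exact: subspD (subsp_perp _) wH kH.
Qed.

Lemma psi_inj : {in R7 &, injective psi}.
Proof.
move=> x y xR yR E; apply: lxor_eq0; apply: hbk.
  by have := R7_lxor xR yR; rewrite mem_rng.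
by rewrite -/psi psi_lxor E addvv.
Qed.

Lemma psi_enum : perm_eq (map psi R7) (enum H).
Proof.
have us : uniq (map psi R7) by rewrite map_inj_in_uniq; [exact: rng_uniq | exact: psi_inj].
have sub : {subset map psi R7 <= enum H} by move=> _ /mapP[k _ ->]; rewrite mem_enum psi_H.
have sz : size (enum H) <= size (map psi R7) by rewrite -cardE card_H size_map size_rng.
by have [_ E] := uniq_min_size us sub sz; apply: uniq_perm => //; rewrite enum_uniq.
Qed.

Lemma count_psi (a : pred T) : count (fun k => a (psi k)) R7 = #|[set h in H | a h]|.
Proof.
rewrite -[LHS](count_map psi a) (permP psi_enum) cardsE cardE -size_filter /enum_mem -filter_predI.
by congr size; apply: eq_filter => h /=; rewrite andbC.
Qed.

Lemma Phi_pdot v k : pdot (Phi v) k = dot v (psi k).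
Proof.
rewrite /Phi pdot_fold_bits /psi; elim: (hb) k => [|w s IH] k /=; first by rewrite dotC dot0.
by rewrite IH dotDr; case: (N.odd k); rewrite // (dotC v o) dot0.
Qed.

Lemma PhiD v w : Phi (v +o w) = Phi v ^^ Phi w.
Proof.
rewrite /Phi -fold_bits_xor /fold_bits; elim: (hb) => //= x s ->.
by rewrite dotD.
Qed.

Lemma Phi_R7 v : Phi v \in R7.
Proof.
rewrite /Phi; have -> : fold_bits (dot v) hb = fold_bits id [seq dot v w | w <- hb].
  by rewrite /fold_bits; elim: (hb) => //= x s ->.
by apply: fold_bits_R7; rewrite size_map.
Qed.

Lemma Phi0 v : (Phi v == 0%num) = (v \in [set o; P]).
Proof.
apply/eqP/idP => [E|vP].
  rewrite -(perpK subsp_line); apply/perpP => h hH.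
  have : h \in map psi R7 by rewrite (perm_mem psi_enum) mem_enum.
  by move=> /mapP[k kR ->]; rewrite dotC -Phi_pdot E /pdot N.land_0_l.
apply: pdot_sep; [exact: Phi_R7|exact: R7_0|] => k kR.
rewrite Phi_pdot /pdot N.land_0_l; apply: (perpP _ _ (psi_H k)); exact: vP.
Qed.

Let pl (U : {set T}) (x : N) := [exists v in U, Phi v == x].
Let du (U : {set T}) (k : N) := psi k \in perp U.
Let I := [set U in C | P \in U].
Let J := [set U in C | P \notin U].

Lemma plP U (x : N) : reflect (exists2 v, v \in U & Phi v = x) (pl U x).
Proof. by apply: (iffP exists_inP) => -[v vU /eqP E]; exists v => //; apply/eqP. Qed.

Lemma Phi_eq v w : Phi v = Phi w -> v = w \/ v = w +o P.
Proof.
move=> E; have : Phi (v +o w) == 0%num by rewrite PhiD E N.lxor_nilpotent.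
rewrite Phi0 !inE => /orP[] /eqP E'; [left|right]; have := congr1 (fun z => z +o w) E'; rewrite addvK => ->.
  exact: add0l.
exact: addC.
Qed.

(** The map [Phi] has kernel {0, P}, so it is two-to-one on a subspace containing P. *)
Lemma count_pl U : subsp U -> P \in U -> #|U| = 16 -> count (pl U) R7 = 8.
Proof.
move=> sU PU cU.
have E : \sum_(k <- R7) #|[set v in U | Phi v == k]| = 16.
  rewrite -cU -sum1_card (eq_bigr (fun k => \sum_(v in U) (Phi v == k : nat))); last first.
    move=> k _; rewrite -sum1_card big_mkcond [RHS]big_mkcond; apply: eq_bigr => v _.
    by rewrite inE; case: (v \in U); case: (Phi v == k).
  rewrite exchange_big; apply: eq_bigr => v _ /=.
  have -> : \sum_(k <- R7) (Phi v == k : nat) = count (pred1 (Phi v)) R7.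
    by rewrite -sum1_count [RHS]big_mkcond; apply: eq_bigr => k _; rewrite /= eq_sym; case: (_ == _).
  by rewrite count_uniq_mem ?rng_uniq // Phi_R7.
have E2 : \sum_(k <- R7) #|[set v in U | Phi v == k]| = 2 * count (pl U) R7.
  rewrite -sum1_count big_distrr big_mkcond [RHS]big_mkcond; apply: eq_bigr => k _ /=.
  case: (boolP (pl U k)) => [/plP[v vU vx]|npl]; last first.
    apply/eqP; rewrite cards_eq0; apply/eqP/setP => v; rewrite !inE; apply/negP => /andP[vU /eqP vx].
    by case/negP: npl; apply/plP; exists v.
  have -> : [set v in U | Phi v == k] = [set v; v +o P].
    apply/setP => w; rewrite !inE; apply/andP/orP => [[wU /eqP wx]|].
      by case: (@Phi_eq w v); rewrite ?wx ?vx // => ->; rewrite eqxx; [left|right].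
    case=> /eqP ->; first by rewrite vU vx.
    rewrite (subspD sU vU PU) PhiD vx; have -> : Phi P = 0%num by apply/eqP; rewrite Phi0 !inE eqxx orbT.
    by rewrite N.lxor_0_r.
  rewrite cards2 (_ : v != v +o P) //; apply: contra P0 => /eqP Ev.
  by have := congr1 (fun z => v +o z) Ev; rewrite addvv addA addvv add0l => <-.
by move: E; rewrite E2; lia.
Qed.

Lemma orth_pl U k : orth (pl U) k = (psi k \in perp U).
Proof.
apply/allP/perpP => [Hk v vU|Hk z zR].
  have := Hk (Phi v) (Phi_R7 v); rewrite (introT (plP U _)); last by exists v.
  by rewrite Phi_pdot => /negbTE.
by apply/implyP => /plP[v vU <-]; rewrite Phi_pdot Hk.
Qed.

Lemma nI_pl k : nI I pl k = flag C P (psi k).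
Proof.
rewrite /nI /flag; apply: eq_card => U; rewrite !inE orth_pl.
by case: (U \in C); case: (P \in U).
Qed.

Lemma flag_o : flag C P o = thru C P.
Proof.
apply: eq_card => U; rewrite !inE (subsp0 (subsp_perp U)); by rewrite andbT.
Qed.

Lemma psi0 : psi 0%num = o.
Proof. by rewrite /psi; elim: (hb) => //= w s ->; rewrite add0. Qed.

Lemma code_sys : sys I J pl du.
Proof.
have IC U : U \in I -> U \in C /\ P \in U by rewrite inE => /andP[].
have JC U : U \in J -> U \in C /\ P \notin U by rewrite inE => /andP[].
split.
- exact: P17.
(* At least 273 - 17 = 256 codewords miss P. *)
- have := cardsID [set U : {set T} | P \in U] C.
  have -> : C :&: [set U : {set T} | P \in U] = I by apply/setP => U; rewrite !inE.
  have -> : C :\: [set U : {set T} | P \in U] = J by apply/setP => U; rewrite !inE andbC.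
  have -> : #|I| = 17 by exact: P17.
  by move: C273; set m := #|C|; set k := #|J|; lia.
- move=> U /IC[UC PU]; have sU := code_subsp codeC UC; split; last exact: count_pl (code_card codeC UC).
  split=> [|x y _ _ /plP[v vU <-] /plP[w wU <-]].
    by apply/plP; exists o; [exact: subsp0 | apply/eqP; rewrite Phi0 !inE eqxx].
  by apply/plP; exists (v +o w); [exact: subspD | exact: PhiD].
- move=> U W z /IC[UC PU] /IC[WC PW] UW _ /plP[v vU vx] /plP[w wW wx].
  have vW : v \in W.
    case: (@Phi_eq v w); rewrite ?vx ?wx // => ->; first exact: wW.
    exact: (subspD (code_subsp codeC WC) wW PW).
  apply/eqP; rewrite -vx Phi0 -(code_capP codeC P0 UC WC PU PW UW) inE vU; exact: vW.
(* As P is not in U, it is not orthogonal to all of [perp U], and exactly half of these functionals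
   vanish at P. *)
- move=> U /JC[UC PU]; have sP := subsp_perp U; split.
    split=> [|x y _ _ dx dy]; first by rewrite /du psi0 subsp0.
    by rewrite /du psi_lxor; exact: (subspD sP dx dy).
  rewrite (count_psi (fun h => h \in perp U)).
  have := card_dot_half sP (y := P); rewrite (perpK (code_subsp codeC UC)) (code_card_perp codeC UC) => /(_ PU).
  have -> : [set h in H | h \in perp U] = [set x in perp U | ~~ dot x P].
    by apply/setP => h; rewrite !inE in_H dotC andbC.
  by set k := #|_|; lia.
- move=> U W /JC[UC _] /JC[WC _] UW; rewrite (count_psi (fun h => (h \in perp U) && (h \in perp W))).
  apply: leq_trans (proj2 codeC U W UC WC UW).
  rewrite -(card_perpI (code_subsp codeC UC) (code_subsp codeC WC) (code_card codeC UC) (code_card codeC WC)).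
  by apply/subset_leq_card/subsetP => h; rewrite !inE => /and3P[_ -> ->].
- move=> U W /IC[UC PU] /JC[WC PW].
  have UW : U != W by apply: contraNneq PW => <-.
  rewrite (eq_count (a2 := fun k => (psi k \in perp W) && (psi k \in perp U))); last first.
    by move=> k; rewrite /= orth_pl.
  rewrite (count_psi (fun h => (h \in perp W) && (h \in perp U))).
  apply: leq_trans (proj2 codeC U W UC WC UW).
  rewrite -(card_perpI (code_subsp codeC UC) (code_subsp codeC WC) (code_card codeC UC) (code_card codeC WC)).
  by apply/subset_leq_card/subsetP => h; rewrite !inE => /and3P[_ -> ->].
rewrite (eq_count (a2 := fun k => flag C P (psi k) == 3)); last by move=> k; rewrite nI_pl.
rewrite (count_psi (fun h => flag C P h == 3)) -(count_flag3 codeC P0 P17).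
apply: eq_card => h; rewrite !inE in_H; case: (eqVneq h o) => [->|] //=.
by rewrite flag_o P17 andbF.
Qed.

Lemma code_good_aux : good C P.
Proof.
have := sys_good code_sys; rewrite /sgood /good => Hs; apply: leq_trans Hs _; apply: eq_leq.
transitivity (\sum_(h <- map psi R7 | flag C P h == 3) wt (17 - under C h)); last first.
  rewrite (perm_big _ psi_enum) big_enum_cond /=; apply: eq_bigl => h.
  rewrite !inE in_H; case: (eqVneq h o) => [->|] //=.
  by rewrite flag_o P17 andbF.
rewrite big_map; apply: eq_big => [k|k n3]; first by rewrite nI_pl.
(* The codewords in the hyperplane are three through P and those counted by [nJ]. *)
congr wt; have -> : under C (psi k) = flag C P (psi k) + nJ J du k.
  rewrite /under /nJ -(cardsID [set U : {set T} | P \in U]); congr (_ + _); apply: eq_card => U; rewrite !inE /du.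
    by case: (U \in C); case: (P \in U); case: (psi k \in perp U).
  by case: (U \in C); case: (P \in U); case: (psi k \in perp U).
by move: n3; rewrite nI_pl => /eqP ->; set m := nJ _ _ _; lia.
Qed.
End FromCode.

Lemma code_good C : code C -> 273 <= #|C| -> forall P, P != o -> thru C P = 17 -> good C P.
Proof.
move=> codeC C273 P P0 P17.
have [|h [sh hH hk]] := @lin_kernel 7 (perp [set o; P]) (subsp_perp _); first by rewrite (card_H C273 P0 P17).
exact: (code_good_aux codeC C273 P0 P17 sh hH hk).
Qed.

Theorem code_le272 C : code C -> #|C| <= 272.
Proof. exact: code_size_bound code_good C. Qed.
End Spaces.

(** * Transport to vector spaces over F_2 *)

Lemma card_points (F : finFieldType) (V : vectType F) (U : {vspace V}) :
  #|[set u : finvect_type V | (u : V) \in U]| = #|F| ^ \dim U.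
Proof.
case: V U => S cV U; rewrite -(@card_vspace F (finvect_type (Vector.Pack cV)) cV U).
by apply: eq_card => u; rewrite inE.
Qed.

Section Transport.
Import GRing.Theory VectorInternalTheory.
Local Open Scope ring_scope.
Variables (F : finFieldType) (V : vectType F).
Hypotheses (F2 : #|F| = 2%nat) (V8 : \dim {:V} = 8%nat).

Lemma F2_cases (x : F) : x = 0 \/ x = 1.
Proof.
have sub : [set 0; 1] \subset [set: F] by apply: subsetT.
have E : [set 0; 1] = [set: F].
  by apply/eqP; rewrite eqEcard sub cardsT F2 cards2 eq_sym oner_neq0.
have : x \in [set 0; 1] by rewrite E inE.
by rewrite !inE => /orP[] /eqP ->; [left | right].
Qed.

Lemma F2_11 : 1 + 1 = 0 :> F.
Proof.
case: (F2_cases (1 + 1)) => // /eqP.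
by rewrite -[X in _ == X]addr0 (inj_eq (addrI _)) oner_eq0.
Qed.

Lemma F2_addNeq (x y : F) : (x + y != 0) = (x != 0) (+) (y != 0).
Proof.
by case: (F2_cases x) => ->; case: (F2_cases y) => ->; rewrite ?addr0 ?add0r ?F2_11 ?eqxx ?oner_eq0.
Qed.

Let T : finType := finvect_type V.
Let add (u v : T) : T := (u : V) + v.
(** The standard form in coordinates; over F_2, being nonzero is an isomorphism onto the Booleans
    under exclusive or. *)
Let dot (u v : T) := \sum_i v2r (u : V) 0 i * v2r (v : V) 0 i != 0.
Let pts (U : {vspace V}) : {set T} := [set u : T | (u : V) \in U].

Lemma addvv_F2 (u : T) : add u u = 0.
Proof. by rewrite /add -[(u : V)]scale1r -scalerDl F2_11 scale0r. Qed.

Lemma dotD_F2 (u v w : T) : dot (add u v) w = dot u w (+) dot v w.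
Proof.
rewrite /dot -F2_addNeq -big_split; congr (_ != 0); apply: eq_bigr => i _.
by rewrite /add linearD mxE mulrDl.
Qed.

Lemma dotC_F2 (u v : T) : dot u v = dot v u.
Proof. by rewrite /dot; congr (_ != 0); apply: eq_bigr => i _; rewrite mulrC. Qed.

Lemma dot_nondeg_F2 (u : T) : u != 0 -> exists v : T, dot u v.
Proof.
move=> u0; have [i ui] : exists i, v2r (u : V) 0 i != 0.
  apply/existsP; apply: contraNT u0 => /existsPn H.
  have E : v2r (u : V) = 0.
    by apply/rowP => i; rewrite mxE; apply/eqP/negPn/H.
  by rewrite -(v2rK (u : V)) E linear0.
exists (r2v (delta_mx 0 i) : V); rewrite /dot r2vK (bigD1 i) //= big1 => [|j ji].
  by rewrite mxE !eqxx mulr1 addr0.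
by rewrite mxE eqxx (negbTE ji) mulr0.
Qed.

Lemma card_pts (U : {vspace V}) : #|pts U| = (2 ^ \dim U)%nat.
Proof.
by rewrite -F2 -card_points.
Qed.

Lemma card_T : #|T| = 256%nat.
Proof.
rewrite -cardsT; have -> : [set: T] = pts fullv by apply/setP => u; rewrite !inE memvf.
by rewrite card_pts V8.
Qed.

Lemma pts_inj : injective pts.
Proof. by move=> U W /setP E; apply/vspaceP => u; have := E u; rewrite !inE. Qed.

Lemma card_constant_dim (C : {set {vspace V}}) :
  (forall U, U \in C -> \dim U = 4%nat) ->
  (forall U W, U \in C -> W \in C -> U != W -> (6 <= subspace_dist U W)%nat) -> (#|C| <= 272)%nat.
Proof.
move=> C4 C6; rewrite -(card_imset _ pts_inj).
apply: (@code_le272 T add 0 dot) => //.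
- by move=> u v w; apply: addrA.
- by move=> u; apply: addr0.
- exact: addvv_F2.
- exact: dotD_F2.
- exact: dotC_F2.
- exact: dot_nondeg_F2.
- exact: card_T.
split=> [_ /imsetP[U UC ->]|_ _ /imsetP[U UC ->] /imsetP[W WC ->] UW].
  split; last by rewrite card_pts C4.
  apply: subspP; first by rewrite inE mem0v.
  by move=> u v; rewrite !inE; apply: memvD.
have UW' : U != W by apply: contraNneq UW => ->.
have -> : pts U :&: pts W = pts (U :&: W) by apply/setP => u; rewrite !inE memv_cap.
rewrite card_pts -[X in (_ <= X)%nat](expn1 2) leq_exp2l //.
(* For 4-spaces, distance at least 6 means 8 - 2 m >= 6, so the intersection has dimension m at most
   1 and at most two vectors. *)
have := C6 U W UC WC UW'; rewrite subspace_distE (C4 U UC) (C4 W WC).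
by move: (\dim (U :&: W)) => m; clear; lia.
Qed.
End Transport.

Theorem mainTheorem1 (F : finFieldType) (V : vectType F) :
  #|F| = 2 -> \dim {:V} = 8 ->
  max_code_size V 6 4 <= 272 /\
  (forall (N : nat) (C : {set {vspace V}}),
     constant_dim_code 8 N 6 4 C -> N <= 272).
Proof.
move=> F2 V8.
have bound N (C : {set {vspace V}}) : constant_dim_code 8 N 6 4 C -> N <= 272.
  case/and4P=> _ /eqP <- /andP[/'forall_implyP dC _] /'forall_implyP kC.
  apply: (card_constant_dim F2 V8) => [U UC|U W UC WC UW]; first exact/eqP/kC.
  by have /'forall_implyP/(_ W WC)/implyP/(_ UW) := dC U UC.
split; last exact: bound.
by apply/bigmax_leqP => C; rewrite V8; apply: bound.
Qed.
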